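(* Let $\eta>0$ and let $k,\ell,d$ be integers with $1\le \ell<k/2$ and $\ell<d\le k-1$. Then there exists $n_0$ such that every $k$-graph $H$ on $n\ge n_0$ vertices with $(k-\ell)\mid n$ and $$\delta_d(H)\ge\left(\max\{t(k,d,\ell),\,1/3\}+\eta\right)\binom{n}{k-d}$$ contains a Hamilton $\ell$-cycle. That is, $h_d^\ell(k)\le\max\{t(k,d,\ell),1/3\}$.
   Context: A $k$-graph $H=(V,E)$ ($k\ge 2$) has a vertex set $V$ and an edge set $E\subseteq\binom{V}{k}$. For $S\in\binom{V}{d}$, $\deg_H(S)$ is the number of $T\in\binom{V}{k-d}$ with $S\cup T\in E$, and the minimum $d$-degree $\delta_d(H)$ is the minimum of $\deg_H(S)$ over all $S\in\binom{V}{d}$. For $1\le \ell<k$, a $k$-graph is an $\ell$-cycle if there is a cyclic ordering of its vertices such that every edge consists of $k$ consecutive vertices and any two consecutive edges (in the natural order of the edges) share exactly $\ell$ vertices. A $k$-graph on $n$ vertices contains a Hamilton $\ell$-cycle if it contains an $\ell$-cycle as a spanning subhypergraph; this forces $(k-\ell)\mid n$. For $(k-\ell)\mid n$ and $1\le d\le k-1$, $h_d^\ell(k,n)$ denotes the smallest integer $h$ such that every $n$-vertex $k$-graph $H$ with $\delta_d(H)\ge h$ contains a Hamilton $\ell$-cycle, and $h_d^\ell(k):=\limsup_{n\to\infty} h_d^\ell(k,n)/\binom{n}{k-d}$, where $n$ ranges over multiples of $k-\ell$. For $k>b\ge 0$, $Y_{k,b}$ is the $k$-graph consisting of two edges that intersect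 in exactly $b$ vertices. For $k$-graphs $F$ and $H$, an $F$-tiling in $H$ is a subgraph of $H$ consisting of vertex-disjoint copies of $F$. For $k\ge 3$, $1\le\ell<k/2$, $1\le d\le k-1$ and $\varepsilon>0$, $t_d^\ell(k,n,\varepsilon)$ denotes the minimum $t$ such that every $k$-graph $H$ on $n$ vertices with $\delta_d(H)\ge t$ contains a $Y_{k,2\ell}$-tiling covering all but at most $\varepsilon n$ vertices of $H$, and $$t(k,d,\ell):=\limsup_{\varepsilon\to 0}\,\limsup_{n\to\infty}\frac{t_d^\ell(k,n,\varepsilon)}{\binom{n}{k-d}}.$$ *)

(* Defs.v *)
From HB Require Import structures.
From mathcomp Require Import all_boot all_order all_algebra.

Set Implicit Arguments.
Unset Strict Implicit.
Unset Printing Implicit Defensive.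

Structure kgraph (k : nat) (V : finType) := KGraph {
  edges : {set {set V}};
  edges_card : {in edges, forall e : {set V}, #|e| = k}
}.

Definition degree k (V : finType) (H : kgraph k V) (S : {set V}) : nat :=
  #|[set T : {set V} | (#|T| == k - #|S|) && (S :|: T \in edges H)]|.

(* The initial value 'C(#|V|, k - d) bounds every degree, so it is irrelevant
   as soon as d <= #|V|. *)
Definition mindegree k (d : nat) (V : finType) (H : kgraph k V) : nat :=
  \big[minn/'C(#|V|, k - d)]_(S : {set V} | #|S| == d) degree H S.

Lemma mindegree_le k (d : nat) (V : finType) (H : kgraph k V) :
  mindegree d H <= 'C(#|V|, k - d).
Proof.
rewrite /mindegree; apply: (big_rec (fun m => m <= 'C(#|V|, k - d))) => //.
by move=> S m _ IH; rewrite geq_min IH orbT.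
Qed.

(* The k consecutive vertices, in the cyclic ordering v, that start at
   position i. *)
Definition window (k : nat) (V : finType) (v : seq V) (i : nat) : seq V :=
  take k (rot i v).

(* Consecutive edges of an l-cycle share exactly l vertices, and these are the
   last l of the first edge and the first l of the second one.  Without the
   positional condition, two edges sharing l vertices, followed by arbitrarily
   many isolated vertices, would form an l-cycle, since each edge is the
   successor of the other. *)
Definition consecutive (k l : nat) (V : finType) (v : seq V) : rel nat :=
  fun i j =>
    (drop (k - l) (window k v i) == take l (window k v j)) &&
    (#|[set x in window k v i] :&: [set x in window k v j]| == l).

(* s lists the starting positions of the edges in their natural order. *)
Definition is_lcycle k (l : nat) (V : finType) (C : kgraph k V) : Prop :=
  exists (v : seq V) (s : seq nat),
    [/\ uniq v /\ (forall x, x \in v),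
        sorted ltn s /\ {in s, forall i, i < size v},
        s != [::],
        edges C = [set:: [seq [set x in window k v i] | i <- s]] &
        cycle (consecutive k l v) s].

Definition has_hamilton_lcycle k (l : nat) (V : finType) (H : kgraph k V)
    : Prop :=
  exists C : kgraph k V, edges C \subset edges H /\ is_lcycle l C.

Definition Y_edge1 (k b : nat) : {set 'I_(k + (k - b))} :=
  [set i : 'I_(k + (k - b)) | i < k].

Definition Y_edge2 (k b : nat) : {set 'I_(k + (k - b))} :=
  [set i : 'I_(k + (k - b)) | k - b <= i].

Lemma Y_edges_card (k b : nat) :
  {in [set Y_edge1 k b; Y_edge2 k b], forall e : {set 'I__}, #|e| = k}.
Proof.
move=> e; rewrite !inE => /orP[] /eqP ->.
- rewrite -sum1_card (eq_bigl (fun i : 'I_(k + (k - b)) => i < k)); last first.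
    by move=> i; rewrite inE.
  by rewrite -(big_ord_widen _ (fun=> 1)) ?leq_addr // sum1_card card_ord.
- suff E : #|~: Y_edge2 k b| = k - b.
    by have := cardsC (Y_edge2 k b); rewrite E card_ord => /addIn.
  rewrite -sum1_card (eq_bigl (fun i : 'I_(k + (k - b)) => i < k - b)).
    by rewrite -(big_ord_widen _ (fun=> 1)) ?leq_addl // sum1_card card_ord.
  by move=> i; rewrite !inE -ltnNge.
Qed.

Definition Ygraph (k b : nat) : kgraph k 'I_(k + (k - b)) :=
  KGraph (@Y_edges_card k b).

Lemma Y_edgesI (k b : nat) : b <= k -> #|Y_edge1 k b :&: Y_edge2 k b| = b.
Proof.
move=> le_bk; have U : Y_edge1 k b :|: Y_edge2 k b = [set: _].
  apply/setP=> i; rewrite !inE; case: ltnP => //= le_ki.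
  by rewrite (leq_trans _ le_ki) ?leq_subr.
have := cardsUI (Y_edge1 k b) (Y_edge2 k b).
rewrite U cardsT card_ord !(Y_edges_card (set21 _ _), Y_edges_card (set22 _ _)).
by rewrite -addnA => /addnI E; apply/eqP; rewrite -(eqn_add2l (k - b)) E subnK.
Qed.

Definition is_copy k (W V : finType) (F : kgraph k W) (H : kgraph k V)
    (f : {ffun W -> V}) : Prop :=
  injective f /\ {in edges F, forall e : {set W}, f @: e \in edges H}.

Definition is_tiling k (W V : finType) (F : kgraph k W) (H : kgraph k V)
    (T : {set {ffun W -> V}}) : Prop :=
  {in T, forall f, is_copy F H f} /\
  {in T &, forall f g : {ffun W -> V},
     f != g -> [disjoint f @: [set: W] & g @: [set: W]]}.

Definition covered (W V : finType) (T : {set {ffun W -> V}}) : {set V} :=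
  \bigcup_(f in T) f @: [set: W].

From mathcomp Require Import all_classical all_reals all_analysis.
Import Order.TTheory GRing.Theory Num.Theory.
Import numFieldNormedType.Exports.

Lemma mindegree_threshold_ex (k d n : nat) (P : kgraph k 'I_n -> Prop) :
  exists t, `[< forall H : kgraph k 'I_n, t <= mindegree d H -> P H >].
Proof.
exists 'C(n, k - d).+1; apply/asboolP => H; rewrite ltnNge.
by have := mindegree_le d H; rewrite card_ord => ->.
Qed.

Definition mindegree_threshold (k d n : nat) (P : kgraph k 'I_n -> Prop) : nat :=
  ex_minn (mindegree_threshold_ex d P).

Local Open Scope ring_scope.
Local Open Scope classical_set_scope.

Definition hamilton_threshold (k d l n : nat) : nat :=
  mindegree_threshold d (fun H : kgraph k 'I_n => has_hamilton_lcycle l H).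

Definition hamilton_density (R : realType) (k d l : nat) : \bar R :=
  limf_esup
    (fun n : nat =>
       ((hamilton_threshold k d l n)%:R / ('C(n, k - d))%:R : R)%:E)
    (within [set n | (k - l %| n)%N] \oo).

Definition has_almost_tiling (R : realType) k (W V : finType)
    (F : kgraph k W) (eps : R) (H : kgraph k V) : Prop :=
  exists T, is_tiling F H T /\ (#|~: covered T|%:R <= eps * #|V|%:R).

Definition tiling_threshold (R : realType) (k d l n : nat) (eps : R) : nat :=
  mindegree_threshold d
    (fun H : kgraph k 'I_n => has_almost_tiling (Ygraph k (2 * l)) eps H).

Definition tiling_density (R : realType) (k d l : nat) : \bar R :=
  limf_esup
    (fun eps : R =>
       limf_esup
         (fun n : nat =>
            ((tiling_threshold k d l n eps)%:R / ('C(n, k - d))%:R : R)%:E)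
         \oo)
    0^'+.

(* Main.v *)
(* Since [l < d], every set of at most [l + 1] vertices lies in a positive proportion of the
   [k]-sets as part of an edge.  Growing the set of reachable [l]-tuples along the windows of a
   [2l]-tuple shows that any two [l]-tuples are joined by many [l]-paths of a fixed length.  For
   most pairs of vertices, many small gadgets can exchange the two vertices; combining such
   gadgets gives many absorbers for every [(k - l)]-set that avoids a few bad vertices, and the
   bad vertices are covered by disjoint edges.  Disjoint families of absorbers and of connectors
   that meet each demand linearly often are chosen greedily, a demand that is met [c] times
   having weight [2 ^- c].

   Almost all other vertices are covered by long [l]-paths, which are removed one at a time.
   Most samples of boundedly many remaining vertices inherit the minimum [d]-degree, hence have
   an almost perfect [Y_(k,2l)]-tiling and contain a copy of [Y_(k,2l)] that is light for a
   given weight function; by supersaturation there is a light blow-up of [Y_(k,2l)], and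
   this contains a long light [l]-path.  As weights we take the derivatives of an exponential
   potential; it then stays small, which keeps all [d]-degrees into the remaining set large.
   Finally the reserved connectors link all paths into one cycle, and the uncovered vertices
   are absorbed. *)
From HB Require Import structures.
From mathcomp Require Import all_boot all_order all_algebra.
From mathcomp Require Import all_classical all_reals all_analysis.
From mathcomp Require Import zify ring lra.
Require Import Defs.
Set Implicit Arguments.
Unset Strict Implicit.
Unset Printing Implicit Defensive.
Import Order.TTheory GRing.Theory Num.Theory.
Import numFieldNormedType.Exports.

(** * Averages over tuples *)

(** Densities are averages over tuples with repetition: concatenation is then independence and
    connections compose by an exact identity, while degenerate tuples cost O(1/n). The obstacle
    behind the path cover is that the tiling threshold says nothing about what remains after badly
    chosen removals: the degree of some [d]-set may be ruined, and there are about [n ^ d] of them.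
    To first order, [D] loses relative degree when the removed vertices extend [D] better than an
    average vertex does. So a path should be no heavier than average for all [D] at once, and the
    potential, with a parameter linear in [n], compresses these requirements into one weight
    function. Absorbers cannot exchange arbitrary vertices, because only most pairs are
    exchangeable. Hence [S], together with the interior of an [l]-path, is exchanged against the
    interior of a random [l]-path that has the same ends and one more edge; the longer interior has
    exactly [k - l] more vertices. *)

Lemma perm_filter_notin (T : eqType) (s t : seq T) : uniq s -> uniq t -> {subset t <= s} ->
  perm_eq s (t ++ [seq x <- s | x \notin t]).
Proof.
move=> us ut ts; apply: uniq_perm => //.
  by rewrite cat_uniq ut filter_uniq // andbT; apply/hasPn => x; rewrite mem_filter => /andP[].
by move=> x; rewrite mem_cat mem_filter; case: (boolP (x \in t)) => [/ts|].
Qed.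

Lemma sumr_const_seq (R : pzSemiRingType) (I : Type) (s : seq I) (a : R) :
  (\sum_(x <- s) a = (size s)%:R * a)%R.
Proof. by rewrite big_const_seq count_predT iter_addr addr0 mulr_natl. Qed.

Section TupleAverages.
Variables (R : realFieldType) (V : eqType).
Implicit Types (W F : seq V) (f g : seq V -> R).
Local Open Scope ring_scope.

(** Repetitions are allowed, so that [Em_cat] and [Em_swap] are plain Fubini identities;
    [Em_nuniq_le] bounds what injectivity would change. *)
Fixpoint Sm W m f : R :=
  if m is m'.+1 then \sum_(x <- W) Sm W m' (fun s => f (x :: s)) else f [::].

Definition Em W m f : R := Sm W m f / (size W)%:R ^+ m.

Lemma le_Sm W m f g :
  (forall s, size s = m -> {subset s <= W} -> f s <= g s) ->
  Sm W m f <= Sm W m g.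
Proof.
elim: m f g => [|m IH] f g le_fg /=; first exact: le_fg.
rewrite big_seq [leRHS]big_seq; apply: ler_sum => x xW; apply: IH => s sm sW.
by apply: le_fg => [|y]; rewrite /= ?sm // inE => /predU1P[->|/sW].
Qed.

Lemma eq_Sm W m f g :
  (forall s, size s = m -> {subset s <= W} -> f s = g s) ->
  Sm W m f = Sm W m g.
Proof. by move=> eq_fg; apply/le_anti/andP; split; apply: le_Sm => s *; rewrite eq_fg. Qed.

Lemma SmD W m f g : Sm W m (fun s => f s + g s) = Sm W m f + Sm W m g.
Proof.
elim: m f g => //= m IH f g; rewrite -big_split.
by apply: eq_bigr => x _; rewrite IH.
Qed.

Lemma SmZ W m a f : Sm W m (fun s => a * f s) = a * Sm W m f.
Proof.
elim: m f => //= m IH f; rewrite mulr_sumr.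
by apply: eq_bigr => x _; rewrite IH.
Qed.

Lemma Sm_cst W m a : Sm W m (fun=> a) = a * (size W)%:R ^+ m.
Proof.
elim: m => [|m IH] /=; first by rewrite mulr1.
by rewrite IH sumr_const_seq mulrC exprSr mulrA.
Qed.

Lemma Sm0 W m : Sm W m (fun=> 0) = 0.
Proof. by rewrite Sm_cst mul0r. Qed.

Lemma Sm_sum W m (I : Type) (r : seq I) (P : pred I) (F : I -> seq V -> R) :
  Sm W m (fun s => \sum_(i <- r | P i) F i s) = \sum_(i <- r | P i) Sm W m (F i).
Proof.
elim: r => [|i r IH]; first by under eq_Sm do rewrite big_nil; rewrite big_nil Sm0.
under eq_Sm do rewrite big_cons; rewrite big_cons; case: (P i) => //.
by rewrite SmD IH.
Qed.

Lemma Sm_cat W a b f :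
  Sm W (a + b) f = Sm W a (fun x => Sm W b (fun y => f (x ++ y))).
Proof. by elim: a f => //= a IH f; apply: eq_bigr => x _; rewrite IH. Qed.

Lemma Sm_swap W W' a b (f : seq V -> seq V -> R) :
  Sm W a (fun x => Sm W' b (f x)) = Sm W' b (fun y => Sm W a (f^~ y)).
Proof.
elim: a f => //= a IH f; rewrite Sm_sum; apply: eq_bigr => x _.
exact: IH.
Qed.

Lemma Sm_ge0 W m f :
  (forall s, size s = m -> {subset s <= W} -> 0 <= f s) -> 0 <= Sm W m f.
Proof. by move=> f0; rewrite -(Sm0 W m); apply: le_Sm. Qed.

Lemma le_Em W m f g :
  (forall s, size s = m -> {subset s <= W} -> f s <= g s) ->
  Em W m f <= Em W m g.
Proof. by move=> le_fg; rewrite ler_wpM2r ?invr_ge0 ?exprn_ge0 // le_Sm. Qed.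

Lemma eq_Em W m f g :
  (forall s, size s = m -> {subset s <= W} -> f s = g s) ->
  Em W m f = Em W m g.
Proof. by rewrite /Em => /eq_Sm ->. Qed.

Lemma EmD W m f g : Em W m (fun s => f s + g s) = Em W m f + Em W m g.
Proof. by rewrite /Em SmD mulrDl. Qed.

Lemma EmZ W m a f : Em W m (fun s => a * f s) = a * Em W m f.
Proof. by rewrite /Em SmZ mulrA. Qed.

Lemma EmZr W m a f : Em W m (fun s => f s * a) = Em W m f * a.
Proof. by under eq_Em do rewrite mulrC; rewrite EmZ mulrC. Qed.

Lemma EmN W m f : Em W m (fun s => - f s) = - Em W m f.
Proof. by under eq_Em do rewrite -mulN1r; rewrite EmZ mulN1r. Qed.

Lemma EmB W m f g : Em W m (fun s => f s - g s) = Em W m f - Em W m g.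
Proof. by rewrite EmD EmN. Qed.

Lemma Em_cst W m a : (0 < size W)%N -> Em W m (fun=> a) = a.
Proof. by move=> W0; rewrite /Em Sm_cst mulfK // expf_neq0 // pnatr_eq0 -lt0n. Qed.

Lemma Em_sum W m (I : Type) (r : seq I) (P : pred I) (F : I -> seq V -> R) :
  Em W m (fun s => \sum_(i <- r | P i) F i s) = \sum_(i <- r | P i) Em W m (F i).
Proof. by rewrite /Em Sm_sum mulr_suml. Qed.

Lemma Em_ge0 W m f :
  (forall s, size s = m -> {subset s <= W} -> 0 <= f s) -> 0 <= Em W m f.
Proof. by move=> f0; rewrite mulr_ge0 ?invr_ge0 ?exprn_ge0 // Sm_ge0. Qed.

Lemma Em_le1 W m f :
  (0 < size W)%N -> (forall s, size s = m -> {subset s <= W} -> f s <= 1) ->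
  Em W m f <= 1.
Proof. by move=> W0 f1; rewrite -(Em_cst m 1 W0); apply: le_Em. Qed.

Lemma Em_cat W a b f :
  Em W (a + b) f = Em W a (fun x => Em W b (fun y => f (x ++ y))).
Proof.
rewrite /Em Sm_cat exprD invfM mulrA mulrAC; congr (_ * _).
by rewrite mulrC -SmZ; apply: eq_Sm => s _ _; rewrite mulrC.
Qed.

Lemma Em_swap W W' a b (f : seq V -> seq V -> R) :
  Em W a (fun x => Em W' b (f x)) = Em W' b (fun y => Em W a (f^~ y)).
Proof.
rewrite /Em; under eq_Sm do rewrite mulrC; rewrite SmZ Sm_swap.
by under [in RHS]eq_Sm do rewrite mulrC; rewrite SmZ; ring.
Qed.

Lemma Em0 W f : Em W 0 f = f [::].
Proof. by rewrite /Em expr0 divr1. Qed.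

Lemma Em1 W f : Em W 1 f = (\sum_(x <- W) f [:: x]) / (size W)%:R.
Proof. by rewrite /Em expr1. Qed.

Lemma EmS W m f : Em W m.+1 f = Em W 1 (fun x => Em W m (fun y => f (x ++ y))).
Proof. exact: (@Em_cat W 1 m). Qed.

Lemma Em_take W a b f :
  (0 < size W)%N -> Em W (a + b) (fun s => f (take a s)) = Em W a f.
Proof.
move=> W0; rewrite Em_cat; apply: eq_Em => x xa _.
by rewrite -[RHS](Em_cst b _ W0); apply: eq_Em => y *; rewrite -xa take_size_cat.
Qed.

Lemma Em_window W a b c f : (0 < size W)%N ->
  Em W (a + (b + c)) (fun s => f (take b (drop a s))) = Em W b f.
Proof.
move=> W0; rewrite Em_cat -(Em_cst a (Em W b f) W0); apply: eq_Em => x xa _.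
by rewrite -(Em_take b c _ W0); apply: eq_Em => y *; rewrite -xa drop_size_cat.
Qed.

Lemma Em_exists W m f a : (0 < size W)%N -> a <= Em W m f ->
  exists s, [/\ size s = m, {subset s <= W} & a <= f s].
Proof.
move=> W0; elim: m f => [|m IH] f; first by rewrite Em0; exists [::].
have N0 : 0 < (size W)%:R :> R by rewrite ltr0n.
rewrite EmS Em1 ler_pdivlMr // => le_a.
have /hasP[x xW] : has (fun x => a <= Em W m (fun y => f (x :: y))) W.
  apply: contraTT le_a => /hasPn lt_a; rewrite -ltNge.
  rewrite mulrC -sumr_const_seq big_seq [ltRHS]big_seq.
  apply: ltr_sum => [|x xW]; last by rewrite ltNge lt_a.
  by case: (W) W0 => // x W' _; apply/hasP; exists x; rewrite ?mem_head.
move=> /IH[s [sm sW le_as]]; exists (x :: s); split=> //=; rewrite ?sm //.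
by move=> y; rewrite inE => /predU1P[->|/sW].
Qed.

Lemma Em_mem_le W m F : uniq W -> (0 < size W)%N ->
  Em W m (fun s => (has (mem F) s)%:R) <= (m * size F)%:R / (size W)%:R.
Proof.
move=> uW W0; have N0 : 0 < (size W)%:R :> R by rewrite ltr0n.
elim: m => [|m IH]; first by rewrite Em0 mul0n mul0r.
rewrite EmS (@le_trans _ _ (Em W 1 (fun x => (has (mem F) x)%:R
    + Em W m (fun s => (has (mem F) s)%:R)))) //.
  apply: le_Em => x _ _; rewrite -[X in X + _](Em_cst m _ W0) -EmD.
  by apply: le_Em => s _ _; rewrite has_cat -natrD ler_nat; do 2 case: has.
rewrite EmD (Em_cst 1 _ W0) mulSn natrD mulrDl lerD // Em1.
rewrite ler_pdivrMr // divfK ?gt_eqF // -natr_sum ler_nat /=.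
under eq_bigr do rewrite orbF.
rewrite -big_mkcond sum1_count -size_filter uniq_leq_size ?filter_uniq //.
by move=> x; rewrite mem_filter => /andP[].
Qed.

Lemma Em_nuniq_le W m : uniq W -> (0 < size W)%N ->
  Em W m (fun s => (~~ uniq s)%:R) <= (m * m)%:R / (size W)%:R.
Proof.
move=> uW W0; have N0 : 0 < (size W)%:R :> R by rewrite ltr0n.
elim: m => [|m IH]; first by rewrite Em0 mul0r.
rewrite (@le_trans _ _ (Em W 1 (fun x => Em W m (fun s =>
    (has (mem s) x)%:R + (~~ uniq s)%:R)))) //.
  rewrite EmS; apply: le_Em => -[|x []] //= _ _; apply: le_Em => s _ _.
  by rewrite orbF negb_and negbK -natrD ler_nat; case: (_ \in _); case: uniq.
rewrite Em_swap (@le_trans _ _ (Em W m (fun s => m%:R / (size W)%:R + (~~ uniq s)%:R))) //.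
  apply: le_Em => s sm _; rewrite EmD (Em_cst 1 _ W0) lerD2r.
  by have := Em_mem_le 1 s uW W0; rewrite sm mul1n.
rewrite EmD (Em_cst m _ W0); apply: le_trans (lerD (lexx _) IH) _.
by rewrite -mulrDl -natrD ler_pM2r ?invr_gt0 // ler_nat; lia.
Qed.

(** Tuples with a repeated entry or an entry in [F] have density at most
    [m * (m + size F) / size W], which is less than [a]. *)
Lemma Em_fresh W m F (P : pred (seq V)) a : uniq W -> (0 < size W)%N ->
  a <= Em W m (fun s => (P s)%:R) ->
  (m * (m + size F))%:R < a * (size W)%:R ->
  exists s, [/\ size s = m, {subset s <= W}, P s, uniq s & ~~ has (mem F) s].
Proof.
move=> uW W0 le_a lt_a; have N0 : 0 < (size W)%:R :> R by rewrite ltr0n.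
pose Q s := [&& P s, uniq s & ~~ has (mem F) s].
pose b : R := a - (m * (m + size F))%:R / (size W)%:R.
have b0 : 0 < b by rewrite subr_gt0 ltr_pdivrMr.
have [|s [sm sW]] := @Em_exists W m (fun s => (Q s)%:R) b W0; last first.
  by case Qs: (Q s) => /=; [case/and3P: Qs; exists s | rewrite leNgt b0].
rewrite /b lerBlDr; apply: le_trans le_a _.
rewrite mulnDr natrD mulrDl.
apply: le_trans (lerD (lexx _) (lerD (Em_nuniq_le m uW W0) (Em_mem_le m F uW W0))).
rewrite -!EmD; apply: le_Em => s _ _; rewrite -!natrD ler_nat /Q.
by case: (P s) (uniq s) (has _ _) => [] [] [].
Qed.

Lemma Sm_ins W m i f : (i <= m)%N ->
  Sm W m.+1 f = \sum_(a <- W) Sm W m (fun y => f (take i y ++ a :: drop i y)).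
Proof.
move=> /subnKC def_m; rewrite -def_m -addnS Sm_cat /= Sm_sum.
apply: eq_bigr => a _; rewrite Sm_cat; apply: eq_Sm => x xi _.
by apply: eq_Sm => y _ _; rewrite -xi take_size_cat ?drop_size_cat.
Qed.

(** Induction on the number of coordinates: the coordinate listed first by [q] is summed outermost
    by [Sm_ins], and [unbump i] renumbers the remaining positions. *)
Lemma Sm_perm W m x0 (q : seq nat) f :
  uniq q -> size q = m -> {in q, forall i, (i < m)%N} ->
  Sm W m (fun x => f [seq nth x0 x i | i <- q]) = Sm W m f.
Proof.
elim: m q f => [|m IH] [|i q] f //= /andP[iq uq] [sq] ltq.
have lei : (i <= m)%N by rewrite -ltnS ltq ?mem_head.
rewrite -/(Sm W m.+1 (fun x => f (nth x0 x i :: [seq nth x0 x j | j <- q]))).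
rewrite (Sm_ins W (fun x => f (nth x0 x i :: [seq nth x0 x j | j <- q])) lei).
apply: eq_bigr => a _.
have qE : {in q, cancel (unbump i) (bump i)}.
  by move=> j jq; rewrite unbumpKcond; case: eqP iq jq => // -> /negP.
rewrite -[RHS](IH (map (unbump i) q)) ?size_map //.
- apply: eq_Sm => y ym _; congr (f _).
  have sti : size (take i y) = i by rewrite size_takel // ym.
  rewrite nth_cat sti ltnn subnn /=; congr (_ :: _); rewrite -map_comp.
  apply/eq_in_map => j jq /=; rewrite nth_cat sti.
  have := qE j jq; move: (unbump i j) => u <-; rewrite /bump.
  case: (leqP i u) => h; rewrite ?add1n ?add0n; last by rewrite h nth_take.
  by rewrite ltnNge leqW // subSn //= nth_drop subnKC.
- by rewrite map_inj_in_uniq // => x y /qE {2}<- /qE {2}<- ->.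
- move=> _ /mapP[j jq ->]; have := ltq j; rewrite inE jq orbT => /(_ isT).
  have: j != i by apply: contraTneq jq => ->.
  by rewrite /unbump; lia.
Qed.

Lemma Em_perm W m x0 (q : seq nat) f :
  uniq q -> size q = m -> {in q, forall i, (i < m)%N} ->
  Em W m (fun x => f [seq nth x0 x i | i <- q]) = Em W m f.
Proof. by move=> *; rewrite /Em Sm_perm. Qed.

End TupleAverages.

Section MapAverages.
Variables (R : realFieldType) (U V : eqType) (h : U -> V).
Local Open Scope ring_scope.

Lemma Sm_map (W : seq U) m (f : seq V -> R) :
  Sm (map h W) m f = Sm W m (fun s => f (map h s)).
Proof. by elim: m f => //= m IH f; rewrite big_map; apply: eq_bigr => x _; rewrite IH. Qed.

Lemma Em_map (W : seq U) m (f : seq V -> R) :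
  Em (map h W) m f = Em W m (fun s => f (map h s)).
Proof. by rewrite /Em Sm_map size_map. Qed.

End MapAverages.

Lemma Sm_enum (R : realFieldType) (T : finType) m (f : seq T -> R) :
  Sm (enum T) m f = (\sum_(t : m.-tuple T) f t)%R.
Proof.
elim: m f => [|m IH] f /=.
  by rewrite (big_pred1 [tuple]) // => t; apply/esym/eqP/val_inj; case: t => [[]].
rewrite big_enum /= (eq_bigr _ (fun x _ => IH _)) pair_big /=.
rewrite (reindex (fun p : T * m.-tuple T => [tuple of p.1 :: p.2])) //=.
exists (fun t : m.+1.-tuple T => (thead t, [tuple of behead t])) => [[x t]|t] _ /=.
  by congr (_, _); apply: val_inj.
by rewrite [in RHS](tuple_eta t).
Qed.

(** * Connecting tuples by paths *)

Lemma drop_catl (T : Type) i (s t : seq T) :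
  i <= size s -> drop i (s ++ t) = drop i s ++ t.
Proof. by move=> h; rewrite -{1}(cat_take_drop i s) -catA drop_size_cat ?size_takel. Qed.

(** Edges are predicates on sequences that fail on repeated entries, so sums over all tuples need no
    injectivity side condition. *)
Definition edge_pred (V : eqType) (k : nat) (e : pred (seq V)) : Prop :=
  [/\ forall v, e v -> size v = k, forall v, e v -> uniq v
    & forall u v, perm_eq u v -> e u = e v].

Definition link_density (R : realFieldType) (V : eqType) k (e : pred (seq V))
    (W v : seq V) : R :=
  Em W (k - size v) (fun y => (e (v ++ y))%:R)%R.

Section LPaths.
Variables (V : eqType) (k l : nat) (e : pred (seq V)).
Hypotheses (l2k : 2 * l < k) (eP : edge_pred k e).

(** Only vertices of a common edge are forced to be distinct. Distinctness of a whole path is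
    imposed where paths are put together, which keeps path densities multiplicative. *)
Fixpoint lpath q (v : seq V) : bool :=
  if q is q'.+1 then e (take k v) && lpath q' (drop (k - l) v) else size v == l.

Lemma lpath_size q v : lpath q v -> size v = q * (k - l) + l.
Proof.
elim: q v => [|q IH] v /=; first by move/eqP.
case/andP=> /(let: And3 h _ _ := eP in h) + /IH; rewrite size_drop size_take.
by case: ltnP; nia.
Qed.

(** The tuple [j] starts at a multiple of [k - l], so no edge reaches from before [j] to beyond
    it. *)
Lemma lpath_join a b u j w : size u = a * (k - l) -> size j = l ->
  lpath (a + b) (u ++ j ++ w) = lpath a (u ++ j) && lpath b (j ++ w).
Proof.
move=> + sj; elim: a u => [|a IH] u su /=.
  by move/size0nil: su => ->; rewrite /= sj eqxx.
have sr : k - l <= size u by rewrite su mulSn leq_addr.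
rewrite -andbA catA takel_cat; last by rewrite size_cat sj; lia.
rewrite -catA !drop_catl // IH // size_drop su mulSn addKn //.
Qed.

Lemma lpath1 u m w : size u = l -> size m = k - l - l -> size w = l ->
  lpath 1 (u ++ m ++ w) = e (u ++ m ++ w).
Proof.
move=> su sm sw; rewrite /= take_oversize; last by rewrite !size_cat; lia.
by rewrite size_drop !size_cat su sm sw andbC; case: eqP => //; lia.
Qed.

Lemma lpath_window q v i : lpath q v -> i < q -> e (take k (drop (i * (k - l)) v)).
Proof.
elim: q v i => // q IH v [|i] /= /andP[ev pv] ltiq; first by rewrite drop0.
by have := IH _ i pv ltiq; rewrite drop_drop addnC -mulSn.
Qed.

End LPaths.

Section Connect.
Variables (R : realFieldType) (V : finType) (k l : nat) (e : pred (seq V)).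
Hypotheses (l2k : 2 * l < k) (eP : edge_pred k e) (V0 : 0 < size (enum V)).
Local Open Scope ring_scope.
Local Notation r := (k - l)%N.
Local Notation E := (Em (R := R) (enum V)).
Local Notation n := (size (enum V)).
Local Notation lp := (lpath k l e).

(** An [l]-path with [q + 1] edges has [(q + 1) * r + l] vertices, of which the two ends take
    [2 * l]. *)
Definition conn_len q := (q * r + (r - l))%N.

Definition conn q X Y : R := E (conn_len q) (fun z => (lp q.+1 (X ++ z ++ Y))%:R).

Let eperm u v : perm_eq u v -> e u = e v. Proof. by case: eP => _ _; apply. Qed.

Lemma conn_ge0 q X Y : 0 <= conn q X Y.
Proof. by apply: Em_ge0 => *; apply: ler0n. Qed.

(** An equality rather than an estimate, because the two halves may share vertices. *)
Lemma conn_comp a b X Y : size X = l -> size Y = l ->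
  conn (a + b).+1 X Y = E l (fun J => conn a X J * conn b J Y).
Proof.
move=> sX sY; rewrite /conn.
have -> : conn_len (a + b).+1 = (conn_len a + (l + conn_len b))%N.
  by rewrite /conn_len mulSn mulnDl; lia.
rewrite Em_cat; under eq_Em do rewrite Em_cat; rewrite Em_swap.
apply: eq_Em => J sJ _; rewrite -EmZr; apply: eq_Em => z1 sz1 _.
rewrite -EmZ; apply: eq_Em => z2 sz2 _.
rewrite -addSn -addnS -!catA catA lpath_join //; last first.
  by rewrite size_cat sX sz1 /conn_len; lia.
by rewrite -!catA -natrM mulnb.
Qed.

Lemma conn0 X Y : size X = l -> size Y = l ->
  conn 0 X Y = E (r - l) (fun m => (e (X ++ m ++ Y))%:R).
Proof. by move=> *; apply: eq_Em => m sm _; rewrite lpath1. Qed.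

Lemma conn0C X Y : size X = l -> size Y = l -> conn 0 X Y = conn 0 Y X.
Proof.
move=> sX sY; rewrite !conn0 //; apply: eq_Em => m _ _; congr (_ %:R).
by congr nat_of_bool; apply: eperm; rewrite perm_catC -catA perm_catCA perm_refl.
Qed.

Section Growth.
Variable c : R.
Hypothesis c0 : 0 < c.
Hypothesis deg : forall v, uniq v -> (size v <= l.+1)%N -> c <= link_density R k e (enum V) v.

(* The pairs counted on the left are joined to many [Z]; those [Z] with few neighbours in
   [G] carry little weight, and the other ones carry little weight by definition of the
   complement of [grow th G]. *)
Definition grow (th : R) (G : pred (seq V)) : pred (seq V) :=
  fun J' => th ^+ 2 <= E l (fun J => (G J)%:R * conn 1 J J').

Lemma growP (G : pred (seq V)) (th : R) : 0 < th ->
  c * E l.+1 (fun s => (G (take l s) && ~~ grow th G (behead s))%:R)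
    <= 2 * th + c * ((l.+1 * l.+1)%:R / n%:R).
Proof.
move=> th0; pose ev s := G (take l s) && ~~ grow th G (behead s).
rewrite -[X in c * X]/(E l.+1 (fun s => (ev s)%:R)).
(* An edge is split into the [l.+1] vertices of [s], [a] further vertices and an [l]-tuple [Z];
   there is room for them because [2 * l < k]. *)
pose a := (k - l.+1 - l)%N.
pose w (s Z : seq V) : R := E a (fun M => (e (s ++ M ++ Z))%:R).
have w0 s Z : 0 <= w s Z by apply: Em_ge0 => *; apply: ler0n.
pose p Z : R := E l (fun J => (G J)%:R * conn 0 J Z).
have step1 : c * E l.+1 (fun s => (ev s)%:R) <=
    E l.+1 (fun s => (ev s)%:R * E l (w s)) + c * ((l.+1 * l.+1)%:R / n%:R).
  apply: le_trans (lerD (lexx _) (ler_wpM2l (ltW c0) (Em_nuniq_le R l.+1 (enum_uniq V) V0))).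
  rewrite -!EmZ -EmD; apply: le_Em => s ss _.
  have Ew0 : 0 <= E l (w s) by apply: Em_ge0.
  case us: (uniq s); last first.
    by case: (ev s) => /=; move: c0; lra.
  rewrite mulr0 addr0 mulrC ler_wpM2l //.
  apply: le_trans (deg us _) _; first by rewrite ss.
  rewrite /w Em_swap /link_density ss (_ : (k - l.+1)%N = (a + l)%N) ?Em_cat //.
  by rewrite /a; lia.
(* The case of small [p Z]: for fixed [Z], the weight averages to [p Z] itself. *)
have step3 : E l.+1 (fun s => E l (fun Z => (G (take l s))%:R * w s Z * (p Z < th)%R%:R)) <= th.
  rewrite Em_swap -[leRHS](Em_cst l th V0); apply: le_Em => Z sZ _.
  rewrite EmZr (_ : Em _ _ _ = p Z); first by case: ltP => h; rewrite ?mulr1 ?mulr0 ltW.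
  rewrite -addn1 Em_cat; apply: eq_Em => J sJ _; rewrite conn0 //.
  transitivity (E 1 (fun u => (G J)%:R * w (J ++ u) Z)).
    by apply: eq_Em => u _ _; rewrite -sJ take_size_cat.
  rewrite EmZ /w; congr (_ * _).
  rewrite (_ : (r - l)%N = (1 + a)%N); last by rewrite /a; lia.
  by rewrite Em_cat; apply: eq_Em => u _ _; apply: eq_Em => M _ _; rewrite -!catA.
have step4 : E l.+1 (fun s => E l (fun Z => (~~ grow th G (behead s))%:R * w s Z * (th <= p Z)%R%:R)) <= th.
  rewrite -add1n Em_cat Em_swap -[leRHS](Em_cst l th V0); apply: le_Em => J sJ _.
  rewrite Em_swap.
  have -> : E l (fun Z => E 1 (fun x => (~~ grow th G (behead (x ++ J)))%:R * w (x ++ J) Z * (th <= p Z)%R%:R))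
      = (~~ grow th G J)%:R * E l (fun Z => conn 0 J Z * (th <= p Z)%R%:R).
    rewrite -EmZ; apply: eq_Em => Z sZ _; rewrite mulrA EmZr; congr (_ * _).
    transitivity (E 1 (fun x => (~~ grow th G J)%:R * w (x ++ J) Z)).
      by apply: eq_Em => -[|x []].
    rewrite EmZ conn0 // (_ : (r - l)%N = (1 + a)%N); last by rewrite /a; lia.
    rewrite Em_cat; congr (_ * _); apply: eq_Em => x _ _; apply: eq_Em => M _ _.
    by congr (nat_of_bool _)%:R; apply: eperm; rewrite -!catA perm_catCA perm_refl.
  case: (boolP (grow th G J)) => [_|]; first by rewrite mul0r ltW.
  (* The case of large [p Z] is Markov's inequality: the average of [p Z * conn 0 J Z] over [Z] is
     the density of two-edge connections from [G] to [J], which is below [th ^+ 2]. *)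
  rewrite /grow -ltNge mul1r => lt_th; rewrite -(ler_pM2l th0) -expr2.
  apply: le_trans (ltW lt_th); rewrite -EmZ.
  rewrite [leRHS](_ : _ = E l (fun Z => p Z * conn 0 J Z)); last first.
    rewrite /p; under [RHS]eq_Em do rewrite -EmZr; rewrite Em_swap.
    apply: eq_Em => J0 sJ0 _; rewrite -[1%N]/((0 + 0).+1)%N conn_comp // -EmZ.
    by apply: eq_Em => Z sZ _; rewrite mulrA (@conn0C Z J).
  apply: le_Em => Z sZ _; have c00 := conn_ge0 0 J Z.
  have p0 : 0 <= p Z by apply: Em_ge0 => *; rewrite mulr_ge0 ?conn_ge0.
  by case: (leP th) => h /=; [rewrite mulr1 ler_wpM2r | rewrite !mulr0 mulr_ge0].
apply: le_trans step1 _; rewrite lerD2r mulr_natl mulr2n.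
apply: le_trans _ (lerD step3 step4); rewrite -EmD; apply: le_Em => s _ _.
rewrite -EmD -EmZ; apply: le_Em => Z _ _; have := w0 s Z.
rewrite /ev; case: (G _); case: (grow _ _ _); case: (ltP (p Z) th) => _ /=; lra.
Qed.

Let c2 : 0 < c / 2. Proof. by rewrite divr_gt0. Qed.

Fixpoint reach (th : R) X i : pred (seq V) :=
  if i is i'.+1 then grow th (reach th X i') else fun J => c / 2 <= conn 0 X J.

Lemma reach_conn th X i J : size X = l -> size J = l -> reach th X i J ->
  c / 2 * (th ^+ 2) ^+ i <= conn (2 * i) X J.
Proof.
move=> sX; elim: i J => [|i IH] J sJ; first by rewrite mulr1.
move=> le_th; rewrite (_ : (2 * i.+1)%N = (2 * i + 1).+1%N); last by lia.
rewrite conn_comp // exprSr mulrA; move: le_th; rewrite /= /grow => le_th.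
have c20 : 0 <= c / 2 * (th ^+ 2) ^+ i by apply: mulr_ge0 (ltW c2) (exprn_ge0 _ (sqr_ge0 _)).
apply: le_trans (ler_wpM2l c20 le_th) _; rewrite -EmZ; apply: le_Em => J' sJ' _.
rewrite mulrA ler_wpM2r ?conn_ge0 //.
case: (boolP (reach th X i J')) => [r1|_]; first by rewrite mulr1 IH.
by rewrite mulr0 conn_ge0.
Qed.

(** A telescoping sum over the windows of an [(l + j)]-tuple: if the first window is reached and the
    last is not, then membership is lost between two neighbouring windows, and [growP] bounds each
    such loss. *)
Lemma hybrid_le th X j : 0 < th ->
  E (l + j) (fun s => (reach th X 0 (take l s) && ~~ reach th X j (drop j s))%:R)
    <= j%:R * (2 * th / c + (l.+1 * l.+1)%:R / n%:R).
Proof.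
move=> th0; elim: j => [|j IH].
  rewrite mul0r addn0 -(Em_cst l 0 V0); apply: le_Em => s ss _.
  by rewrite drop0 take_oversize ?ss // andbN.
have B : E l.+1 (fun s => (reach th X j (take l s) && ~~ reach th X j.+1 (behead s))%:R)
    <= 2 * th / c + (l.+1 * l.+1)%:R / n%:R.
  have := growP (reach th X j) th0; rewrite -ler_pdivlMl // => /le_trans; apply.
  by rewrite mulrDr (mulrC c^-1) lerD2l mulrA mulVf ?mul1r // gt_eqF.
rewrite -natr1 mulrDl mul1r; apply: le_trans _ (lerD IH B).
rewrite -(Em_take (l + j) 1 _ V0) -(Em_window j l.+1 0 _ V0).
rewrite (_ : (j + (l.+1 + 0))%N = (l + j.+1)%N); last by lia.
rewrite (_ : (l + j + 1)%N = (l + j.+1)%N); last by lia.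
rewrite -EmD; apply: le_Em => s ss _; rewrite -natrD ler_nat take_takel ?leq_addr //.
have -> : behead (take l.+1 (drop j s)) = drop j.+1 s.
  by rewrite -drop1 (take_oversize) ?drop_drop // size_drop; lia.
have -> : take l (take l.+1 (drop j s)) = drop j (take (l + j) s).
  by rewrite take_takel // take_drop.
by case: (reach th X 0 _); case: (reach th X j _); case: (reach th X j.+1 _).
Qed.

Lemma conn0_mean Z : uniq Z -> size Z = l -> c <= E l (conn 0 Z).
Proof.
move=> uZ sZ; have := deg uZ; rewrite sZ => /(_ (leqnSn l)) /le_trans; apply.
rewrite /link_density sZ (_ : (k - l)%N = (r - l + l)%N); last by lia.
by rewrite Em_cat Em_swap; apply: le_Em => J sJ _; rewrite conn0.
Qed.

(** The value for which [l * (2 * conn_th / c)] is [c ^+ 2 / 8], half of the error that [conn_ge]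
    tolerates; repeated vertices take the other half. *)
Definition conn_th : R := c ^+ 3 / (l%:R *+ 16).
Definition conn_density : R := c / 2 * (conn_th ^+ 2) ^+ l * (c / 2).

(** For [j = l] the first and the last window of the [2 * l]-tuple are disjoint, hence independent.
    So the density of [G0], at least [c / 2], times the density of the complement of [Gl] is at most
    [c ^+ 2 / 4], and the complement has density at most [c / 2]. Since [conn 0 Y] has mean at least
    [c], a mean of [c / 2] remains on [Gl]. *)
Lemma conn_ge X Y : (0 < l)%N -> uniq X -> size X = l -> uniq Y -> size Y = l ->
  (8 * l * (l.+1 * l.+1))%:R <= c ^+ 2 * n%:R ->
  conn_density <= conn (2 * l).+1 X Y.
Proof.
move=> l0 uX sX uY sY le_n.
have l0R : 0 < l%:R :> R by rewrite ltr0n.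
have n0R : 0 < n%:R :> R by rewrite ltr0n.
have th0 : 0 < conn_th by rewrite divr_gt0 ?exprn_gt0 ?pmulrn_lgt0.
pose G0 := reach conn_th X 0; pose Gl := reach conn_th X l.
have G0_ge : c / 2 <= E l (fun J => (G0 J)%:R).
  have : c <= c / 2 + E l (fun J => (G0 J)%:R).
    apply: le_trans (conn0_mean uX sX) _; rewrite -[X in X + _](Em_cst l _ V0) -EmD.
    apply: le_Em => J sJ _; rewrite /G0 /=; case: (leP (c / 2)) => [_|/ltW h] /=.
      rewrite -[leLHS]add0r lerD ?(ltW c2) //.
      by apply: Em_le1 => // *; rewrite lern1 leq_b1.
    by rewrite addr0.
  lra.
have Gl_le : E l (fun J => (~~ Gl J)%:R) <= c / 2.
  have P0 : 0 <= E l (fun J => (~~ Gl J)%:R) by apply: Em_ge0 => *; apply: ler0n.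
  have H : c / 2 * E l (fun J => (~~ Gl J)%:R) <=
      l%:R * (2 * conn_th / c + (l.+1 * l.+1)%:R / n%:R).
    apply: le_trans (hybrid_le X l th0).
    apply: le_trans (ler_wpM2r P0 G0_ge) _.
    rewrite Em_cat -EmZr; apply: le_Em => x xl _.
    rewrite -EmZ; apply: le_Em => y yl _.
    by rewrite -xl take_size_cat // drop_size_cat // -natrM mulnb xl.
  rewrite -(ler_pM2l (_ : 0 < c / 2)) ?divr_gt0 //; apply: le_trans H _.
  rewrite mulrDr (_ : l%:R * (2 * conn_th / c) = c ^+ 2 / 8); last first.
    by rewrite /conn_th; field; rewrite !gt_eqF.
  have : l%:R * ((l.+1 * l.+1)%:R / n%:R) <= c ^+ 2 / 8.
    rewrite mulrA ler_pdivrMr // mulrAC ler_pdivlMr // mulrC.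
    by rewrite -!natrM mulnA.
  rewrite (_ : c / 2 * (c / 2) = c ^+ 2 / 4); last by field.
  lra.
rewrite -[(2 * l)%N]addn0 conn_comp //.
have kge0 : 0 <= c / 2 * (conn_th ^+ 2) ^+ l by apply: mulr_ge0 (ltW c2) (exprn_ge0 _ (sqr_ge0 _)).
apply: (@le_trans _ _ (c / 2 * (conn_th ^+ 2) ^+ l * E l (fun J => (Gl J)%:R * conn 0 J Y))).
  rewrite ler_wpM2l //; have := conn0_mean uY sY.
  have : E l (conn 0 Y) <= E l (fun J => (Gl J)%:R * conn 0 J Y) + E l (fun J => (~~ Gl J)%:R).
    rewrite -EmD; apply: le_Em => J sJ _; rewrite conn0C //; case: (Gl J) => /=.
      by rewrite mul1r addr0.
    by rewrite mul0r add0r; apply: Em_le1 => // *; rewrite lern1 leq_b1.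
  lra.
rewrite -EmZ; apply: le_Em => J sJ _; rewrite mulrA ler_wpM2r ?conn_ge0 //.
case: (boolP (Gl J)) => [r1|_]; first by rewrite mulr1 reach_conn.
by rewrite mulr0 conn_ge0.
Qed.

End Growth.
End Connect.

(** * Greedy selection *)

Lemma size_flatten_const (T : Type) a (ss : seq (seq T)) :
  all (fun s => size s == a) ss -> size (flatten ss) = a * size ss.
Proof.
elim: ss => [|s ss IH] /=; first by rewrite muln0.
by case/andP=> /eqP sa /IH E; rewrite size_cat sa E mulnS.
Qed.

Section Selection.
Variables (R : realFieldType) (V : finType) (T : eqType) (sat : T -> pred (seq V)).
Variables (a : nat) (kappa : R).
Hypotheses (V0 : 0 < size (enum V)) (kappa0 : (0 < kappa)%R).
Local Open Scope ring_scope.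
Local Notation E := (Em (R := R) (enum V)).
Local Notation n := (size (enum V)).

Lemma greedy_choice (Ds : seq T) (F : seq V) :
  {in Ds, forall D, kappa <= E a (fun t => (sat D t)%:R)} ->
  (a * (a + size F + a * size Ds))%:R < kappa * n%:R ->
  exists ts, [/\ size ts = size Ds, all2 sat Ds ts, all (fun t => size t == a) ts,
    uniq (flatten ts) & ~~ has (mem F) (flatten ts)].
Proof.
elim: Ds F => [|D Ds IH] F satD lt_n; first by exists [::].
have [|t [st _ Dt ut tF]] := Em_fresh (enum_uniq V) V0 (satD D (mem_head _ _)) (F := F).
  by apply: le_lt_trans lt_n; rewrite ler_nat leq_mul ?leq_addr.
have [||ts [sts sat_ts ats uts tsF]] := IH (t ++ F).
- by move=> D' D'Ds; apply: satD; rewrite inE D'Ds orbT.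
- by apply: le_lt_trans lt_n; rewrite ler_nat size_cat st /= leq_mul // mulnS; lia.
have disj G : {subset G <= t ++ F} -> ~~ has (mem G) (flatten ts).
  move=> sG; apply: contra tsF => /hasP[x xts xG]; apply/hasP; exists x => //=.
  exact: sG.
exists (t :: ts); split=> /=; rewrite ?sts ?Dt ?sat_ts ?st ?eqxx //.
  by rewrite cat_uniq ut uts disj // => x xt; rewrite mem_cat xt.
by rewrite has_cat (negPf tF) disj // => x xF; rewrite mem_cat xF orbT.
Qed.

(* Every demand receives weight [2 ^- c], where [c] counts the chosen tuples that satisfy it;
   some tuple decreases the total weight by the factor [1 - kappa / 4]. *)
Lemma balanced_choice (Ds : seq T) (F : seq V) N M :
  {in Ds, forall D, kappa <= E a (fun t => (sat D t)%:R)} ->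
  2 * (a * (a + size F + a * N))%:R <= kappa * n%:R ->
  (size Ds)%:R * (1 - kappa / 4) ^+ N < 2 ^- M ->
  exists ts, [/\ (size ts <= N)%N, all (fun t => size t == a) ts,
    uniq (flatten ts) /\ ~~ has (mem F) (flatten ts),
    {in ts, forall t, exists2 D, D \in Ds & sat D t} &
    {in Ds, forall D, (M <= count (sat D) ts)%N}].
Proof.
move=> satD le_n lt_M; have n0 : 0 < n%:R :> R by rewrite ltr0n.
pose Phi ts : R := \sum_(D <- Ds) 2 ^- count (sat D) ts.
have term0 i : 0 < 2 ^- i :> R by rewrite invr_gt0 exprn_gt0.
have : exists ts, [/\ (size ts <= N)%N, all (fun t => size t == a) ts,
    uniq (flatten ts) /\ ~~ has (mem F) (flatten ts),
    {in ts, forall t, exists2 D, D \in Ds & sat D t} &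
    Phi ts <= (size Ds)%:R * (1 - kappa / 4) ^+ N]; last first.
  case=> ts [sts ats uts hts Phi_le]; exists ts; split=> // D DDs.
  have : 2 ^- count (sat D) ts <= Phi ts.
    rewrite /Phi (big_rem D) //= lerDl; apply: sumr_ge0 => i _; exact: ltW.
  move=> /le_trans /(_ Phi_le) /le_lt_trans /(_ lt_M).
  by rewrite ltf_pV2 ?posrE ?exprn_gt0 // ltr_eXn2l ?ltr1n // => /ltnW.
case: Ds satD {lt_M} @Phi => [|D0 Ds0] satD.
  move=> Phi; exists [::]; split=> //; rewrite /Phi big_nil mul0r lexx //.
set Ds := D0 :: Ds0 in satD * => Phi.
have Phi0 ts : 0 < Phi ts.
  rewrite /Phi big_cons ltr_wpDr // sumr_ge0 // => i _; exact: ltW.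
have {Phi0} : forall j, (j <= N)%N -> exists ts, [/\ (size ts <= j)%N,
    all (fun t => size t == a) ts,
    uniq (flatten ts) /\ ~~ has (mem F) (flatten ts),
    {in ts, forall t, exists2 D, D \in Ds & sat D t} &
    Phi ts <= (size Ds)%:R * (1 - kappa / 4) ^+ j]; last by apply.
elim=> [_|j IH ltjN].
  exists [::]; split=> //; rewrite mulr1 /Phi.
  rewrite (eq_bigr (fun=> 1)) => [|D _]; last by rewrite /= invr1.
  by rewrite sumr_const_seq mulr1.
have [ts [sts ats [uts Fts] hts Phi_ts]] := IH (ltnW ltjN).
(* Only fresh tuples count as progress. Freshness costs at most half of [kappa], and a satisfied
   demand loses half of its weight; together this gives the factor [1 - kappa / 4]. *)
pose Q t := [&& has (sat^~ t) Ds, uniq t & ~~ has (mem (F ++ flatten ts)) t].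
pose f D t : R := 2 ^- count (sat D) ts * (1 - (sat D t && Q t)%:R / 2).
have avg : E a (fun t => \sum_(D <- Ds) f D t) <= (1 - kappa / 4) * Phi ts.
  rewrite Em_sum /Phi mulr_sumr big_seq [leRHS]big_seq; apply: ler_sum => D DDs.
  rewrite EmZ mulrC ler_pM2r // EmB (Em_cst a _ V0) lerD2l lerN2 EmZr.
  suff : kappa / 2 <= E a (fun t => (sat D t && Q t)%:R) by lra.
  have := satD D DDs.
  have : E a (fun t => (sat D t)%:R) <= E a (fun t => (sat D t && Q t)%:R)
     + (E a (fun t => (~~ uniq t)%:R) + E a (fun t => (has (mem (F ++ flatten ts)) t)%:R)).
    rewrite -!EmD; apply: le_Em => t _ _; rewrite -!natrD ler_nat /Q.
    case sDt: (sat D t) => //; have -> : has (sat^~ t) Ds by apply/hasP; exists D.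
    by case: uniq; case: has.
  have := Em_nuniq_le R a (enum_uniq V) V0.
  have := Em_mem_le R a (F ++ flatten ts) (enum_uniq V) V0.
  have : (a * a)%:R / n%:R + (a * size (F ++ flatten ts))%:R / n%:R <= kappa / 2.
    rewrite -mulrDl ler_pdivrMr // -natrD -(ler_pM2l (_ : 0 < 2)) //.
    rewrite [leRHS](_ : _ = kappa * n%:R); last by field.
    apply: le_trans le_n; rewrite ler_pM2l // ler_nat size_cat (size_flatten_const ats).
    by have := leq_mul (leqnn a) (leq_mul (leqnn a) (leq_trans sts (ltnW ltjN))); lia.
  lra.
have avgN : - ((1 - kappa / 4) * Phi ts) <= E a (fun t => - \sum_(D <- Ds) f D t).
  by rewrite EmN lerN2.
have [t [st _ ft]] := Em_exists V0 avgN.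
have {}ft : \sum_(D <- Ds) f D t <= (1 - kappa / 4) * Phi ts by rewrite -lerN2.
(* A tuple that is not fresh would leave the total weight unchanged, although it must decrease. *)
case: (boolP (Q t)) => Qt; last first.
  exfalso; move: ft; rewrite (_ : \sum_(D <- Ds) f D t = Phi ts); last first.
    by apply: eq_bigr => D _; rewrite /f (negPf Qt) andbF mul0r subr0 mulr1.
  by have := mulr_gt0 kappa0 (Phi0 ts); lra.
case/and3P: (Qt) => /hasP[D DDs sDt] ut.
rewrite has_sym has_cat negb_or => /andP[tF tts]; exists (t :: ts); split=> /=.
- exact: leq_ltn_trans sts _.
- by rewrite st eqxx.
- by rewrite cat_uniq ut uts tts has_cat negb_or has_sym tF Fts.
- by move=> u; rewrite inE => /predU1P[->|/hts //]; exists D.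
- rewrite exprS mulrCA; apply: le_trans _ (ler_wpM2l _ Phi_ts); last first.
    have : kappa <= 1.
      apply: le_trans (satD D DDs) _; apply: Em_le1 => // *.
      by rewrite lern1 leq_b1.
    lra.
  apply: le_trans ft; apply: ler_sum => D' _; rewrite /f Qt andbT.
  rewrite /=; case: (sat D' t); last by rewrite mul0r subr0 mulr1 add0n.
  by rewrite add1n exprSr invfM ler_pM2l //=; lra.
Qed.

(** Every demand is met by at least as many tuples as there are demands, so the tuples already used
    never exhaust its options. *)
Lemma distinct_choice (Ds : seq T) (ts : seq (seq V)) : uniq ts ->
  {in Ds, forall D, (size Ds <= count (sat D) ts)%N} ->
  exists ts', [/\ size ts' = size Ds, uniq ts', {subset ts' <= ts} & all2 sat Ds ts'].
Proof.
move=> uts; rewrite -[size Ds]addn0 -[0%N]/(size (Nil (seq V))).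
suff H used : {in Ds, forall D, (size Ds + size used <= count (sat D) ts)%N} ->
  exists ts', [/\ size ts' = size Ds, uniq ts', {subset ts' <= ts}, all2 sat Ds ts'
    & ~~ has (mem used) ts'].
  by move=> /H[ts' [? ? ? ? _]]; exists ts'; rewrite addn0.
elim: Ds used => [|D Ds IH] used cnt; first by exists [::].
have [t] : exists2 t, t \in [seq t <- ts | sat D t] & t \notin used.
  apply/hasP; rewrite -[has _ _]negbK -all_predC; apply/negP => /allP sub.
  have := uniq_leq_size (filter_uniq (sat D) uts)
    (fun t h => negbNE (sub t h) : t \in used).
  by rewrite size_filter leqNgt (leq_trans _ (cnt D (mem_head _ _))) // addSn ltnS leq_addl.
rewrite mem_filter => /andP[sDt tts] tu.
have [|ts' [sts' uts' sub sat' disj]] := IH (t :: used).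
  move=> D' D'Ds; have := cnt D'; rewrite inE D'Ds orbT => /(_ isT) /=.
  by rewrite addnS addSn.
exists (t :: ts'); rewrite /= sts' uts' sDt sat' (negPf tu) andbT /=; split=> //.
- by apply/negP => tts'; case/negP: disj; apply/hasP; exists t => //=; rewrite mem_head.
- by move=> x; rewrite inE => /predU1P[->|/sub].
- by apply: contra disj => /hasP[x xts' xu]; apply/hasP; exists x => //=; rewrite inE (xu : x \in used) orbT.
Qed.
End Selection.

(** * Absorbers *)

Section Spans.
Variables (V : eqType) (k l : nat) (e : pred (seq V)).
Hypotheses (l2k : 2 * l < k) (eP : edge_pred k e).
Local Notation r := (k - l).

Definition ends (v : seq V) := (take l v, drop (size v - l) v).

(** Of a family of disjoint paths only the ends and the vertex set are remembered. Two families with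
    the same ends are interchangeable in a cycle, which is all that absorption uses. *)
Definition spans (es : seq (seq V * seq V)) (us : seq V) : Prop :=
  exists vs, [/\ map ends vs = es, {in vs, forall v, exists q, lpath k l e q.+1 v}
    & perm_eq (flatten vs) us].

Lemma ends_cat a m b : l <= size a -> l <= size b ->
  ends (a ++ m ++ b) = (take l a, drop (size b - l) b).
Proof.
move=> la lb; rewrite /ends takel_cat // catA drop_cat !size_cat; congr (_, _).
by case: ltnP => [|_]; [lia | congr drop; lia].
Qed.

Lemma spans_nil : spans [::] [::].
Proof. by exists [::]. Qed.

Lemma spans_cat es es' us us' :
  spans es us -> spans es' us' -> spans (es ++ es') (us ++ us').
Proof.
move=> [vs [mv pv vP]] [vs' [mv' pv' vP']]; exists (vs ++ vs').
rewrite map_cat mv mv' flatten_cat perm_cat //; split=> // v.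
by rewrite mem_cat => /orP[/pv|/pv'].
Qed.

Lemma spans_perm es us us' : perm_eq us us' -> spans es us -> spans es us'.
Proof. by move=> p [vs [mv pv vP]]; exists vs; rewrite (perm_trans vP p). Qed.

Lemma spans1 q v : lpath k l e q.+1 v -> spans [:: ends v] v.
Proof.
by move=> pv; exists [:: v]; rewrite /= cats0; split=> // u; rewrite inE => /eqP ->; exists q.
Qed.

Lemma lpath1_edge v : size v = k -> lpath k l e 1 v = e v.
Proof.
move=> sv; rewrite /= take_oversize ?sv // size_drop sv andbC; case: eqP => //; lia.
Qed.

Definition swap_len := (1 + (1 + (k - 2 + r.-1)))%N.

(* [g] lists [x'], [u'], [J] ([l - 1] vertices), [M2] and [M1]: both [M1 u' (x' J) u M2] and
   [M1 x' (u' J) x M2] are [l]-paths with two edges, and they have the same ends. *)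
Definition swap_gadget (X U g : seq V) : bool :=
  let X' := take 1 g in let U' := take 1 (drop 1 g) in
  let f := take (k - 2) (drop 2 g) in let M1 := drop (k - 2) (drop 2 g) in
  [&& e (X' ++ U' ++ take l.-1 f ++ M1), e (X' ++ U ++ f) & e (X ++ U' ++ f)].

Definition swap_ends (g : seq V) :=
  let f := take (k - 2) (drop 2 g) in let M1 := drop (k - 2) (drop 2 g) in
  (take l M1, drop (size (drop l.-1 f) - l) (drop l.-1 f)).

Lemma swap_path (X' U' J M1 U M2 : seq V) : 0 < l ->
  size X' = 1 -> size U' = 1 -> size J = l.-1 -> size M1 = r.-1 -> size U = 1 ->
  size M2 = r.-1 -> e (X' ++ U' ++ J ++ M1) -> e (X' ++ U ++ J ++ M2) ->
  spans [:: (take l M1, drop (size M2 - l) M2)] (U ++ X' ++ U' ++ J ++ M2 ++ M1).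
Proof.
move=> l0 sX' sU' sJ sM1 sU sM2 e1 e2.
have eperm := let: And3 _ _ h := eP in h.
rewrite -(@ends_cat M1 (U' ++ X' ++ J ++ U) M2) ?sM1 ?sM2; try lia.
apply: (@spans_perm _ (M1 ++ (U' ++ X' ++ J ++ U) ++ M2)).
  by apply/permP => p; rewrite !count_cat; lia.
apply: (@spans1 1).
rewrite -[2]/(1 + 1) -!catA (catA M1 U') (catA X' J) lpath_join //; last first.
- by rewrite size_cat sX' sJ; lia.
- by rewrite size_cat sM1 sU'; lia.
rewrite !lpath1_edge ?size_cat ?sM1 ?sM2 ?sU' ?sX' ?sJ ?sU; try lia.
apply/andP; split.
  by rewrite (eperm _ (X' ++ U' ++ J ++ M1)) //; apply/permP => p; rewrite !count_cat; lia.
by rewrite (eperm _ (X' ++ U ++ J ++ M2)) //; apply/permP => p; rewrite !count_cat; lia.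
Qed.

(** The edge on [X'], [U'], [J] and [M1] is symmetric in [X'] and [U'], so interchanging these two
    turns the path through [U] into one through [X]. *)
Lemma swap_spans X U g : 0 < l -> size X = 1 -> size U = 1 -> size g = swap_len ->
  swap_gadget X U g ->
  spans [:: swap_ends g] (X ++ g) /\ spans [:: swap_ends g] (U ++ g).
Proof.
move=> l0 sX sU; rewrite /swap_len => sg /and3P[].
rewrite /swap_ends.
set f := take (k - 2) _; set M1 := drop (k - 2) _; set X' := take 1 g.
set U' := take 1 _; set J := take l.-1 f; set M2 := drop l.-1 f.
have fE : J ++ M2 = f by rewrite cat_take_drop.
have gE : g = X' ++ U' ++ f ++ M1.
  rewrite cat_take_drop -[drop 2 g]/(drop (1 + 1) g) -drop_drop.
  by rewrite /U' cat_take_drop cat_take_drop.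
have sf : size f = k - 2 by rewrite size_takel // size_drop sg; lia.
have sX' : size X' = 1 by rewrite size_takel // sg; lia.
have sU' : size U' = 1 by rewrite size_takel // size_drop sg; lia.
have sJ : size J = l.-1 by rewrite size_takel // sf; lia.
have sM2 : size M2 = r.-1 by rewrite size_drop sf; lia.
have sM1 : size M1 = r.-1 by rewrite !size_drop sg; lia.
have eperm := let: And3 _ _ h := eP in h.
rewrite -fE => e1 e2 e3; rewrite gE -fE; split.
  apply: (@spans_perm _ (X ++ U' ++ X' ++ J ++ M2 ++ M1)).
    by apply/permP => p; rewrite !count_cat; lia.
  apply: swap_path => //.
  by rewrite (eperm _ (X' ++ U' ++ J ++ M1)) //; apply/permP => p; rewrite !count_cat; lia.
  by rewrite (eperm _ (X ++ U' ++ J ++ M2)) //; apply/permP => p; rewrite !count_cat; lia.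
apply: (@spans_perm _ (U ++ X' ++ U' ++ J ++ M2 ++ M1)).
  by apply/permP => p; rewrite !count_cat; lia.
exact: swap_path.
Qed.

Fixpoint swap_all (ps : seq (V * V)) (G : seq V) : bool :=
  if ps is p :: ps' then
    swap_gadget [:: p.1] [:: p.2] (take swap_len G) && swap_all ps' (drop swap_len G)
  else true.

Fixpoint swap_all_ends m (G : seq V) : seq (seq V * seq V) :=
  if m is m'.+1 then swap_ends (take swap_len G) :: swap_all_ends m' (drop swap_len G)
  else [::].

Lemma swap_all_spans ps G : 0 < l -> size G = size ps * swap_len -> swap_all ps G ->
  spans (swap_all_ends (size ps) G) (G ++ unzip1 ps) /\
  spans (swap_all_ends (size ps) G) (G ++ unzip2 ps).
Proof.
move=> l0; elim: ps G => [|[x u] ps IH] G /=.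
  by move/size0nil => -> _; split; apply: spans_nil.
move=> sG /andP[sw /IH].
have st : size (take swap_len G) = swap_len by rewrite size_takel // sG leq_addr.
rewrite size_drop sG mulSn addKn => /(_ erefl)[IH1 IH2].
have [sx su] := swap_spans l0 (erefl : size [:: x] = 1) (erefl : size [:: u] = 1) st sw.
have cG p : count p G = count p (take swap_len G) + count p (drop swap_len G).
  by rewrite -count_cat cat_take_drop.
split; [apply: spans_perm (spans_cat sx IH1)|apply: spans_perm (spans_cat su IH2)];
by apply/permP => p; rewrite !count_cat /= cG; lia.
Qed.

End Spans.

Section AbsorberShape.
Variables (V : eqType) (k l : nat) (e : pred (seq V)).
Hypotheses (l0 : 0 < l) (l2k : 2 * l < k) (eP : edge_pred k e).
Local Notation r := (k - l).

Definition abs_short := conn_len k l (2 * l).+1.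
Definition abs_long := conn_len k l (2 * l).+2.
Definition abs_len := (l + (l + (abs_short + (abs_long + abs_long * swap_len k l))))%N.

(* [t] lists the ends [X] and [Y], the middles [W] and [W'] of two [l]-paths from [X] to [Y],
   and a gadget for each pair of [zip (W ++ S) W']: exchanging these pairs frees [S]. *)
Definition absorbs (S t : seq V) : bool :=
  let X := take l t in let t1 := drop l t in
  let Y := take l t1 in let t2 := drop l t1 in
  let W := take abs_short t2 in let t3 := drop abs_short t2 in
  let W' := take abs_long t3 in let G := drop abs_long t3 in
  [&& lpath k l e (2 * l).+2 (X ++ W ++ Y), lpath k l e (2 * l).+3 (X ++ W' ++ Y)
    & swap_all k l e (zip (W ++ S) W') G].

Definition abs_ends (t : seq V) : seq (seq V * seq V) :=
  let t1 := drop l t in let t3 := drop abs_short (drop l t1) in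
  (take l t, take l t1) :: swap_all_ends k l abs_long (drop abs_long t3).

Lemma abs_longE : abs_long = (abs_short + r)%N.
Proof. by rewrite /abs_long /abs_short /conn_len mulSn; clear; lia. Qed.

(** Without [S], the path through [W] is used and the gadgets host [W']; with [S], the path through
    [W'] is used and the gadgets host [W ++ S]. The lists to be paired have equal length because one
    more edge adds [r] vertices. *)
Lemma absorbs_spans S t : size S = r -> size t = abs_len -> absorbs S t ->
  spans k l e (abs_ends t) t /\ spans k l e (abs_ends t) (t ++ S).
Proof.
rewrite /abs_len /absorbs /abs_ends => sS st.
set X := take l t; set t1 := drop l t; set Y := take l t1; set t2 := drop l t1.
set W := take abs_short t2; set t3 := drop abs_short t2.
set W' := take abs_long t3; set G := drop abs_long t3.
case/and3P=> lpW lpW' swG.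
have st1 : size t1 = (l + (abs_short + (abs_long + abs_long * swap_len k l)))%N.
  by rewrite size_drop st addKn.
have st2 : size t2 = (abs_short + (abs_long + abs_long * swap_len k l))%N.
  by rewrite size_drop st1 addKn.
have st3 : size t3 = (abs_long + abs_long * swap_len k l)%N.
  by rewrite size_drop st2 addKn.
have sG : size G = (abs_long * swap_len k l)%N by rewrite size_drop st3 addKn.
have sW : size W = abs_short by rewrite size_takel // st2 leq_addr.
have sW' : size W' = abs_long by rewrite size_takel // st3 leq_addr.
have sX : size X = l by rewrite size_takel // st leq_addr.
have sY : size Y = l by rewrite size_takel // st1 leq_addr.
have sWS : size (W ++ S) = abs_long by rewrite size_cat sW sS abs_longE.
have sz : size (zip (W ++ S) W') = abs_long by rewrite size_zip sWS sW' minnn.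
have := swap_all_spans l2k eP l0 (_ : size G = (size (zip (W ++ S) W') * _)%N) swG.
rewrite sz => /(_ sG) [].
rewrite unzip1_zip ?unzip2_zip ?sWS ?sW' // => sp1 sp2.
have tE : t = X ++ Y ++ W ++ W' ++ G by rewrite !cat_take_drop.
have eX A : ends l (X ++ A ++ Y) = (X, Y).
  by rewrite (ends_cat l2k) ?sX ?sY // take_oversize ?sX // subnn drop0.
have spW := spans1 lpW; have spW' := spans1 lpW'; rewrite !eX in spW spW'.
split; [have := spans_cat spW sp2 | have := spans_cat spW' sp1];
apply: spans_perm; rewrite tE; apply/permP => p; rewrite !count_cat; lia.
Qed.

End AbsorberShape.

Section Absorbers.
Variables (R : realFieldType) (V : finType) (k l : nat) (e : pred (seq V)).
Hypotheses (l0 : (0 < l)%N) (l2k : (2 * l < k)%N) (eP : edge_pred k e).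
Hypothesis V0 : (0 < size (enum V))%N.
Local Open Scope ring_scope.
Local Notation r := (k - l)%N.
Local Notation E := (Em (R := R) (enum V)).
Local Notation n := (size (enum V)).
Local Notation lp := (lpath k l e).
Local Notation conn := (conn R k l e).
Local Notation ash := (abs_short k l).
Local Notation alg := (abs_long k l).
Variable c : R.
Hypothesis c0 : 0 < c.
Hypothesis deg : forall v, uniq v -> (size v <= l.+1)%N -> c <= link_density R k e (enum V) v.

Let eperm u v : perm_eq u v -> e u = e v. Proof. by case: eP => _ _; apply. Qed.
Let n0 : 0 < n%:R :> R. Proof. by rewrite ltr0n. Qed.

Let Eb_ge0 m (P : pred (seq V)) : 0 <= E m (fun s => (P s)%:R).
Proof. by apply: Em_ge0 => *; apply: ler0n. Qed.

Let Eb_le1 m (P : pred (seq V)) : E m (fun s => (P s)%:R) <= 1.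
Proof. by apply: Em_le1 => // *; rewrite lern1 leq_b1. Qed.

Definition swap_density X U : R := E (swap_len k l) (fun g => (swap_gadget k l e X U g)%:R).

Let gam f X : R := E 1 (fun Y => (e (X ++ Y ++ f))%:R).
Let twin X U : R := E (k - 2) (fun f => gam f X * gam f U).

(** For fixed [f], the vertices [X'] and [U'] are chosen independently, which gives the product in
    [twin]. The remaining edge extends the [l.+1] vertices [X'], [U'] and [J], and has density at
    least [c] unless these coincide. *)
Lemma swap_density_ge X U : size X = 1 -> size U = 1 ->
  c * twin X U - c * ((l.+1 * l.+1)%:R / n%:R) <= swap_density X U.
Proof.
move=> sX sU; rewrite /swap_density /swap_len.
pose J f := take l.-1 (f : seq V).
have -> : twin X U = E 1 (fun X' => E 1 (fun U' => E (k - 2) (fun f =>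
    (e (X' ++ U ++ f))%:R * (e (X ++ U' ++ f))%:R))).
  rewrite /twin; under [RHS]eq_Em do rewrite Em_swap; rewrite [RHS]Em_swap.
  apply: eq_Em => f _ _; rewrite mulrC /gam -EmZr; apply: eq_Em => X' _ _; rewrite -EmZ.
  apply: eq_Em => U' _ _; congr (_%:R * _); congr nat_of_bool; apply: eperm.
  by rewrite perm_catCA perm_refl.
have : E 1 (fun X' => E 1 (fun U' => E (k - 2) (fun f => (~~ uniq (X' ++ U' ++ J f))%:R)))
    <= (l.+1 * l.+1)%:R / n%:R.
  apply: le_trans _ (Em_nuniq_le R l.+1 (enum_uniq V) V0).
  rewrite -(Em_take l.+1 (k - l.+1) _ V0).
  rewrite (_ : (l.+1 + (k - l.+1))%N = (1 + (1 + (k - 2)))%N); last by lia.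
  rewrite Em_cat; apply: le_Em => X' sX' _; rewrite Em_cat; apply: le_Em => U' sU' _.
  apply: le_Em => f _ _; rewrite (take_cat l.+1 X') sX' ltnS ltn0 subSS subn0.
  by rewrite (take_cat l U') sU' ltnNge l0 subn1.
move/(ler_wpM2l (ltW c0)); rewrite -lerN2 => /(lerD (lexx _))/le_trans; apply.
rewrite -!EmZ -EmB Em_cat; apply: le_Em => X' sX' _.
rewrite -!EmZ -EmB Em_cat; apply: le_Em => U' sU' _.
rewrite -!EmZ -EmB Em_cat; apply: le_Em => f sf _.
pose a : R := (e (X' ++ U ++ f))%:R * (e (X ++ U' ++ f))%:R.
have a0 : 0 <= a by rewrite mulr_ge0.
have a1 : a <= 1 by rewrite /a -natrM mulnb lern1 leq_b1.
have -> : E r.-1 (fun M1 => (swap_gadget k l e X U (X' ++ U' ++ f ++ M1))%:R)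
    = a * E r.-1 (fun M1 => (e ((X' ++ U' ++ J f) ++ M1))%:R).
  rewrite -EmZ; apply: eq_Em => M1 sM1 _; rewrite /swap_gadget.
  have d2 : drop 2 (X' ++ U' ++ f ++ M1) = f ++ M1.
    by rewrite catA drop_size_cat // size_cat sX' sU'.
  rewrite d2 (take_size_cat _ sX') (drop_size_cat _ sX') (take_size_cat _ sU').
  rewrite (take_size_cat _ sf) (drop_size_cat _ sf).
  by rewrite /a -!natrM !mulnb -!catA andbC.
rewrite -/a; case: (boolP (uniq _)) => uv /=; last first.
  rewrite mulr1; apply: (@le_trans _ _ 0); last by rewrite mulr_ge0.
  by rewrite subr_le0 ler_piMr // ltW.
rewrite mulr0 subr0 mulrC ler_wpM2l //.
have sv : size (X' ++ U' ++ J f) = l.+1.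
  by rewrite !size_cat sX' sU' size_takel ?sf; lia.
apply: le_trans (deg uv _) _; first by rewrite sv.
by rewrite /link_density sv (_ : (k - l.+1)%N = r.-1) //; lia.
Qed.

(** Distinct [X] and [U] lie in edges [X ++ U ++ f] of density at least [c]. Those with
    [gam f X < th] have total density at most [th], since averaging over [U] gives [gam f X] again;
    the same holds for [U]. For the other [f] the product of the two values of [gam] is at least
    [th ^+ 2], so a pair with [twin X U < th ^+ 3] has at most a proportion [th] of them. *)
Lemma twin_pairs th : 0 < th ->
  c * E 1 (fun X => E 1 (fun U => (twin X U < th ^+ 3)%R%:R)) <= 3 * th + c * (4 / n%:R).
Proof.
move=> th0; pose ev X U := (twin X U < th ^+ 3)%R.
pose w X U f : R := (e (X ++ U ++ f))%:R.
have gam0 f X : 0 <= gam f X by apply: Eb_ge0.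
have S1 : c * E 1 (fun X => E 1 (fun U => (ev X U)%:R)) <=
   E 1 (fun X => E 1 (fun U => (ev X U)%:R * E (k - 2) (w X U))) + c * (4 / n%:R).
  have := Em_nuniq_le R (1 + 1) (enum_uniq V) V0; rewrite Em_cat => /(ler_wpM2l (ltW c0)).
  move=> H; apply: le_trans _ (lerD (lexx _) H); rewrite -!EmZ -EmD; apply: le_Em => X sX _.
  rewrite -!EmZ -EmD; apply: le_Em => U sU _.
  have Ew0 : 0 <= E (k - 2) (w X U) by apply: Eb_ge0.
  case us: (uniq (X ++ U)) => /=; last first.
    by move: c0; case: (ev X U) => /=; lra.
  rewrite mulr0 addr0 mulrC ler_wpM2l //.
  have sv : size (X ++ U) = 2 by rewrite size_cat sX sU.
  apply: le_trans (deg us _) _; first by rewrite sv; lia.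
  by rewrite /link_density sv; apply: le_Em => f _ _; rewrite -catA.
have S2 : E 1 (fun X => E 1 (fun U => E (k - 2) (fun f => w X U f * (gam f X < th)%R%:R))) <= th.
  under eq_Em do rewrite Em_swap; rewrite Em_swap -[leRHS](Em_cst (k - 2) th V0).
  apply: le_Em => f _ _; rewrite -[leRHS](Em_cst 1 th V0); apply: le_Em => X _ _.
  rewrite EmZr -/(gam f X); case: (ltP (gam f X)) => h /=; last by rewrite mulr0 ltW.
  by rewrite mulr1 ltW.
have S3 : E 1 (fun X => E 1 (fun U => E (k - 2) (fun f => w X U f * (gam f U < th)%R%:R))) <= th.
  rewrite Em_swap; apply: le_trans S2; apply: le_Em => U _ _; apply: le_Em => X _ _.
  apply: le_Em => f _ _; rewrite /w (@eperm (X ++ U ++ f) (U ++ X ++ f)) //.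
  by rewrite perm_catCA perm_refl.
have S4 : E 1 (fun X => E 1 (fun U => (ev X U)%:R * (twin X U / th ^+ 2))) <= th.
  rewrite -[leRHS](Em_cst 1 th V0); apply: le_Em => X _ _.
  rewrite -[leRHS](Em_cst 1 th V0); apply: le_Em => U _ _; rewrite /ev.
  case: (ltP (twin X U)) => h /=; last by rewrite mul0r ltW.
  by rewrite mul1r ler_pdivrMr ?exprn_gt0 // -exprS ltW.
apply: le_trans S1 _; rewrite lerD2r (_ : 3 * th = th + (th + th)); last by ring.
apply: le_trans _ (lerD S2 (lerD S3 S4)); rewrite -!EmD; apply: le_Em => X _ _.
rewrite -!EmD; apply: le_Em => U _ _.
rewrite (_ : (ev X U)%:R * (twin X U / th ^+ 2) =
  E (k - 2) (fun f => (ev X U)%:R * (gam f X * gam f U / th ^+ 2))); last by rewrite EmZ EmZr.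
rewrite -EmZ -!EmD; apply: le_Em => f _ _.
have th20 : 0 < th ^+ 2 by rewrite exprn_gt0.
have w0 : 0 <= w X U f by apply: ler0n.
have w1 : w X U f <= 1 by rewrite lern1 leq_b1.
have P0 : 0 <= gam f X * gam f U / th ^+ 2 by apply: divr_ge0; [apply: mulr_ge0 | apply: ltW].
case: (ev X U); case: (ltP (gam f X)) => h1; case: (ltP (gam f U)) => h2 /=; try lra.
have : 1 <= gam f X * gam f U / th ^+ 2 by rewrite ler_pdivlMr // mul1r expr2 ler_pM // ltW.
lra.
Qed.

Section Threshold.
Variable th : R.
Hypotheses (th0 : 0 < th) (th_n : 4 * c <= th * n%:R)
  (th3_n : 2 * (l.+1 * l.+1)%:R <= th ^+ 3 * n%:R).

Definition swappable (p : V * V) : bool :=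
  c * th ^+ 3 / 2 <= swap_density [:: p.1] [:: p.2].

Definition nswap (X U : seq V) : bool := (swap_density X U < c * th ^+ 3 / 2)%R.

Lemma nswap_pairs : E 1 (fun X => E 1 (fun U => (nswap X U)%:R)) <= 4 * th / c.
Proof.
rewrite ler_pdivlMr // mulrC.
apply: (@le_trans _ _ (c * E 1 (fun X => E 1 (fun U => (twin X U < th ^+ 3)%R%:R)))).
  rewrite ler_wpM2l ?(ltW c0) //; apply: le_Em => X sX _; apply: le_Em => U sU _.
  rewrite ler_nat /nswap; case: (ltP (swap_density X U)) => // h; rewrite lt0b.
  have h2 := le_lt_trans (swap_density_ge sX sU) h.
  rewrite ltNge; apply/negP => h3.
  have h4 : c * ((l.+1 * l.+1)%:R / n%:R) <= c * (th ^+ 3 / 2).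
    rewrite ler_wpM2l ?(ltW c0) // ler_pdivrMr // mulrAC ler_pdivlMr // mulrC.
    exact: th3_n.
  by have := ler_wpM2l (ltW c0) h3; lra.
apply: le_trans (twin_pairs th0) _.
have : c * (4 / n%:R) <= th by rewrite mulrA ler_pdivrMr // mulrC.
lra.
Qed.

Definition unswappable (rho : R) (x : V) : bool :=
  rho < E 1 (fun U => (nswap [:: x] U)%:R).

Lemma unswappable_le rho : 0 < rho ->
  (size [seq x <- enum V | unswappable rho x])%:R <= 4 * th / (c * rho) * n%:R.
Proof.
move=> rho0; have := nswap_pairs; rewrite Em1 ler_pdivrMr // => H.
rewrite -(ler_pM2r rho0); apply: (@le_trans _ _ (4 * th / c * n%:R)); last first.
  by rewrite invfM !mulrA [leRHS]mulrAC mulfVK ?gt_eqF.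
apply: le_trans H; rewrite size_filter -sum1_count natr_sum mulr_suml big_mkcond.
apply: ler_sum => x _; case: ifP => [/ltW|_]; first by rewrite mul1r.
exact: Eb_ge0.
Qed.

Lemma nswap_zip m :
  E m (fun W => E m (fun W' => (~~ all swappable (zip W W'))%:R)) <= m%:R * (4 * th / c).
Proof.
elim: m => [|m IH]; first by rewrite !Em0 mul0r.
rewrite -addn1 natrD mulrDl mul1r; apply: le_trans _ (lerD IH nswap_pairs).
have e1 : E 1 (fun X => E 1 (fun U => (nswap X U)%:R)) =
    E 1 (fun X => E m (fun=> E 1 (fun U => E m (fun=> (nswap X U)%:R)))).
  by apply: eq_Em => X _ _; rewrite Em_cst //; apply: eq_Em => U _ _; rewrite Em_cst.
have e2 : E m (fun W => E m (fun W' => (~~ all swappable (zip W W'))%:R)) =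
    E 1 (fun X => E m (fun W => E 1 (fun U => E m (fun W' => (~~ all swappable (zip W W'))%:R)))).
  by rewrite Em_cst //; apply: eq_Em => W _ _; rewrite Em_cst.
rewrite e1 e2 addn1 EmS -EmD; apply: le_Em => -[|x []] // _ _.
rewrite -EmD; apply: le_Em => W _ _; rewrite EmS -EmD; apply: le_Em => -[|u []] // _ _.
rewrite -EmD; apply: le_Em => W' _ _; rewrite -natrD ler_nat /= negb_and.
rewrite /swappable -ltNge /= -/(nswap [:: x] [:: u]).
by case: nswap; case: (all _ _).
Qed.

Lemma nswap_zip_fixed rho (S : seq V) :
  {in S, forall x, ~~ unswappable rho x} ->
  E (size S) (fun W' => (~~ all swappable (zip S W'))%:R) <= (size S)%:R * rho.
Proof.
elim: S => [|x S IH] nS; first by rewrite Em0 mul0r.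
have {}IH := IH (fun y yS => nS y (mem_behead (yS : y \in behead (x :: S)))).
have nx := nS x (mem_head _ _); rewrite /unswappable -leNgt in nx.
rewrite /= -addn1 natrD mulrDl mul1r; apply: le_trans _ (lerD IH nx).
rewrite -[X in X + _](Em_cst 1 _ V0) addn1 EmS -EmD; apply: le_Em => -[|u []] // _ _.
rewrite -[X in _ + X](Em_cst (size S) _ V0) -EmD; apply: le_Em => W' _ _.
rewrite -natrD ler_nat /= negb_and /swappable -ltNge /= -/(nswap [:: x] [:: u]).
by case: nswap; case: (all _ _).
Qed.

Lemma swap_all_density ps : all swappable ps ->
  (c * th ^+ 3 / 2) ^+ size ps <=
    E (size ps * swap_len k l) (fun G => (swap_all k l e ps G)%:R).
Proof.
have t0 : 0 <= c * th ^+ 3 / 2 by rewrite divr_ge0 ?mulr_ge0 ?exprn_ge0 // ltW.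
elim: ps => [|p ps IH] /=; first by rewrite Em0.
case/andP=> sp /IH {}IH; rewrite exprS mulSn Em_cat.
apply: le_trans (ler_pM t0 (exprn_ge0 _ t0) sp IH) _.
rewrite -EmZr; apply: le_Em => g sg _; rewrite -EmZ; apply: le_Em => G _ _.
by rewrite take_size_cat // drop_size_cat // -natrM mulnb.
Qed.

Definition abs_density (kappa : R) : R :=
  (c * th ^+ 3 / 2) ^+ alg * (kappa ^+ 2 * c / 8).

(** Random [X], [Y], [W], [W'] form both paths with density at least [kappa ^+ 2 * c / 4]. By a
    union bound, pairs that are not swappable spoil at most half of this. Each of the remaining
    choices extends by gadgets of density [c * th ^+ 3 / 2] per pair. *)
Lemma absorbs_density S rho kappa : size S = r ->
  {in S, forall x, ~~ unswappable rho x} -> 0 < kappa ->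
  (forall X Y, uniq X -> size X = l -> uniq Y -> size Y = l ->
     kappa <= conn (2 * l).+1 X Y) ->
  ash%:R * (4 * th / c) + r%:R * rho <= kappa ^+ 2 * c / 8 ->
  (4 * l * l)%:R <= n%:R * c -> (8 * l * l <= n)%N ->
  abs_density kappa <= E (abs_len k l) (fun t => (absorbs k l e S t)%:R).
Proof.
move=> sS nS kappa0 connP le_rho c_n le_n.
have kappa1 : kappa <= 1.
  have E1 : 1 <= E l (fun s => (predT s)%:R) by rewrite (eq_Em (g := fun=> 1)) ?Em_cst.
  have lt1 : (l * (l + size ([::] : seq V)))%:R < 1 * n%:R :> R.
    rewrite mul1r ltr_nat addn0; apply: leq_trans le_n; rewrite -mulnA ltn_Pmull //.
    by rewrite muln_gt0 l0.
  have [X [sX _ _ uX _]] := Em_fresh (enum_uniq V) V0 E1 lt1.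
  apply: le_trans (connP X X uX sX uX sX) _; exact: Eb_le1.
(* One edge leads from [X] to an intermediate [J], then [connP] applies; the mean [c] drops to
   [3 * c / 4] because [J] must have distinct entries. *)
have connL X Y : uniq X -> size X = l -> uniq Y -> size Y = l ->
    kappa * (3 * c / 4) <= conn (2 * l).+2 X Y.
  move=> uX sX uY sY; rewrite -[(2 * l).+2]/((0 + (2 * l).+1).+1) conn_comp //.
  apply: (@le_trans _ _ (E l (fun J => kappa * (conn 0 X J - (~~ uniq J)%:R)))).
    rewrite EmZ EmB ler_wpM2l ?(ltW kappa0) //.
    have H1 := conn0_mean l2k V0 c0 deg uX sX.
    have H2 := Em_nuniq_le R l (enum_uniq V) V0.
    have H3 : (l * l)%:R / n%:R <= c / 4.
      by rewrite ler_pdivrMr //; move: c_n; rewrite -mulnA natrM; lra.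
    lra.
  apply: le_Em => J sJ _; case: (boolP (uniq J)) => uJ /=.
    by rewrite subr0 mulrC ler_wpM2l ?conn_ge0 // connP.
  apply: (@le_trans _ _ 0); last by rewrite mulr_ge0 ?conn_ge0.
  by rewrite pmulr_rle0 // subr_le0; apply: Eb_le1.
pose t : R := (c * th ^+ 3 / 2) ^+ alg.
have t0 : 0 <= t by rewrite exprn_ge0 // divr_ge0 ?mulr_ge0 ?exprn_ge0 // ltW.
pose good W W' := all swappable (zip (W ++ S) W').
pose F X Y W W' : R := (lp (2 * l).+2 (X ++ W ++ Y))%:R * (lp (2 * l).+3 (X ++ W' ++ Y))%:R.
(* Subtracting the indicator of a bad pairing makes the integrand nonpositive there, so gadgets are
   needed only for good pairings. *)
apply: (@le_trans _ _ (E l (fun X => E l (fun Y => E ash (fun W => E alg (fun W' =>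
    t * (F X Y W W' - (~~ good W W')%:R))))))).
  have -> : abs_density kappa = E l (fun X => E l (fun Y => t * (kappa ^+ 2 * c / 8))).
    by rewrite !Em_cst.
  have -> : E l (fun X => E l (fun Y => E ash (fun W => E alg (fun W' =>
      t * (F X Y W W' - (~~ good W W')%:R))))) =
    E l (fun X => E l (fun Y => t * (conn (2 * l).+1 X Y * conn (2 * l).+2 X Y
       - E ash (fun W => E alg (fun W' => (~~ good W W')%:R))))).
    apply: eq_Em => X _ _; apply: eq_Em => Y _ _.
    rewrite /conn -EmZr -EmB -EmZ; apply: eq_Em => W _ _.
    by rewrite -EmZ -EmB -EmZ; apply: eq_Em => W' _ _.
  have B_le : E ash (fun W => E alg (fun W' => (~~ good W W')%:R)) <= kappa ^+ 2 * c / 8.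
    apply: le_trans _ le_rho; rewrite -sS.
    apply: le_trans _ (lerD (nswap_zip ash) (nswap_zip_fixed nS)).
    rewrite -[X in _ + X](Em_cst ash _ V0) -EmD; apply: le_Em => W sW _.
    rewrite -[X in _ + X](Em_cst ash _ V0) -EmD abs_longE -sS Em_cat.
    apply: le_Em => W1 sW1 _; rewrite -[X in X + _](Em_cst (size S) _ V0) -EmD.
    apply: le_Em => W2 sW2 _; rewrite -natrD ler_nat /good zip_cat ?sW // all_cat.
    by case: (all _ _); case: (all _ _).
  have P_ge : kappa ^+ 2 * c / 4 <= E l (fun X => E l (fun Y =>
      conn (2 * l).+1 X Y * conn (2 * l).+2 X Y)).
    have nu : E l (fun X => (~~ uniq X)%:R) <= 1 / 8.
      apply: le_trans (Em_nuniq_le R l (enum_uniq V) V0) _.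
      by rewrite ler_pdivrMr // mulrC mulrA ler_pdivlMr // mulr1 -natrM ler_nat mulnC mulnA.
    pose K := kappa ^+ 2 * (3 * c / 4).
    have K0 : 0 <= K by rewrite mulr_ge0 ?exprn_ge0 ?(ltW kappa0) // divr_ge0 ?mulr_ge0 ?(ltW c0).
    apply: (@le_trans _ _ (E l (fun X => E l (fun Y =>
      K * (1 - (~~ uniq X)%:R - (~~ uniq Y)%:R))))); last first.
      apply: le_Em => X sX _; apply: le_Em => Y sY _.
      have := conn_ge0 R k l e (2 * l).+1 X Y; have := conn_ge0 R k l e (2 * l).+2 X Y.
      case: (boolP (uniq X)) => uX /=; case: (boolP (uniq Y)) => uY /= h1 h2; first last.
      - by apply: (@le_trans _ _ 0); [apply: mulr_ge0_le0 => //; lra | apply: mulr_ge0].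
      - by apply: (@le_trans _ _ 0); [apply: mulr_ge0_le0 => //; lra | apply: mulr_ge0].
      - by apply: (@le_trans _ _ 0); [apply: mulr_ge0_le0 => //; lra | apply: mulr_ge0].
      rewrite !subr0 mulr1 /K expr2 -mulrA ler_pM ?connP ?connL ?(ltW kappa0) //.
      by rewrite mulr_ge0 ?(ltW kappa0) // divr_ge0 ?mulr_ge0 ?(ltW c0).
    have -> : E l (fun X => E l (fun Y => K * (1 - (~~ uniq X)%:R - (~~ uniq Y)%:R)))
       = K * (1 - E l (fun X => (~~ uniq X)%:R) - E l (fun X => (~~ uniq X)%:R)).
      rewrite -[X in X - _ - _](Em_cst l _ V0) -EmB -[X in _ - X](Em_cst l _ V0) -EmB -EmZ.
      apply: eq_Em => X _ _; rewrite EmZ EmB Em_cst //.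
    apply: (@le_trans _ _ (K * (3 / 4))); last by rewrite ler_wpM2l //; lra.
    have : 0 <= kappa ^+ 2 * c by rewrite mulr_ge0 ?exprn_ge0 ?(ltW kappa0) ?(ltW c0).
    rewrite /K; lra.
  under [leRHS]eq_Em do rewrite EmZ EmB Em_cst //.
  rewrite [leRHS]EmZ EmB !(Em_cst l _ V0) ler_wpM2l //; lra.
rewrite /abs_len Em_cat; apply: le_Em => X sX _; rewrite Em_cat; apply: le_Em => Y sY _.
rewrite Em_cat; apply: le_Em => W sW _; rewrite Em_cat; apply: le_Em => W' sW' _.
have -> : E (alg * swap_len k l) (fun G => (absorbs k l e S (X ++ Y ++ W ++ W' ++ G))%:R) =
    F X Y W W' * E (alg * swap_len k l) (fun G => (swap_all k l e (zip (W ++ S) W') G)%:R).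
  rewrite -EmZ; apply: eq_Em => G _ _; rewrite /absorbs.
  rewrite !(take_size_cat _ sX) !(drop_size_cat _ sX) !(take_size_cat _ sY) !(drop_size_cat _ sY).
  rewrite !(take_size_cat _ sW) !(drop_size_cat _ sW) !(take_size_cat _ sW') !(drop_size_cat _ sW').
  by rewrite /F -!natrM !mulnb andbA.
have F0 : 0 <= F X Y W W' by rewrite mulr_ge0.
case: (boolP (good W W')) => /= gW.
  rewrite subr0 mulrC ler_wpM2l //.
  have := swap_all_density gW; rewrite size_zip size_cat sW sW' sS -abs_longE minnn; exact.
apply: (@le_trans _ _ 0); last by rewrite mulr_ge0 ?Eb_ge0.
rewrite mulr_ge0_le0 // subr_le0 /F -natrM mulnb lern1 leq_b1 //.
Qed.

End Threshold.
End Absorbers.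

(** * Concentration and blow-ups *)

Lemma nat_above (R : realType) (x : R) : exists n, (x <= n%:R)%R.
Proof.
have [x0|/ltW x0] := leP 0%R x; last by exists 0%N.
by exists (Num.bound x); apply/ltW/archi_boundP.
Qed.

Section Exponential.
Variable R : realType.
Local Open Scope ring_scope.

(** From [expR (- t) >= 1 - t] and the identity [(1 + t + 2 * t ^+ 2) * (1 - t) = 1 + t ^+ 2 * (1 -
    2 * t)]. *)
Lemma expR_le_quadratic (t : R) : t <= 1 / 2 -> expR t <= 1 + t + 2 * t ^+ 2.
Proof.
move=> t12; have h := expR_ge1Dx (- t).
have t1 : 0 < 1 - t by lra.
rewrite -[t in expR t]opprK expRN -[_^-1]div1r ler_pdivrMr ?expR_gt0 //.
apply: (@le_trans _ _ ((1 + t + 2 * t ^+ 2) * (1 - t))); last first.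
  by rewrite ler_wpM2l //; have := sqr_ge0 (1 + 4 * t); lra.
have : 0 <= t ^+ 2 * (1 - 2 * t) by rewrite mulr_ge0 ?sqr_ge0 //; lra.
lra.
Qed.

Lemma exp_beats_poly (a eps : R) K : 0 < a -> 0 < eps ->
  exists m0, forall m, (m0 <= m)%N -> m%:R ^+ K * expR (- (a * m%:R)) <= eps.
Proof.
move=> a0 e0; pose C : R := K.+1`!%:R / (a ^+ K.+1 * eps).
have [m0 m0P] := nat_above C; exists m0.+1 => m lt_m.
have f0 : 0 < K.+1`!%:R :> R by rewrite ltr0n fact_gt0.
have m00 : 0 < m%:R :> R by rewrite ltr0n; apply: leq_ltn_trans lt_m.
have Cm : C <= m%:R by apply: le_trans m0P _; rewrite ler_nat ltnW.
have am0 : 0 <= a * m%:R by rewrite mulr_ge0 ?ltW.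
rewrite expRN ler_pdivrMr ?expR_gt0 //.
apply: (@le_trans _ _ (eps * ((a * m%:R) ^+ K.+1 / K.+1`!%:R))); last first.
  by rewrite ler_pM2l //; apply: le_trans _ (expR_ge1Dxn K am0); rewrite lerDr.
have -> : eps * ((a * m%:R) ^+ K.+1 / K.+1`!%:R)
    = m%:R ^+ K * (m%:R * (a ^+ K.+1 * eps) / K.+1`!%:R).
  by rewrite exprMn [m%:R ^+ K.+1]exprS; ring.
rewrite ler_peMr ?exprn_ge0 ?(ltW m00) // ler_pdivlMr // mul1r.
by move: Cm; rewrite /C ler_pdivrMr ?mulr_gt0 ?exprn_gt0.
Qed.

End Exponential.

Section Concentration.
Variables (R : realType) (V : eqType).
Local Open Scope ring_scope.

Lemma Em_prod (W : seq V) m (g : V -> R) :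
  Em W m (fun s => \prod_(x <- s) g x) = ((\sum_(x <- W) g x) / (size W)%:R) ^+ m.
Proof.
elim: m => [|m IH]; first by rewrite Em0 big_nil.
rewrite EmS exprS -IH Em1 mulrAC; congr (_ / _); rewrite mulr_suml.
by apply: eq_bigr => x _; rewrite -EmZ; apply: eq_Em => s _ _; rewrite big_cons.
Qed.

Lemma chernoff (W : seq V) M (F : V -> R) mu eta : (0 < size W)%N ->
  {in W, forall x, 0 <= F x <= 1} -> mu = (\sum_(x <- W) F x) / (size W)%:R ->
  0 < eta -> eta <= 1 ->
  Em W M (fun s => (\sum_(x <- s) F x <= M%:R * (mu - eta))%R%:R)
    <= expR (- (eta ^+ 2 / 8 * M%:R)).
Proof.
move=> W0 F01 muE e0 e1; have n0 : 0 < (size W)%:R :> R by rewrite ltr0n.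
have mu01 : 0 <= mu <= 1.
  rewrite muE divr_ge0 ?ler0n ?big_seq ?sumr_ge0 //=; last by move=> x /F01/andP[].
  rewrite ler_pdivrMr // mul1r -sum1_size natr_sum [leRHS]big_seq.
  by apply: ler_sum => x /F01/andP[].
(* The exponent per sample is [- lam * eta + 2 * lam ^+ 2]; it is minimal at [eta / 4], where it
   equals [- eta ^+ 2 / 8]. *)
pose lam : R := eta / 4; pose g x := expR (lam * (mu - F x)).
apply: (@le_trans _ _ (Em W M (fun s => expR (- (lam * eta * M%:R)) * \prod_(x <- s) g x))).
  apply: le_Em => s sM _; rewrite -expR_sum -expRD.
  case: (leP (\sum_(x <- s) F x)) => [le_F|_] /=; last exact: expR_ge0.
  have -> : \sum_(i <- s) lam * (mu - F i) = lam * (M%:R * mu - \sum_(i <- s) F i).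
    rewrite -mulr_sumr; congr (_ * _); rewrite sumrB -sM; congr (_ - _).
    by rewrite sumr_const_seq.
  rewrite -[X in X <= _]expR0 ler_expR.
  have : 0 <= lam * (M%:R * (mu - eta) - \sum_(x <- s) F x).
    by rewrite mulr_ge0 ?subr_ge0 // divr_ge0 // ltW.
  lra.
rewrite EmZ Em_prod.
have avg_le : (\sum_(x <- W) g x) / (size W)%:R <= expR (2 * lam ^+ 2).
  apply: le_trans _ (expR_ge1Dx _); rewrite ler_pdivrMr //.
  apply: (@le_trans _ _ (\sum_(x <- W) (1 + lam * (mu - F x) + 2 * lam ^+ 2))).
    rewrite big_seq [leRHS]big_seq; apply: ler_sum => x /F01/andP[F0 F1].
    have l0 : 0 <= lam by rewrite divr_ge0 // ltW.
    have l1 : lam <= 1 / 4 by rewrite /lam; lra.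
    have d1 : mu - F x <= 1 by lra.
    have d2 : -1 <= mu - F x by lra.
    apply: le_trans (expR_le_quadratic _) _; first by nra.
    rewrite lerD2l ler_pM2l // exprMn ler_piMr ?sqr_ge0 //.
    by rewrite expr2; nra.
  rewrite !big_split /= -mulr_sumr sumrB.
  have -> : \sum_(i <- W) F i = mu * (size W)%:R by rewrite muE divfK ?gt_eqF.
  by rewrite !sumr_const_seq; lra.
apply: le_trans (ler_wpM2l (expR_ge0 _) (lerXn2r M _ _ avg_le)) _.
- by rewrite nnegrE divr_ge0 ?sumr_ge0 // => x _; apply: expR_ge0.
- by rewrite nnegrE expR_ge0.
rewrite -expRM_natl -expRD ler_expR /lam; lra.
Qed.

End Concentration.

Lemma all2_cat_imp (S T : Type) (q : S -> T -> bool) s1 s2 t1 t2 :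
  all2 q s1 t1 -> all2 q s2 t2 -> all2 q (s1 ++ s2) (t1 ++ t2).
Proof. by elim: s1 t1 => [|x s1 IH] [|y t1] //= /andP[-> /IH h] /h. Qed.

Definition transversal (V : eqType) : seq V -> seq (seq V) -> bool :=
  all2 (fun y (B : seq V) => y \in B).

Section Blowup.
Variable R : realType.
Local Open Scope ring_scope.

Lemma Em_all (V : eqType) (W : seq V) b (P : pred V) :
  Em W b (fun s => (all P s)%:R) = Em W 1 (fun s => (all P s)%:R) ^+ b :> R.
Proof.
elim: b => [|b IH]; first by rewrite Em0.
rewrite EmS exprS -IH -EmZr; apply: eq_Em => x _ _; rewrite -EmZ.
by apply: eq_Em => s _ _; rewrite all_cat -natrM mulnb.
Qed.

(** Erdős's supersaturation argument, one coordinate at a time. A proportion at least [kappa / 2] of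
    the tails [y] admits a proportion at least [kappa / 2] of first entries, so a random [b]-tuple
    of first entries suits such a [y] with probability at least [(kappa / 2) ^+ b]. Some fresh
    [b]-tuple then has many common tails, to which induction applies. *)
Lemma blowup h : forall (kappa : R) b fs, 0 < kappa -> exists N0,
  forall (V : eqType) (W F : seq V) (phi : pred (seq V)),
  uniq W -> (N0 < size W)%N -> (size F <= fs)%N ->
  kappa <= Em W h (fun y => (phi y)%:R) ->
  exists Bs, [/\ size Bs = h, all (fun B => size B == b) Bs,
    uniq (flatten Bs) /\ ~~ has (mem F) (flatten Bs), {subset flatten Bs <= W} &
    forall y, transversal y Bs -> phi y].
Proof.
elim: h => [|h IH] kappa b fs k0.
  exists 0%N => V W F phi _ _ _; rewrite Em0 => phi0; exists [::]; split=> // -[|//] _.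
  by case: (phi [::]) phi0 => //=; rewrite leNgt k0.
pose d : R := (kappa / 2) ^+ b.+1.
have d0 : 0 < d by rewrite exprn_gt0 // divr_gt0.
have [|N1 N1P] := IH (d / 2) b (fs + b)%N; first by rewrite divr_gt0.
have [N2 N2P] := nat_above (2 * (b * b + b * fs)%:R / d).
exists (N1 + N2)%N => V W F phi uW ltN sF le_k.
have W0 : (0 < size W)%N by apply: leq_ltn_trans ltN.
have n0 : 0 < (size W)%:R :> R by rewrite ltr0n.
pose psi s y := all (fun a => phi (a :: y)) s.
pose X y : R := Em W 1 (fun s => (psi s y)%:R).
have X0 y : 0 <= X y by apply: Em_ge0 => *; apply: ler0n.
have avg : d <= Em W b (fun s => Em W h (fun y => (psi s y)%:R)).
  rewrite Em_swap; under eq_Em do rewrite Em_all.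
  apply: (@le_trans _ _ (Em W h (fun y => (kappa / 2) ^+ b * (kappa / 2 <= X y)%R%:R))).
    rewrite EmZ /d exprSr ler_wpM2l ?exprn_ge0 ?divr_ge0 ?(ltW k0) //.
    have : kappa <= Em W h X.
      apply: le_trans le_k _; rewrite EmS /X [leRHS]Em_swap.
      apply: le_Em => -[|x []] // _ _; apply: le_Em => y _ _.
      by rewrite /psi /= andbT.
    have : Em W h X <= Em W h (fun y => kappa / 2 + (kappa / 2 <= X y)%R%:R).
      apply: le_Em => y _ _; case: (leP (kappa / 2)) => [_|/ltW hX] /=; last by rewrite addr0.
      rewrite -[leLHS]add0r lerD ?divr_ge0 ?(ltW k0) //.
      by apply: Em_le1 => // *; rewrite lern1 leq_b1.
    rewrite EmD Em_cst //; lra.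
  apply: le_Em => y _ _; case: (leP (kappa / 2)) => hX /=; last by rewrite mulr0 (exprn_ge0 _ (X0 y)).
  rewrite mulr1 lerXn2r // nnegrE; last exact: X0.
  by rewrite divr_ge0 ?(ltW k0).
pose f s : R := Em W h (fun y => (psi s y)%:R) - ((~~ uniq s)%:R + (has (mem F) s)%:R).
have : d / 2 <= Em W b f.
  have : (b * b)%:R / (size W)%:R + (b * size F)%:R / (size W)%:R <= d / 2.
    have {}N2P : 2 * (b * b + b * fs)%:R <= N2%:R * d by rewrite -ler_pdivrMr.
    rewrite -mulrDl ler_pdivrMr // -natrD.
    have h1 : (b * b + b * size F)%:R <= (b * b + b * fs)%:R :> R.
      by rewrite ler_nat leq_add2l leq_mul2l sF orbT.
    have h2 : N2%:R * d <= (size W)%:R * d.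
      by rewrite ler_wpM2r ?(ltW d0) // ler_nat; lia.
    lra.
  have := Em_nuniq_le R b uW W0; have := Em_mem_le R b F uW W0.
  rewrite /f EmB EmD; lra.
move=> /(Em_exists W0)[s [sb sW le_f]].
have [us Fs] : uniq s /\ ~~ has (mem F) s.
  have : Em W h (fun y => (psi s y)%:R) <= 1 :> R.
    by apply: Em_le1 => // *; rewrite lern1 leq_b1.
  move: le_f; rewrite /f; case: uniq; case: has => //=; lra.
have [|||Bs [sBs aBs [uBs FBs] BsW phiBs]] := N1P V W (F ++ s) (psi s) uW.
- by apply: leq_ltn_trans ltN; apply: leq_addr.
- by rewrite size_cat sb leq_add2r.
- by apply: le_trans le_f _; rewrite /f lerBlDr lerDl addr_ge0.
exists (s :: Bs); split=> /=.
- by rewrite sBs.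
- by rewrite sb eqxx.
- have : ~~ has (mem (flatten Bs)) (F ++ s) by rewrite has_sym.
  rewrite has_cat negb_or => /andP[h1 h2].
  by rewrite cat_uniq us uBs has_cat negb_or Fs !(has_sym _ (flatten Bs)) h1 h2.
- by move=> x; rewrite mem_cat => /orP[/sW|/BsW].
case=> [|a y] //= /andP[a_s /phiBs /allP]; exact.
Qed.

End Blowup.

(** * Paths running through a blow-up *)

Section Rows.
Variables (V : eqType) (x0 : V) (k l : nat) (e : pred (seq V)).
Hypotheses (l2k : 2 * l < k) (eP : edge_pred k e).
Implicit Types Bs : seq (seq V).

Definition brow Bs j : seq V := [seq nth x0 B j | B <- Bs].

Lemma brow_transversal Bs b j :
  all (fun B => size B == b) Bs -> j < b -> transversal (brow Bs j) Bs.
Proof.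
move=> + ltj; elim: Bs => //= B Bs IH /andP[/eqP sB /IH].
by rewrite /transversal /= => ->; rewrite mem_nth // sB.
Qed.

Lemma perm_brows Bs b : all (fun B => size B == b) Bs ->
  perm_eq (flatten [seq brow Bs j | j <- iota 0 b]) (flatten Bs).
Proof.
elim: Bs => [|B Bs IH] /=.
  by move=> _; elim: (iota 0 b).
case/andP=> /eqP sB /IH {}IH.
have BE : [seq nth x0 B i | i <- iota 0 b] = B by rewrite -sB; apply: mkseq_nth.
apply: (@perm_trans _ ([seq nth x0 B i | i <- iota 0 b]
    ++ flatten [seq brow Bs j | j <- iota 0 b])); last by rewrite BE perm_cat2l.
elim: (iota 0 b) => //= j s IHs; rewrite perm_cons /=.
by apply: perm_trans (perm_cat (perm_refl _) IHs) _; rewrite perm_catCA perm_refl.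
Qed.

(** Every row yields two edges, and the second one borrows its last [l] vertices from the next row.
    The beginning of one row followed by the rest of another is still a transversal, so the
    hypothesis covers this edge too. *)
Lemma brows_lpath Bs b g j0 : size Bs = 2 * (k - l) ->
  all (fun B => size B == b) Bs ->
  (forall y, transversal y Bs -> e (take k y) && e (drop (k - l) y ++ take l y)) ->
  j0 + g < b ->
  lpath k l e (2 * g)
    (flatten [seq brow Bs j | j <- iota j0 g] ++ take l (brow Bs (j0 + g))).
Proof.
move=> sBs aBs tr; elim: g j0 => [|g IH] j0 ltb.
  by rewrite /= addn0 size_takel // size_map sBs; lia.
have srow j : size (brow Bs j) = 2 * (k - l) by rewrite size_map.
rewrite (_ : 2 * g.+1 = 2 + 2 * g); last by lia.
rewrite [iota _ _]/= [map _ _]/= [flatten _]/= -catA addnS -addSn.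
have := IH j0.+1; rewrite addSnnS => /(_ ltb).
set rest := _ ++ take l _ => lp_rest.
have tE : take l rest = take l (brow Bs j0.+1).
  rewrite /rest; case: (g) => [|g'] /=; first by rewrite addn1 take_takel.
  by rewrite -catA takel_cat // srow; lia.
rewrite -(cat_take_drop l rest).
have stl : size (take l rest) = l by rewrite tE size_takel // srow; lia.
rewrite lpath_join ?srow // cat_take_drop lp_rest andbT tE.
have ltj : j0 < b by lia.
have ltj1 : j0.+1 < b by lia.
have t0 := brow_transversal aBs ltj; have t1 := brow_transversal aBs ltj1.
rewrite /= takel_cat ?srow; last by lia.
have /andP[-> _] := tr _ t0; rewrite drop_catl ?srow; last by lia.
have sdt : size (drop (k - l) (brow Bs j0) ++ take l (brow Bs j0.+1)) = k.
  by rewrite size_cat size_drop srow size_takel ?srow; lia.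
rewrite take_oversize ?sdt // size_drop sdt andbC; case: eqP => [_|]; last by lia.
have /tr/andP[_] : transversal (take l (brow Bs j0.+1) ++ drop l (brow Bs j0)) Bs.
  rewrite -[X in transversal _ X](cat_take_drop l Bs) /transversal /brow -!map_take -!map_drop.
  move: aBs; rewrite -{1}(cat_take_drop l Bs) all_cat => /andP[a1 a2].
  apply: all2_cat_imp; first exact: (brow_transversal a1 ltj1).
  exact: (brow_transversal a2 ltj).
have sl : size (take l (brow Bs j0.+1)) = l by rewrite size_takel // srow; lia.
rewrite take_size_cat // drop_cat sl; case: ltnP => [|_]; first by lia.
by rewrite drop_drop subnK //; lia.
Qed.

End Rows.

(** * Samples *)

Lemma iota_extend (p : seq nat) m : uniq p -> {in p, forall i, i < m} ->
  exists q, perm_eq (p ++ q) (iota 0 m).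
Proof.
move=> up ltp; exists [seq i <- iota 0 m | i \notin p]; rewrite perm_sym.
by apply: perm_filter_notin => // [|i /ltp]; rewrite ?iota_uniq ?mem_iota.
Qed.

Section Sample.
Variables (R : realType) (V : eqType) (x0 : V) (k : nat) (e : pred (seq V)).
Hypothesis eP : edge_pred k e.
Local Open Scope ring_scope.
Local Notation A := (link_density R k e).

Lemma link_ge0 W v : 0 <= A W v.
Proof. by apply: Em_ge0 => *; apply: ler0n. Qed.

Lemma link_le1 W v : (0 < size W)%N -> A W v <= 1.
Proof. by move=> W0; apply: Em_le1 => // *; rewrite lern1 leq_b1. Qed.

Lemma link_nuniq W v : ~~ uniq v -> A W v = 0.
Proof.
move=> nuv; rewrite /link_density (eq_Em (g := fun=> 0)) => [|y _ _].
  by rewrite /Em Sm_cst !mul0r.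
case: (boolP (e _)) => // ev; have [_ /(_ _ ev)] := eP.
by rewrite cat_uniq (negPf nuv).
Qed.

Lemma link_rcons W v : (size v < k)%N ->
  A W v = (\sum_(z <- W) A W (rcons v z)) / (size W)%:R.
Proof.
move=> sv; rewrite /link_density (_ : (k - size v)%N = (k - (size v).+1).+1); last by lia.
rewrite EmS Em1; congr (_ / _); apply: eq_bigr => z _; rewrite size_rcons.
by apply: eq_Em => y _ _; rewrite cat_rcons.
Qed.

Variable W : seq V.
Hypotheses (uW : uniq W) (W0 : (0 < size W)%N).

Definition sel (p : seq nat) (x : seq V) := [seq nth x0 x i | i <- p].

(** The tuple is given by positions in the sample and not by vertices, so that the entries at the
    other positions are independent of it. *)
Definition poor (eta : R) (p : seq nat) (x : seq V) : bool :=
  (\sum_(z <- x) A W (rcons (sel p x) z) < (size x)%:R * (A W (sel p x) - eta))%R.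

(** With the positions of [p] moved to the front, [chernoff] applies with [eta / 2] to the other
    [m - size p] entries. Ignoring the entries at [p] costs at most [size p], which the other half
    of [eta] pays for. *)
Lemma poor_le eta p m : 0 < eta -> eta <= 1 -> uniq p -> {in p, forall i, (i < m)%N} ->
  (size p < k)%N -> (2 * size p)%:R <= m%:R * eta ->
  Em W m (fun x => (poor eta p x)%:R) <= expR (- (eta ^+ 2 / 32 * (m - size p)%:R)).
Proof.
move=> e0 e1 up ltp sp le_m; set j := size p.
have [p' perm_q] := iota_extend up ltp; set q := p ++ p' in perm_q.
have uq : uniq q by rewrite (perm_uniq perm_q) iota_uniq.
have sq : size q = m by rewrite (perm_size perm_q) size_iota.
have ltq : {in q, forall i, (i < m)%N} by move=> i; rewrite (perm_mem perm_q) mem_iota.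
have jm : (j <= m)%N by rewrite -sq size_cat leq_addr.
pose f (y : seq V) : R := (\sum_(z <- drop j y) A W (rcons (take j y) z)
  <= (m - j)%:R * (A W (take j y) - eta / 2))%R%:R.
apply: (@le_trans _ _ (Em W m (fun x => f [seq nth x0 x i | i <- q]))).
  apply: le_Em => x xm _; rewrite ler_nat.
  have tE : take j [seq nth x0 x i | i <- q] = sel p x.
    by rewrite -map_take take_size_cat.
  have sE : \sum_(z <- x) A W (rcons (sel p x) z) =
     \sum_(z <- [seq nth x0 x i | i <- q]) A W (rcons (sel p x) z).
    rewrite -{1}(mkseq_nth x0 x) xm /mkseq !big_map; apply/esym/perm_big.
    exact: perm_q.
  case: (boolP (poor eta p x)) => //; rewrite /poor /f tE xm => poor_x.
  rewrite lt0b; move: poor_x; rewrite sE -[in X in X -> _](cat_take_drop j [seq nth x0 x i | i <- q]).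
  rewrite big_cat tE /=; set S1 := \sum_(z <- sel p x) _; set S2 := \sum_(z <- drop _ _) _.
  have S10 : 0 <= S1 by apply: sumr_ge0 => *; apply: link_ge0.
  have := link_le1 (sel p x) W0; have := link_ge0 W (sel p x).
  move: le_m; rewrite -/j natrB // natrM; set a := A W _; set M := m%:R; set J : R := j%:R.
  have J0 : 0 <= J by apply: ler0n.
  move=> le_m a0 a1 lt_S; nra.
rewrite Em_perm // -[in X in X <= _](subnKC jm) Em_cat.
rewrite -[leRHS](Em_cst j _ W0); apply: le_Em => v sv vW.
rewrite (_ : eta ^+ 2 / 32 = (eta / 2) ^+ 2 / 8); last by field.
apply: le_trans (chernoff (m - j) W0 (F := fun z => A W (rcons v z)) _ (link_rcons _ _) _ _).
- by apply: le_Em => y sy _; rewrite /f -sv take_size_cat // drop_size_cat // sv.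
- by move=> z _; rewrite link_ge0 link_le1.
- by rewrite sv.
- by rewrite divr_gt0.
- lra.
Qed.

(** The tuple is extended one vertex at a time, with a loss of [eta] per vertex. Thus concentration
    is needed for linear sums only, not for a count of [(k - size p)]-tuples. Repeated positions are
    harmless, as their link density is zero. *)
Lemma poor_free eta m x : 0 <= eta -> (0 < m)%N -> size x = m ->
  (forall p, uniq p -> {in p, forall i, (i < m)%N} -> (size p < k)%N -> ~~ poor eta p x) ->
  forall p, {in p, forall i, (i < m)%N} -> (size p <= k)%N ->
    A W (sel p x) - (k - size p)%:R * eta <= A x (sel p x).
Proof.
move=> e0 m0 xm npoor p; move Ds: (k - size p)%N => s.
elim: s p Ds => [|s IH] p Ds ltp sp.
  rewrite mul0r subr0 /link_density size_map Ds !Em0 //.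
have spk : (size p < k)%N by lia.
have [up|nup] := boolP (uniq p); last first.
  rewrite link_nuniq; last by apply: contra nup => /map_uniq.
  by have := link_ge0 x (sel p x); have := mulr_ge0 (ler0n R s.+1) e0; lra.
have := npoor p up ltp spk; rewrite /poor -leNgt xm => le_sum.
have m0R : 0 < m%:R :> R by rewrite ltr0n.
rewrite (link_rcons x); last by rewrite size_map.
rewrite xm ler_pdivlMr // mulrC -natr1.
apply: (@le_trans _ _ (\sum_(z <- x) (A W (rcons (sel p x) z) - s%:R * eta))); last first.
  rewrite big_seq [leRHS]big_seq; apply: ler_sum => z zx.
  have := IH (rcons p (index z x)); rewrite size_rcons /sel map_rcons nth_index //.
  apply; [lia| |lia] => i; rewrite mem_rcons inE => /predU1P[->|/ltp //].
  by rewrite -xm index_mem.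
rewrite sumrB (_ : \sum_(z <- x) s%:R * eta = m%:R * (s%:R * eta)); first by lra.
by rewrite sumr_const_seq xm.
Qed.

End Sample.

Lemma Em_sel (R : realFieldType) (V : eqType) (x0 : V) (W : seq V) m (p : seq nat)
    (f : seq V -> R) : (0 < size W)%N -> uniq p -> {in p, forall i, i < m} ->
  Em W m (fun x => f (sel x0 p x)) = Em W (size p) f.
Proof.
move=> W0 up ltp; have [q pq] := iota_extend up ltp.
have uq : uniq (p ++ q) by rewrite (perm_uniq pq) iota_uniq.
have sq : size (p ++ q) = m by rewrite (perm_size pq) size_iota.
have ltq : {in p ++ q, forall i, i < m} by move=> i; rewrite (perm_mem pq) mem_iota.
have le_pm : size p <= m by rewrite -sq size_cat leq_addr.
have <- := Em_take (size p) (m - size p) f W0; rewrite subnKC //.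
rewrite -[RHS](Em_perm _ x0 _ uq sq ltq); apply: eq_Em => x _ _; congr f.
by rewrite -map_take take_size_cat //.
Qed.

Lemma ord_seq m (p : seq nat) : {in p, forall i, i < m} ->
  exists t : (size p).-tuple 'I_m, map val t = p.
Proof.
elim: p => [|i p IH] ltp; first by exists [tuple].
have [|t tE] := IH; first by move=> j jp; apply: ltp; rewrite inE jp orbT.
by exists [tuple of Ordinal (ltp i (mem_head _ _)) :: t]; rewrite /= tE.
Qed.

Section NiceSample.
Variable R : realType.
Local Open Scope ring_scope.

Definition wmean (V : eqType) (W : seq V) (w : V -> R) : R :=
  (\sum_(z <- W) w z) / (size W)%:R.

(** A union bound over at most [k * m ^ k] position lists against a failure probability
    exponentially small in [m]. Hence the sample size depends on [k] and [eta] alone, not on [W]. *)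
Lemma nice_sample k (eta : R) : 0 < eta -> eta <= 1 ->
  exists m0, forall m, (m0 <= m)%N -> exists N0,
  forall (V : eqType) (x0 : V) e (W : seq V) (w : V -> R), edge_pred k e -> uniq W ->
    (N0 < size W)%N -> {in W, forall x, 0 <= w x <= 1} ->
  exists nice : pred (seq V), 1 / 2 <= Em W m (fun x => (nice x)%:R) :> R /\
    forall x, size x = m -> nice x ->
      [/\ uniq x, \sum_(z <- x) w z <= m%:R * (wmean W w + eta) &
        forall p, uniq p -> {in p, forall i, (i < m)%N} -> (size p < k)%N ->
          ~~ poor x0 k e W eta p x].
Proof.
move=> e0 e1; pose a : R := eta ^+ 2 / 32.
have a0 : 0 < a by rewrite divr_gt0 ?exprn_gt0.
have [|m1 m1P] := @exp_beats_poly R a (1 / (8 * (k%:R + 1) * expR (a * k%:R))) k a0.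
  by rewrite divr_gt0 ?mulr_gt0 ?expR_gt0 ?ltr_wpDl.
have [||m2 m2P] := @exp_beats_poly R (eta ^+ 2 / 8) (1 / 8) 0; rewrite ?divr_gt0 ?exprn_gt0 //.
have [m3 m3P] := nat_above ((2 * k)%:R / eta).
exists (m1 + m2 + m3 + k).+1 => m le_m; exists (4 * (m * m))%N => V x0 e W w eP uW ltN w01.
have W0 : (0 < size W)%N by apply: leq_ltn_trans ltN.
have N0 : 0 < (size W)%:R :> R by rewrite ltr0n.
pose nbad x : R := \sum_(j < k) \sum_(t : j.-tuple 'I_m)
  (uniq t && poor x0 k e W eta (map val t) x)%:R.
(* [chernoff] bounds a lower tail; the upper tail of [w] is the lower tail of [1 - w]. *)
pose heavy x := (\sum_(z <- x) (1 - w z) <= m%:R * ((1 - wmean W w) - eta))%R.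
pose nice x := [&& uniq x, ~~ heavy x & (nbad x < 1)%R].
have nbad0 x : 0 <= nbad x by apply: sumr_ge0 => j _; apply: sumr_ge0 => t _; apply: ler0n.
have E1 : Em W m (fun x => (~~ uniq x)%:R) <= 1 / 4 :> R.
  apply: le_trans (Em_nuniq_le R m uW W0) _; rewrite ler_pdivrMr // mulrAC.
  by rewrite ler_pdivlMr // mulrC -natrM mul1r ler_nat ltnW.
have E2 : Em W m (fun x => (heavy x)%:R) <= 1 / 8 :> R.
  apply: le_trans (chernoff m W0 (F := fun z => 1 - w z) _ _ e0 e1) _.
  - by move=> x /w01; lra.
  - rewrite /wmean sumrB mulrBl; congr (_ - _).
    by rewrite sumr_const_seq mulr1 divff // gt_eqF.
  - by have := m2P m; rewrite expr0 mul1r; apply; lia.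
have E3 : Em W m nbad <= 1 / 8 :> R.
  rewrite /nbad Em_sum.
  have kf : k%:R * m%:R ^+ k * expR (- (a * (m%:R - k%:R))) <= 1 / 8 :> R.
    have := m1P m; rewrite ler_pdivlMr ?mulr_gt0 ?expR_gt0 ?ltr_wpDl // => H.
    rewrite mulrBr opprB expRD (mulrC (expR _)).
    have := mulr_ge0 (mulr_ge0 (exprn_ge0 k (ler0n R m)) (expR_ge0 (- (a * m%:R)))) (expR_ge0 (a * k%:R)).
    have {}H := H (_ : (m1 <= m)%N); set Z := _ * _ * _ => Z0.
    have : 8 * ((k%:R + 1) * Z) <= 1 by apply: le_trans (H _); [rewrite /Z; lra | lia].
    rewrite (_ : k%:R * m%:R ^+ k * _ = k%:R * Z); last by rewrite /Z; ring.
    lra.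
  apply: le_trans _ kf.
  apply: (@le_trans _ _ (\sum_(j < k) (m%:R ^+ k * expR (- (a * (m%:R - k%:R)))))); last first.
    by rewrite sumr_const card_ord -[leLHS]mulr_natl mulrA.
  apply: ler_sum => j _; rewrite Em_sum.
  apply: (@le_trans _ _ (\sum_(t : j.-tuple 'I_m) expR (- (a * (m%:R - k%:R))))); last first.
    rewrite sumr_const card_tuple card_ord -[leLHS]mulr_natl ler_wpM2r ?expR_ge0 // -natrX ler_nat.
    by rewrite leq_pexp2l //; [lia | apply: ltnW].
  apply: ler_sum => t _; case ut: (uniq t); last by rewrite Em_cst ?expR_ge0.
  rewrite /=; have st : size (map val t) = j by rewrite size_map size_tuple.
  apply: le_trans (poor_le x0 e W0 e0 e1 (m := m) (p := map val t) _ _ _ _) _.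
  - by rewrite map_inj_uniq //; apply: val_inj.
  - by move=> _ /mapP[i _ ->]; apply: ltn_ord.
  - by rewrite st.
  - rewrite st; apply: (@le_trans _ _ (2 * k)%:R); first by rewrite ler_nat leq_mul2l ltnW.
    rewrite -ler_pdivrMr //; apply: le_trans m3P _; rewrite ler_nat; lia.
  have jk : (j < k)%N := ltn_ord j.
  rewrite st ler_expR lerN2 ler_pM2l // natrB; last by lia.
  by rewrite lerD2l lerN2 ler_nat ltnW.
exists nice; split.
  have : 1 <= Em W m (fun x => (nice x)%:R + ((~~ uniq x)%:R + ((heavy x)%:R + nbad x))) :> R.
    rewrite -[X in X <= _](Em_cst m _ W0); apply: le_Em => x _ _; rewrite /nice.
    have := nbad0 x; case: (uniq x); case: (heavy x); case: (ltP (nbad x)) => /=; lra.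
  rewrite !EmD; lra.
move=> x xm /and3P[ux hx nx]; split=> //.
  move: hx; rewrite /heavy -ltNge sumrB sumr_const_seq mulr1 xm.
  move=> /ltW; lra.
move=> p up ltp sp; apply/negP => bad.
move: nx; rewrite ltNge => /negP; apply.
have [t tE] := ord_seq ltp.
rewrite /nbad (bigD1 (Ordinal sp)) //= (bigD1 t) //= tE bad andbT.
have -> : uniq t by move: up; rewrite -[p in uniq p]tE => /map_uniq.
rewrite -addrA lerDl addr_ge0 ?sumr_ge0 // => j _; rewrite sumr_ge0 //.
Qed.

End NiceSample.

Lemma ffact_le_expn n s : n ^_ s <= n ^ s.
Proof. by elim: s => // s IH; rewrite ffactnSr expnSr leq_mul ?leq_subr. Qed.

(** * Degrees of sets as densities of tuples *)

Section TuplesVsSets.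
Variables (T : finType) (s : nat).

Lemma card_set_tuples (P : pred {set T}) :
  #|[set t : s.-tuple T | uniq t && P [set:: t]]| = s`! * #|[set A : {set T} | (#|A| == s) && P A]|.
Proof.
pose D := [set t : s.-tuple T | uniq t && P [set:: t]].
rewrite -sum1_card (partition_big (fun t : s.-tuple T => [set:: t])
  (mem [set A : {set T} | (#|A| == s) && P A])) /=; last first.
  move=> t; rewrite !inE => /andP[ut ->]; rewrite andbT cardsE.
  by rewrite (card_uniqP ut) size_tuple.
rewrite -sum1_card big_distrr /=; apply: eq_bigr => A; rewrite inE => /andP[/eqP sA PA].
rewrite muln1 sum1dep_card (_ : s`! = #|A| ^_ s); last by rewrite sA ffactnn.
rewrite -card_uniq_tuples.
apply: eq_card => t; rewrite !inE; case: (boolP (uniq t)) => ut /=; last by rewrite andbF.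
have st : #|[set:: t]| = s by rewrite cardsE (card_uniqP ut) size_tuple.
rewrite andbT; apply/andP/allP => [[_ /eqP <-] x xt|tA].
  by have : x \in [set:: t] by rewrite inE.
have tE : [set:: t] = A.
  by apply/eqP; rewrite eqEcard st sA leqnn andbT; apply/fintype.subsetP => x; rewrite inE => /tA.
by rewrite tE.
Qed.

End TuplesVsSets.

Section EdgePredicates.
Variables (k : nat) (T : finType) (G : kgraph k T).

Definition edge_of (v : seq T) : bool := (size v == k) && ([set:: v] \in edges G).

Lemma edge_ofP : edge_pred k edge_of.
Proof.
split=> [v /andP[/eqP ->] //|v /andP[/eqP sv] /edges_card|u v puv].
  by rewrite cardsE => cv; apply/card_uniqP; rewrite cv.
rewrite /edge_of (perm_size puv) (_ : [set:: u] = [set:: v]) //.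
by apply/setP => x; rewrite !inE (perm_mem puv).
Qed.

Lemma edge_of_enum (A : {set T}) : edge_of (enum A) = (A \in edges G).
Proof.
rewrite /edge_of -cardE set_enum andbC; case: (boolP (A \in edges G)) => //= AG.
by rewrite (edges_card AG) eqxx.
Qed.

Lemma degree_tuples (v : seq T) : uniq v ->
  #|[set t : (k - size v).-tuple T | edge_of (v ++ t)]| = (k - size v)`! * degree G [set:: v].
Proof.
move=> uv; have cv : #|[set:: v]| = size v by rewrite cardsE (card_uniqP uv).
rewrite /degree cv -card_set_tuples; apply: eq_card => t; rewrite !inE.
have -> : [set:: v] :|: [set:: t] = [set:: v ++ t].
  by apply/setP => x; rewrite !inE mem_cat.
have [_ eu _] := edge_ofP; apply/idP/andP => [h|[ut h]].
  split; last by case/andP: h.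
  by have := eu _ h; rewrite cat_uniq => /and3P[].
have ck := edges_card h.
have vk : size v <= k.
  by rewrite -cv -ck subset_leq_card //; apply/fintype.subsetP => y; rewrite !inE mem_cat => ->.
rewrite /edge_of h andbT size_cat size_tuple.
have := card_size (v ++ t); rewrite -cardsE ck size_cat size_tuple; lia.
Qed.

Lemma link_density_degree (R : realFieldType) (v : seq T) : 0 < #|T| -> uniq v ->
  (link_density R k edge_of (enum T) v * #|T|%:R ^+ (k - size v)
    = ((k - size v)`! * degree G [set:: v])%N%:R :> R)%R.
Proof.
move=> T0 uv; rewrite -degree_tuples // /link_density /Em -cardE divfK.
  rewrite Sm_enum -natr_sum -sum1_card; congr (_ %:R)%R; rewrite [RHS]big_mkcond.
  by apply: eq_bigr => t _; rewrite inE; case: edge_of.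
by rewrite expf_neq0 // pnatr_eq0 -lt0n.
Qed.

End EdgePredicates.

(** * The graph induced on a sample *)

Section SampleGraph.
Variables (R : realType) (V : eqType) (x0 : V) (k : nat) (e : pred (seq V)).
Hypothesis eP : edge_pred k e.
Variables (m : nat) (x : seq V).

Definition pick (i : 'I_m) : V := nth x0 x i.

(** The vertices are positions in the sample, so the graph lives on ['I_m], where the tiling
    threshold is defined. *)
Definition sample_edges : {set {set 'I_m}} := [set A : {set 'I_m} | e (map pick (enum A))].

Lemma sample_edges_card : {in sample_edges, forall A : {set 'I_m}, #|A| = k}.
Proof. by case: eP => ek _ _ A; rewrite inE => /ek; rewrite size_map -cardE. Qed.

Definition sample_graph : kgraph k 'I_m := KGraph sample_edges_card.

Lemma sample_edge_of p : e (map pick p) = edge_of sample_graph p.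
Proof.
case: eP => ek eu ep; have [_ eu' _] := edge_ofP sample_graph.
have [up|nup] := boolP (uniq p); last first.
  rewrite [LHS](contraNF _ nup) ?[RHS](contraNF _ nup) //; first exact: eu'.
  by move=> /eu /map_uniq.
have -> : e (map pick p) = e (map pick (enum [set:: p])).
  apply: ep; apply: perm_map; apply: uniq_perm; rewrite ?enum_uniq // => i.
  by rewrite mem_enum inE.
rewrite /edge_of inE andbC; case: (boolP (e _)) => //= /ek.
by rewrite size_map -cardE cardsE (card_uniqP up) => ->; rewrite eqxx.
Qed.

Lemma sample_link p : size x = m ->
  link_density R k e x (map pick p) = link_density R k (edge_of sample_graph) (enum 'I_m) p.
Proof.
move=> xm; have xE : x = map pick (enum 'I_m).
  rewrite -{1}(mkseq_nth x0 x) xm /mkseq -val_enum_ord -map_comp //.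
rewrite /link_density [X in Em X]xE Em_map size_map; apply: eq_Em => y _ _.
by rewrite -map_cat sample_edge_of.
Qed.

End SampleGraph.

Lemma mindegree_ge (R : realType) k d (V : finType) (H : kgraph k V) (t : R) :
  (t <= 'C(#|V|, k - d)%:R -> (forall S : {set V}, #|S| = d -> t <= (degree H S)%:R) ->
  t <= (mindegree d H)%:R)%R.
Proof.
move=> tC tS; rewrite /mindegree; elim/big_ind: _ => // [a b ta tb|S /eqP /tS //].
by rewrite /minn; case: ltnP.
Qed.

Lemma ex_perm_tuple (T : finType) (A : {set T}) : exists p : seq T, uniq p /\ [set:: p] = A.
Proof. by exists (enum A); rewrite enum_uniq set_enum. Qed.

Section SampleTiling.
Variables (R : realType) (V : eqType) (x0 : V) (k l d : nat) (e : pred (seq V)).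
Hypotheses (eP : edge_pred k e) (dk : d <= k).
Local Open Scope ring_scope.
Variables (W : seq V) (m : nat) (x : seq V) (c eta : R).
Hypotheses (uW : uniq W) (W0 : (0 < size W)%N) (m0 : (0 < m)%N) (xm : size x = m) (ux : uniq x)
  (xW : {subset x <= W}) (eta0 : 0 <= eta) (c1 : c <= 1).
Hypothesis not_poor : forall p, uniq p -> {in p, forall i, (i < m)%N} -> (size p < k)%N ->
  ~~ poor x0 k e W eta p x.
Hypothesis deg : forall v, uniq v -> size v = d -> {subset v <= W} ->
  c <= link_density R k e W v.

Lemma sample_mindegree :
  (c - k%:R * eta) * 'C(m, k - d)%:R <= (mindegree d (sample_graph x0 eP m x))%:R.
Proof.
set t := c - _; have t1 : t <= 1 by rewrite /t lerBlDr; apply: le_trans c1 _; rewrite lerDl mulr_ge0.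
apply: mindegree_ge => [|S sS]; first by rewrite card_ord ler_piMl.
have [t0|t0] := ltP t 0.
  by apply: le_trans _ (ler0n _ _); rewrite mulr_le0_ge0 // ltW.
have [p [up pS]] := ex_perm_tuple S.
have sp : size p = d by rewrite -sS -pS cardsE (card_uniqP up).
pose q := map val p : seq nat.
have ltq : {in q, forall i, (i < m)%N} by move=> _ /mapP[i _ ->]; apply: ltn_ord.
have sel_q : sel x0 q x = map (pick x0 x) p by rewrite /sel -map_comp.
have uqn : uniq q by rewrite map_inj_uniq //; apply: val_inj.
have uq : uniq (sel x0 q x).
  rewrite map_inj_in_uniq //.
  by move=> i j /ltq lti /ltq ltj /eqP; rewrite nth_uniq ?xm // => /eqP.
have le_t : t <= link_density R k e x (map (pick x0 x) p).
  have := poor_free eP uW W0 eta0 m0 xm not_poor ltq.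
  rewrite size_map sp dk => /(_ isT); rewrite sel_q; apply: le_trans.
  have := @deg (sel x0 q x); rewrite sel_q size_map sp -sel_q => /(_ uq erefl) H.
  have {}H : c <= link_density R k e W (sel x0 q x).
    apply: H => _ /mapP[i /ltq lti ->]; apply: xW; rewrite mem_nth // xm //.
  apply: le_trans (lerB H (lexx _)); rewrite /t lerD2l lerN2.
  by rewrite ler_wpM2r // ler_nat leq_subr.
have := link_density_degree (sample_graph x0 eP m x) R _ up.
rewrite -sample_link // card_ord sp pS => /(_ m0) linkE.
have f0 : 0 < (k - d)`!%:R :> R by rewrite ltr0n fact_gt0.
rewrite -(ler_pM2r f0) -mulrA -natrM bin_ffact.
rewrite -[leRHS]natrM mulnC -linkE ler_pM //.
(* The density is normalized by the power of [m], which is at least the falling factorial behind the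
   binomial coefficient, so nothing is lost here. *)
rewrite -natrX ler_nat ffact_le_expn //.
Qed.

End SampleTiling.

(** * Light copies in a sample *)

Lemma covered_sum (R : nmodType) (I V : finType) (T : {set {ffun I -> V}}) (E : V -> R) :
  {in T &, forall f g : {ffun I -> V}, f != g -> [disjoint f @: [set: I] & g @: [set: I]]} ->
  (\sum_(j in covered T) E j = \sum_(f in T) \sum_(j in f @: [set: I]) E j)%R.
Proof.
move=> disj.
have -> : covered T = \bigcup_f (if f \in T then f @: [set: I] else finset.set0).
  by rewrite /covered big_mkcond.
rewrite partition_disjoint_bigcup /=.
  by rewrite [RHS]big_mkcond; apply: eq_bigr => f _; case: ifP => // _; rewrite big_set0.
move=> f g fg; case: ifP => fT; last by rewrite -finset.setI_eq0 finset.set0I.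
by case: ifP => gT; [apply: disj | rewrite -finset.setI_eq0 finset.setI0].
Qed.

Definition ords h (q : seq nat) : seq 'I_h := pmap insub q.

Lemma val_ords h q : {in q, forall i, i < h} -> map val (ords h q) = q.
Proof.
move=> ltq; rewrite /ords (pmap_filter (insubK _)); apply/all_filterP/allP => i /ltq lti.
by rewrite /= insubT.
Qed.

Section Pattern.
Variables k l : nat.
Hypothesis l2k : 2 * l < k.
Local Notation h := (k + (k - 2 * l)).

(* The pattern in which an [l]-path runs through a blow-up of [Y_(k,2l)]: with edges [AB] and
   [BC] and [B = B1 B2], it visits [B1 A B2 C B1 A B2 C] and so on. *)
Definition Y_pattern : seq 'I_h :=
  ords h (iota (k - 2 * l) l) ++ ords h (iota 0 (k - 2 * l)) ++
  ords h (iota (k - l) l) ++ ords h (iota k (k - 2 * l)).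

Lemma size_ords q : {in q, forall i, i < h} -> size (ords h q) = size q.
Proof. by move=> /val_ords {2}<-; rewrite size_map. Qed.

Lemma Y_pattern_perm : perm_eq Y_pattern (enum 'I_h).
Proof.
apply: (@perm_map_inj _ _ val val_inj).
rewrite val_enum_ord /Y_pattern !map_cat !val_ords; try by move=> i; rewrite mem_iota; lia.
rewrite perm_catCA (_ : h = (k - 2 * l) + (l + (l + (k - 2 * l)))); last by lia.
rewrite !iotaD !add0n (_ : (k - 2 * l + l = k - l)); last by lia.
by rewrite (_ : (k - l + l = k)) ?perm_refl //; lia.
Qed.

End Pattern.

Section LightCopy.
Variables (R : realType) (V : eqType) (x0 : V) (k l : nat) (e : pred (seq V)).
Hypotheses (l2k : 2 * l < k) (eP : edge_pred k e).
Variables (m : nat) (x : seq V).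
Hypotheses (m0 : 0 < m) (xm : size x = m).
Local Open Scope ring_scope.

Local Notation h := (k + (k - 2 * l))%N.

(** If every copy in the tiling were heavier, the at least [(1 - eps) * m] covered positions would
    outweigh the sample. The slack [2 * eps] suffices: [(1 - eps) * (mu + eta + 2 * eps) >= mu +
    eta] when [mu <= 1] and both [eta] and [eps] are at most [1 / 4]. *)
Lemma light_copy (w : V -> R) (mu eta eps : R) :
  has_almost_tiling (Ygraph k (2 * l)) eps (sample_graph x0 eP m x) ->
  {in x, forall z, 0 <= w z} -> \sum_(z <- x) w z <= m%:R * (mu + eta) ->
  0 <= mu -> mu <= 1 -> 0 <= eta -> eta <= 1 / 4 -> 0 <= eps -> eps <= 1 / 4 ->
  exists f : {ffun 'I_h -> 'I_m}, is_copy (Ygraph k (2 * l)) (sample_graph x0 eP m x) f /\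
    \sum_(i : 'I_h) w (pick x0 x (f i)) <= h%:R * (mu + eta + 2 * eps).
Proof.
move=> [T [[copyT disjT] covT]] w0 le_w mu0 mu1 eta0 eta1 eps0 eps1.
have m0R : 0 < m%:R :> R by rewrite ltr0n.
apply: contrapT => no_light.
have heavy f : f \in T -> h%:R * (mu + eta + 2 * eps) < \sum_(i : 'I_h) w (pick x0 x (f i)).
  move=> fT; rewrite ltNge; apply/negP => light; apply: no_light.
  by exists f; split=> //; apply: copyT.
have image_sum f (E : 'I_m -> R) : f \in T ->
    \sum_(j in f @: [set: 'I_h]) E j = \sum_(i : 'I_h) E (f i).
  move=> fT; have [injf _] := copyT f fT.
  by rewrite big_imset /=; [apply: eq_bigl => i; rewrite inE | move=> i j _ _ /injf].
have card_cov : #|covered T|%:R = #|T|%:R * h%:R :> R.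
  rewrite -sum1_card natr_sum covered_sum // -sum1_card natr_sum mulr_suml.
  apply: eq_bigr => f fT; rewrite image_sum // mul1r sumr_const card_ord //.
have cov_ge : (1 - eps) * m%:R <= #|covered T|%:R.
  have := cardsC (covered T); rewrite card_ord => cC.
  have cCR : #|covered T|%:R + #|~: covered T|%:R = m%:R :> R by rewrite -natrD cC.
  by move: covT; rewrite card_ord; lra.
have sum_le : \sum_(f in T) \sum_(i : 'I_h) w (pick x0 x (f i)) <= m%:R * (mu + eta).
  apply: le_trans le_w.
  have -> : \sum_(f in T) \sum_(i : 'I_h) w (pick x0 x (f i)) =
      \sum_(j in covered T) w (pick x0 x j).
    by rewrite covered_sum //; apply: eq_bigr => f fT; rewrite (image_sum f (fun j => w (pick x0 x j))).
  have -> : \sum_(z <- x) w z = \sum_(j : 'I_m) w (pick x0 x j).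
    by rewrite (big_nth x0) big_mkord xm.
  rewrite big_mkcond; apply: ler_sum => j _; case: ifP => // _.
  by apply: w0; rewrite mem_nth ?xm.
have [f0 f0T] : exists f, f \in T.
  apply/finset.set0Pn; apply/eqP => T0; move: cov_ge; rewrite card_cov T0 cards0 mul0r.
  by apply/negP; rewrite -ltNge mulr_gt0 //; lra.
have : #|T|%:R * (h%:R * (mu + eta + 2 * eps)) < m%:R * (mu + eta).
  apply: lt_le_trans sum_le; rewrite mulr_natl -sumr_const.
  rewrite (bigD1 f0) //= [ltRHS](bigD1 f0) //= ltr_leD ?heavy //.
  by apply: ler_sum => f /andP[fT _]; rewrite ltW ?heavy.
rewrite mulrA -card_cov => lt_cov.
have : (1 - eps) * m%:R * (mu + eta + 2 * eps) < m%:R * (mu + eta).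
  by apply: le_lt_trans lt_cov; rewrite ler_wpM2r //; lra.
rewrite (_ : (1 - eps) * _ * _ = m%:R * ((1 - eps) * (mu + eta + 2 * eps))); last by ring.
rewrite ltr_pM2l //; nra.
Qed.

Lemma Y_pattern_copy (f : {ffun 'I_h -> 'I_m}) :
  is_copy (Ygraph k (2 * l)) (sample_graph x0 eP m x) f ->
  let y := map (pick x0 x) (map f (Y_pattern k l)) in
  e (take k y) && e (drop (k - l) y ++ take l y).
Proof.
move=> [injf edgef] /=.
have edgeE (A : {set 'I_h}) (Q : seq 'I_h) : A \in edges (Ygraph k (2 * l)) ->
    uniq Q -> Q =i A -> e (map (pick x0 x) (map f Q)).
  move=> /edgef fA uQ QA; rewrite (sample_edge_of x0 eP).
  have [_ _ ep] := edge_ofP (sample_graph x0 eP m x).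
  rewrite (ep _ (enum (f @: A))) ?edge_of_enum //.
  apply: uniq_perm; rewrite ?enum_uniq ?map_inj_uniq // => j; rewrite mem_enum.
  by apply/mapP/imsetP => -[i iQ ->]; exists i; rewrite // ?QA // -QA.
have uY : uniq (Y_pattern k l) by rewrite (perm_uniq (Y_pattern_perm l2k)) enum_uniq.
have mem_ords a b i : (a + b <= h)%N -> (i \in ords h (iota a b)) = (a <= i < a + b)%N.
  by move=> _; rewrite /ords mem_pmap_sub mem_iota.
have sz a b : (a + b <= h)%N -> size (ords h (iota a b)) = b.
  by move=> ab; rewrite size_ords ?size_iota // => i; rewrite mem_iota; lia.
have s1 : size (ords h (iota (k - 2 * l) l)) = l by apply: sz; lia.
have s2 : size (ords h (iota 0 (k - 2 * l))) = (k - 2 * l)%N by apply: sz; lia.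
have s3 : size (ords h (iota (k - l) l)) = l by apply: sz; lia.
move: uY; rewrite -!map_take -!map_drop -!map_cat /Y_pattern.
set Q1 := ords h _ in s1 *; set Q2 := ords h _ in s2 *; set Q3 := ords h _ in s3 *.
set Q4 := ords h _ => uY.
have -> : take k (Q1 ++ Q2 ++ Q3 ++ Q4) = Q1 ++ Q2 ++ Q3.
  by rewrite catA catA take_size_cat ?catA // !size_cat s1 s2 s3; lia.
have -> : take l (Q1 ++ Q2 ++ Q3 ++ Q4) = Q1 by rewrite take_size_cat.
have -> : drop (k - l) (Q1 ++ Q2 ++ Q3 ++ Q4) = Q3 ++ Q4.
  by rewrite catA drop_size_cat // size_cat s1 s2; lia.
apply/andP; split.
  apply: (@edgeE (Y_edge1 k (2 * l))); first by rewrite !inE eqxx.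
    by move: uY; rewrite !catA cat_uniq => /andP[].
  by move=> i; rewrite inE !mem_cat !mem_ords; lia.
apply: (@edgeE (Y_edge2 k (2 * l))); first by rewrite !inE eqxx orbT.
  move: uY; rewrite -catA (perm_uniq (_ : perm_eq _ (Q2 ++ (Q3 ++ Q4 ++ Q1)))).
    by rewrite cat_uniq => /and3P[].
  by apply/permP => q; rewrite !count_cat; lia.
by move=> i; have := ltn_ord i; rewrite inE !mem_cat !mem_ords; lia.
Qed.

End LightCopy.

(** * Long light paths *)

Section LongLightPath.
Variables (R : realType) (k l d : nat) (c eta eps : R).
Local Open Scope ring_scope.
Hypotheses (l2k : (2 * l < k)%N) (dk : (d <= k)%N) (c1 : c <= 1).
Hypotheses (eta0 : 0 < eta) (eta1 : eta <= 1 / 4) (eps0 : 0 <= eps) (eps1 : eps <= 1 / 4).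
Hypothesis tiling : exists m1, forall m (H : kgraph k 'I_m), (m1 <= m)%N ->
  (c - k%:R * eta) * 'C(m, k - d)%:R <= (mindegree d H)%:R ->
  has_almost_tiling (Ygraph k (2 * l)) eps H.

Lemma wmean_ge0 (V : eqType) (W : seq V) (w : V -> R) :
  {in W, forall z, 0 <= w z <= 1} -> 0 <= wmean W w <= 1.
Proof.
move=> w01; rewrite /wmean; case: (posnP (size W)) => [s0|W0].
  by rewrite s0 invr0 mulr0 lexx ler01.
rewrite divr_ge0 //=; last by rewrite big_seq sumr_ge0 // => z /w01/andP[].
rewrite ler_pdivrMr ?ltr0n // mul1r -sum1_size natr_sum big_seq [leRHS]big_seq.
by apply: ler_sum => z /w01/andP[].
Qed.

(** Lightness is part of the property [phi] that is blown up, so every transversal inherits it, in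
    particular every row of the path. Only the final [l] vertices do not fill a row; each has weight
    at most one. *)
Lemma long_light_path g : exists N0, forall (V : finType) e (W : seq V) (w : V -> R),
  edge_pred k e -> uniq W -> (N0 < size W)%N ->
  (forall v, uniq v -> size v = d -> {subset v <= W} -> c <= link_density R k e W v) ->
  {in W, forall z, 0 <= w z <= 1} ->
  exists T, [/\ uniq T, {subset T <= W}, lpath k l e (2 * g) T &
    \sum_(z <- T) w z <= (g * (2 * (k - l)))%:R * (wmean W w + eta + 2 * eps) + l%:R].
Proof.
pose h := (k + (k - 2 * l))%N.
have hE : h = (2 * (k - l))%N by rewrite /h; lia.
have eta1' : eta <= 1 by move: eta1; lra.
have [m0 m0P] := nice_sample k eta0 eta1'; have [m1 m1P] := tiling.
pose m := (m0 + m1).+1; have m00 : (0 < m)%N by [].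
have [|N1 N1P] := m0P m; first by rewrite leqW // leq_addr.
(* Half of the samples contain a suitable [h]-tuple, at one of at most [m ^ h] choices of
   positions. *)
pose kappa : R := 1 / (2 * m%:R ^+ h).
have mh0 : 0 < 2 * m%:R ^+ h :> R by rewrite mulr_gt0 ?exprn_gt0 ?ltr0n.
have [|N2 N2P] := @blowup R h kappa g.+1 0; first by rewrite divr_gt0.
exists (N1 + N2)%N => V e W w eP uW ltN deg w01.
have W0 : (0 < size W)%N by apply: leq_ltn_trans ltN.
have [x0 _] : exists x0, x0 \in W by case: (W) W0 => // x W' _; exists x; rewrite mem_head.
have /andP[mu0 mu1] := wmean_ge0 w01.
have [|nice [nice_ge niceP]] := N1P V x0 e W w eP uW _ w01.
  exact: leq_ltn_trans (leq_addr _ _) ltN.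
pose phi y := [&& e (take k y), e (drop (k - l) y ++ take l y)
  & (\sum_(z <- y) w z <= h%:R * (wmean W w + eta + 2 * eps))%R].
have phi_ge : kappa <= Em W h (fun y => (phi y)%:R).
  rewrite /kappa ler_pdivrMr // mulrCA -ler_pdivrMl // mulrC.
  apply: le_trans nice_ge _.
  apply: (@le_trans _ _ (Em W m (fun x => \sum_(t : h.-tuple 'I_m)
      (uniq t && phi (sel x0 (map val t) x))%:R))).
    apply: le_Em => x xm xW; case: (boolP (nice x)) => [nx|_] /=; last by rewrite sumr_ge0.
    have [ux le_w npoor] := niceP x xm nx.
    have H : has_almost_tiling (Ygraph k (2 * l)) eps (sample_graph x0 eP m x).
      apply: m1P; first by rewrite leqW // leq_addl.
      exact: (sample_mindegree eP dk uW W0 m00 xm ux xW (ltW eta0) c1 npoor deg).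
    have wx0 : {in x, forall z, 0 <= w z} by move=> z /xW /w01 /andP[].
    have [f [copyf light]] := light_copy m00 xm H wx0 le_w mu0 mu1 (ltW eta0) eta1 eps0 eps1.
    have Yp := Y_pattern_perm l2k.
    have st : size (map f (Y_pattern k l)) == h.
      by rewrite size_map (perm_size Yp) -cardE card_ord.
    have [injf _] := copyf.
    rewrite (bigD1 (Tuple st)) //= (_ : uniq _ && phi _); first by rewrite lerDl sumr_ge0.
    rewrite map_inj_uniq // (perm_uniq Yp) enum_uniq /phi /=.
    have -> : sel x0 (map val (map f (Y_pattern k l))) x = map (pick x0 x) (map f (Y_pattern k l)).
      by rewrite /sel -map_comp.
    have /andP[-> ->] := Y_pattern_copy l2k m00 xm copyf.
    rewrite /= !big_map; apply: le_trans light.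
    by rewrite (perm_big _ Yp) /= big_enum.
  rewrite Em_sum mulrC.
  apply: (@le_trans _ _ (\sum_(t : h.-tuple 'I_m) Em W h (fun y => (phi y)%:R))); last first.
    by rewrite sumr_const card_tuple card_ord -natrX mulr_natl.
  apply: ler_sum => t _; case ut: (uniq t); last first.
    by rewrite Em_cst // Em_ge0 // => *; apply: ler0n.
  rewrite /= (Em_sel x0 (p := map val t) (fun y => (phi y)%:R)) //; last first.
  - by move=> _ /mapP[i _ ->]; apply: ltn_ord.
  - by rewrite map_inj_uniq //; apply: val_inj.
  by rewrite size_map size_tuple.
have [|Bs [sBs aBs [uBs _] BsW phiBs]] := N2P V W [::] phi uW _ isT phi_ge.
  exact: leq_ltn_trans (leq_addl _ _) ltN.
pose rows := [seq brow x0 Bs j | j <- iota 0 g].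
have allrows : flatten [seq brow x0 Bs j | j <- iota 0 g.+1] = flatten rows ++ brow x0 Bs g.
  by rewrite -addn1 iotaD map_cat flatten_cat /= cats0.
have perm_rows := perm_brows x0 aBs; rewrite allrows in perm_rows.
have rowsW : {subset flatten rows ++ brow x0 Bs g <= W}.
  by move=> z; rewrite (perm_mem perm_rows) => /BsW.
have TW : {subset flatten rows ++ take l (brow x0 Bs g) <= W}.
  move=> z zT; apply: rowsW; move: zT; rewrite !mem_cat => /orP[->//|/mem_take ->].
  by rewrite orbT.
exists (flatten rows ++ take l (brow x0 Bs g)); split=> //.
- have := perm_uniq perm_rows; rewrite uBs -{1}(cat_take_drop l (brow x0 Bs g)) catA.
  by rewrite cat_uniq => /andP[].
- rewrite -{2}[g]add0n; apply: (@brows_lpath _ x0 _ _ _ l2k _ g.+1); rewrite ?sBs //.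
  by move=> y /phiBs /and3P[-> ->].
rewrite big_cat /= lerD //.
  rewrite big_flatten /= big_map natrM -mulrA -hE.
  rewrite (_ : g%:R * _ = \sum_(j <- iota 0 g) (h%:R * (wmean W w + eta + 2 * eps))).
    rewrite big_seq [leRHS]big_seq; apply: ler_sum => j; rewrite mem_iota add0n => /andP[_ ltj].
    have ltj1 : (j < g.+1)%N by apply: ltnW.
    by have /phiBs/and3P[] := brow_transversal x0 aBs ltj1.
  by rewrite sumr_const_seq size_iota.
apply: (@le_trans _ _ (size (take l (brow x0 Bs g)))%:R).
  rewrite -sum1_size natr_sum [leLHS]big_seq [leRHS]big_seq; apply: ler_sum => z zT.
  by have /w01/andP[] : z \in W by apply: TW; rewrite mem_cat zT orbT.
by rewrite ler_nat size_take_min geq_minl.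
Qed.

End LongLightPath.

(** * Removing light paths *)

Section RemoveVertices.
Variables (R : realFieldType) (V : eqType) (k : nat) (e : pred (seq V)).
Hypothesis eP : edge_pred k e.
Local Open Scope ring_scope.
Variables (W T : seq V).
Hypotheses (uW : uniq W) (uT : uniq T) (TW : {subset T <= W}).

Let W' := [seq x <- W | x \notin T].
Let S U s D : R := Sm U s (fun y => (e (D ++ y))%:R).

Lemma size_rem_vertices : (size W' + size T)%N = size W.
Proof. by rewrite (perm_size (perm_filter_notin uW uT TW)) size_cat addnC. Qed.

Lemma sum_rem_vertices (F : V -> R) :
  \sum_(x <- W') F x = \sum_(x <- W) F x - \sum_(x <- T) F x.
Proof. by rewrite (perm_big _ (perm_filter_notin uW uT TW)) big_cat /= addrC addrK. Qed.

(** A union bound over the [s] positions where an entry of [T] may stand; by symmetry of [e], that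
    entry may be moved next to [D]. *)
Lemma Sm_rem_vertices s D :
  S W s D - s%:R * \sum_(u <- T) S W s.-1 (rcons D u) <= S W' s D.
Proof.
have S0 U i D' : 0 <= S U i D' by apply: Sm_ge0 => *; apply: ler0n.
have SS U i D' : S U i.+1 D' = \sum_(x <- U) S U i (rcons D' x).
  rewrite /S /=; apply: eq_bigr => x _; apply: eq_Sm => y _ _.
  by rewrite cat_rcons.
elim: s D => [|s IH] D; first by rewrite mul0r subr0.
rewrite [S W' _ _]SS; apply: (@le_trans _ _ (\sum_(x <- W')
   (S W s (rcons D x) - s%:R * \sum_(u <- T) S W s.-1 (rcons (rcons D x) u)))); last first.
  by apply: ler_sum => x _; apply: IH.
rewrite sumrB sum_rem_vertices -SS -mulr_sumr exchange_big /=.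
suff : s%:R * \sum_(u <- T) \sum_(x <- W') S W s.-1 (rcons (rcons D x) u)
    <= s%:R * \sum_(u <- T) S W s (rcons D u) by rewrite -natr1; lra.
case: s {IH} => [|s]; first by rewrite !mul0r.
rewrite ler_wpM2l //; apply: ler_sum => u _; rewrite SS.
apply: (@le_trans _ _ (\sum_(x <- W) S W s (rcons (rcons D x) u))).
  rewrite /W' big_filter [leRHS](bigID (fun x => x \notin T)) /= lerDl.
  by apply: sumr_ge0 => x _; apply: S0.
apply: ler_sum => x _; apply: le_Sm => y _ _; rewrite ler_nat.
have [_ _ ep] := eP; rewrite (ep _ (rcons (rcons D u) x ++ y)) //.
by rewrite !cat_rcons perm_cat2l (perm_catCA [:: x] [:: u] y) perm_refl.
Qed.

Lemma bernoulli (x : R) s : 0 <= x -> 1 + s%:R * x <= (1 + x) ^+ s.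
Proof.
move=> x0; elim: s => [|s IH]; first by rewrite mul0r addr0.
rewrite exprS -natr1; apply: le_trans (ler_wpM2l _ IH); last lra.
have : 0 <= s%:R * x * x by rewrite !mulr_ge0.
lra.
Qed.

Local Notation A := (link_density R k e).

(** A first-order expansion. [Sm_rem_vertices] bounds the loss in the number of tuples, while the
    smaller normalization raises the density by a factor of at least [1 + s * L / N], by
    [bernoulli]. The quadratic term bounds the product of the two changes. *)
Lemma link_rem_vertices D : (0 < k - size D)%N -> (0 < size W')%N ->
  A W D - ((k - size D)%:R / (size W)%:R * (\sum_(u <- T) (A W (rcons D u) - A W D))
      + (k - size D)%:R ^+ 2 * (size T)%:R ^+ 2 / (size W)%:R ^+ 2) <= A W' D.
Proof.
move=> sD W'0; set s : R := (k - size D)%:R; set N : R := (size W)%:R.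
set L : R := (size T)%:R.
have NE : N = (size W')%:R + L by rewrite -natrD size_rem_vertices.
have N'0 : 0 < (size W')%:R :> R by rewrite ltr0n.
have L0 : 0 <= L by apply: ler0n.
have N0 : 0 < N by rewrite NE; lra.
have W0 : (0 < size W)%N by rewrite -(ltr0n R).
have A0 U v : 0 <= A U v by apply: Em_ge0 => *; apply: ler0n.
have A1 v : A W v <= 1 by apply: Em_le1 => // *; rewrite lern1 leq_b1.
set p := \sum_(u <- T) A W (rcons D u).
have p0 : 0 <= p by apply: sumr_ge0 => *; apply: A0.
have pL : p <= L.
  rewrite /L -sum1_size natr_sum; apply: ler_sum => u _; exact: A1.
pose i := (k - size D).-1; have iE : (k - size D)%N = i.+1 by rewrite prednK.
have AE U v : size v = size D -> (0 < size U)%N -> A U v * (size U)%:R ^+ i.+1 = S U i.+1 v.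
  by move=> sv U0; rewrite /link_density sv iE divfK // expf_neq0 // pnatr_eq0 -lt0n.
have pE : p * N ^+ i = \sum_(u <- T) S W i (rcons D u).
  rewrite mulr_suml; apply: eq_bigr => u _; rewrite /link_density size_rcons.
  rewrite (_ : (k - (size D).+1)%N = i); last by rewrite /i subnS.
  by rewrite divfK // expf_neq0 // gt_eqF.
pose X := A W D - s / N * p.
have main : X * N ^+ i.+1 <= A W' D * (size W')%:R ^+ i.+1.
  rewrite !AE //; apply: le_trans (Sm_rem_vertices i.+1 D); rewrite /X mulrBl AE // lerD2l lerN2.
  by rewrite /= -pE /s iE exprS; rewrite le_eqVlt; apply/orP; left; apply/eqP; field; rewrite gt_eqF.
have X_le : X * (1 + s * (L / N)) <= A W' D.
  have [X0|/ltW X0] := leP 0 X; last first.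
    apply: le_trans (A0 _ _); rewrite mulr_le0_ge0 //.
    by rewrite addr_ge0 // mulr_ge0 // divr_ge0 // ltW.
  rewrite -(ler_pM2r (exprn_gt0 i.+1 N'0)); apply: le_trans main.
  rewrite -mulrA ler_wpM2l // (_ : s = i.+1%:R); last by rewrite /s iE.
  apply: le_trans (ler_wpM2r (exprn_ge0 _ (ltW N'0)) (@bernoulli (L / N) i.+1 _)) _.
    by rewrite divr_ge0 // ltW.
  have h1 : 0 <= (1 + L / N) * (size W')%:R.
    by rewrite mulr_ge0 // addr_ge0 // divr_ge0 // ltW.
  rewrite -exprMn lerXn2r ?nnegrE ?h1 ?(ltW N0) //.
  rewrite mulrDl mul1r mulrAC -lerBrDl ler_pdivrMr // NE; nra.
apply: le_trans X_le; rewrite /X sumrB sumr_const_seq.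
rewrite -/p.
have h : s / N * p * (s * (L / N)) <= s ^+ 2 * L ^+ 2 / N ^+ 2.
  rewrite (_ : s ^+ 2 * L ^+ 2 / N ^+ 2 = s / N * L * (s * (L / N))); last by field; rewrite gt_eqF.
  by rewrite ler_wpM2r ?ler_wpM2l ?mulr_ge0 ?invr_ge0 ?ler0n // ltW.
rewrite [leRHS](_ : _ = A W D - s / N * (p - L * A W D) - s / N * p * (s * (L / N))); last by ring.
lra.
Qed.

End RemoveVertices.

Lemma Sm_ge_term (R : realFieldType) (V : eqType) (W : seq V) m (f : seq V -> R) s :
  (forall s, 0 <= f s)%R -> size s = m -> {subset s <= W} -> (f s <= Sm W m f)%R.
Proof.
move=> f0; elim: m f f0 s => [|m IH] f f0 [|x s] //= [sm] sW.
have xW : x \in W by apply: sW; rewrite mem_head.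
rewrite (big_rem x) //= ler_wpDr //.
  by apply: sumr_ge0 => y _; apply: Sm_ge0.
by apply: (IH (fun s => f (x :: s))) => // y ys; apply: sW; rewrite inE ys orbT.
Qed.

(** * The exponential potential *)

Section Potential.
Variables (R : realType) (V : eqType) (k d : nat) (e : pred (seq V)).
Hypotheses (eP : edge_pred k e) (dk : d < k).
Local Open Scope ring_scope.
Local Notation A := (link_density R k e).

(** The index set [W0] stays fixed while [W] shrinks, so a [D] that meets removed vertices keeps its
    term and successive potentials can be compared term by term. *)
Definition potential (lam : R) (W0 W : seq V) : R :=
  Sm W0 d (fun D => (uniq D)%:R * expR (- (lam * A W D))).

(* The derivative of the potential in the direction of the vertex [u], normalized. *)
Definition pull (lam : R) (W0 W : seq V) (u : V) : R :=
  Sm W0 d (fun D => (uniq D)%:R * expR (- (lam * A W D)) * A W (rcons D u))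
    / potential lam W0 W.

Lemma potential_gt0 lam W0 W : uniq W0 -> (d <= size W0)%N -> 0 < potential lam W0 W.
Proof.
move=> uW0 dW0; have ud : uniq (take d W0) by rewrite take_uniq.
have := @Sm_ge_term R V W0 d (fun D => (uniq D)%:R * expR (- (lam * A W D))) (take d W0).
rewrite size_takel // ud mul1r => H; apply: lt_le_trans (H _ erefl _).
- exact: expR_gt0.
- by move=> s; rewrite mulr_ge0 ?expR_ge0.
- by move=> x /mem_take.
Qed.

Lemma pull01 lam W0 W u : (0 < size W)%N -> uniq W0 -> (d <= size W0)%N ->
  0 <= pull lam W0 W u <= 1.
Proof.
move=> sW uW0 dW0; have P0 := potential_gt0 lam W uW0 dW0.
have f0 D : 0 <= (uniq D)%:R * expR (- (lam * A W D)) by rewrite mulr_ge0 ?expR_ge0.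
rewrite divr_ge0 ?(ltW P0) //=; last first.
  by apply: Sm_ge0 => D _ _; rewrite mulr_ge0 ?link_ge0.
rewrite ler_pdivrMr // mul1r; apply: le_Sm => D _ _.
by rewrite ler_piMr // link_le1.
Qed.

(** By [link_rcons], the mean of [pull] over [W] is the mean of [A W D] over all [D], weighted by
    their terms in the potential. The weighted sum of the linear terms of [link_rem_vertices] is
    therefore governed by the excess of [T] over the average pull, and lightness bounds it by
    [size T * delta]. *)
Lemma potential_step lam (W0 W T : seq V) (delta : R) :
  uniq W0 -> (d <= size W0)%N -> uniq W -> uniq T -> {subset T <= W} ->
  (size T < size W)%N -> 0 <= lam ->
  let s : R := (k - d)%:R in let q : R := s * (size T)%:R / (size W)%:R in
  q <= 1 -> lam * q <= 1 / 4 ->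
  \sum_(u <- T) pull lam W0 W u <= (size T)%:R * (wmean W (pull lam W0 W) + delta) ->
  potential lam W0 [seq x <- W | x \notin T] <=
    potential lam W0 W * (1 + lam * (q * delta + q ^+ 2) + 8 * (lam * q) ^+ 2).
Proof.
move=> uW0 dW0 uW uT TW sTW lam0 s q q1 lamq le_T.
have P0 := potential_gt0 lam W uW0 dW0; set P := potential lam W0 W in le_T P0 *.
set W' := [seq _ <- _ | _]; set L : R := (size T)%:R in q q1 lamq le_T *.
set N : R := (size W)%:R in q q1 lamq *.
have W'0 : (0 < size W')%N by have := size_rem_vertices uW uT TW; rewrite -/W'; lia.
have N0 : 0 < N by rewrite ltr0n; apply: leq_ltn_trans sTW.
have sW : (0 < size W)%N by apply: leq_ltn_trans sTW.
have s0 : 0 <= s by apply: ler0n.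
have L0 : 0 <= L by apply: ler0n.
have q0 : 0 <= q by rewrite divr_ge0 ?mulr_ge0 // ltW.
pose f D : R := (uniq D)%:R * expR (- (lam * A W D)).
have f0 D : 0 <= f D by rewrite mulr_ge0 ?expR_ge0.
pose S D : R := \sum_(u <- T) (A W (rcons D u) - A W D).
have sumT (a : R) : \sum_(u <- T) a = L * a by rewrite sumr_const_seq.
have S_abs D : - L <= S D <= L.
  have h u : -1 <= A W (rcons D u) - A W D <= 1.
    have := link_ge0 R k e W (rcons D u); have := link_le1 R k e (rcons D u) sW.
    have := link_ge0 R k e W D; have := link_le1 R k e D sW; lra.
  rewrite -[L]mulr1 -mulrN -!sumT; apply/andP.
  by split; apply: ler_sum => u _; case/andP: (h u).
have term D : size D = d -> (uniq D)%:R * expR (- (lam * A W' D))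
    <= f D * (1 + lam * (s / N * S D + q ^+ 2) + 8 * (lam * q) ^+ 2).
  move=> sD; rewrite /f -mulrA ler_wpM2l //.
  pose del := s / N * S D + q ^+ 2.
  (* With [del] at most [2 * q] in absolute value, the quadratic term of [expR_le_quadratic] becomes
     [8 * (lam * q) ^+ 2]. *)
  have del_le : - (2 * q) <= del <= 2 * q.
    have /andP[S1 S2] := S_abs D; have sN : 0 <= s / N by rewrite divr_ge0 // ltW.
    have h1 := ler_wpM2l sN S1; have h2 := ler_wpM2l sN S2.
    have qE : s / N * L = q by rewrite /q mulrAC.
    have q2 : 0 <= q ^+ 2 <= q by rewrite sqr_ge0 expr2 ler_piMl.
    by rewrite mulrN qE in h1; rewrite qE in h2; rewrite /del; lra.
  apply: (@le_trans _ _ (expR (- (lam * A W D)) * expR (lam * del))).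
    rewrite -expRD ler_expR.
    have := link_rem_vertices R eP uW uT TW (D := D); rewrite sD subn_gt0 dk W'0 => /(_ isT isT).
    rewrite -/s -/N -/L -/W' -/(S D) (_ : s ^+ 2 * L ^+ 2 / N ^+ 2 = q ^+ 2); last first.
      by rewrite /q !exprMn exprVn.
    rewrite -/del => h; have := ler_wpM2l lam0 h; lra.
  rewrite ler_wpM2l ?expR_ge0 //.
  apply: le_trans (expR_le_quadratic _) _.
    have /andP[_ h] := del_le; have := ler_wpM2l lam0 h; lra.
  rewrite -/del lerD2l exprMn [(lam * q) ^+ 2]exprMn.
  rewrite (_ : 8 * (lam ^+ 2 * q ^+ 2) = 2 * (lam ^+ 2 * (4 * q ^+ 2))); last by ring.
  rewrite ler_pM2l // ler_wpM2l ?sqr_ge0 //.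
  have := mulr_ge0 (_ : 0 <= 2 * q - del) (_ : 0 <= 2 * q + del).
  move=> H; have {}H := H _ _; have : 0 <= (2 * q - del) * (2 * q + del) by apply: H; lra.
  lra.
apply: (@le_trans _ _ (Sm W0 d (fun D =>
    f D * (1 + lam * q ^+ 2 + 8 * (lam * q) ^+ 2) + lam * (s / N) * (f D * S D)))).
  apply: le_Sm => D sD _; apply: le_trans (term D sD) _.
  by rewrite le_eqVlt; apply/orP; left; apply/eqP; ring.
rewrite SmD SmZ; under eq_Sm do rewrite mulrC; rewrite SmZ mulrC -/(potential lam W0 W) -/P.
have fS : Sm W0 d (fun D => f D * S D) <= P * (L * delta).
  pose num u := Sm W0 d (fun D => f D * A W (rcons D u)).
  have numE u : num u = P * pull lam W0 W u by rewrite /pull mulrCA divff ?mulr1 // gt_eqF.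
  have E1 : Sm W0 d (fun D => f D * A W D) = P * wmean W (pull lam W0 W).
    rewrite /wmean mulrA mulr_sumr; under [in RHS]eq_bigr do rewrite -numE.
    rewrite /num -Sm_sum mulrC -SmZ; apply: eq_Sm => D sD _.
    rewrite [A W D]link_rcons ?sD // -mulr_sumr; ring.
  have -> : Sm W0 d (fun D => f D * S D)
      = \sum_(u <- T) num u - L * Sm W0 d (fun D => f D * A W D).
    rewrite /num -Sm_sum -SmZ -[X in _ + X]mulN1r -SmZ -SmD; apply: eq_Sm => D _ _.
    by rewrite /S sumrB sumT mulrBr mulr_sumr; ring.
  rewrite E1; under eq_bigr do rewrite numE.
  rewrite -mulr_sumr; have := ler_wpM2l (ltW P0) le_T; lra.
have lsN : 0 <= lam * (s / N) by rewrite mulr_ge0 // divr_ge0 // ltW.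
have := ler_wpM2l lsN fS.
rewrite (_ : lam * (s / N) * (P * (L * delta)) = P * (lam * (q * delta))); last first.
  by rewrite /q; ring.
move=> h; apply: le_trans (lerD (lexx _) h) _.
by rewrite le_eqVlt; apply/orP; left; apply/eqP; ring.
Qed.

End Potential.

(** * Covering almost all vertices by long paths *)

Section PathCover.

(** Initially the potential is at most [n ^ d * expR (- lam * (c + gap))]. At most [n / L] paths
    fit, and together they use three quarters of the slack [lam * gap]; the last quarter beats
    [n ^ d] because [lam] is linear in [n]. So the potential stays below [expR (- lam * c)]. Every
    single term then does as well, which says that all link densities remain at least [c] and
    another light path exists. *)
Lemma path_cover (R : realType) k l d g (c gap epsW eta eps : R) :
  0 < g -> 2 * l < k -> d < k ->
  (0 < gap -> 0 < epsW -> c <= 1 ->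
  0 < eta -> eta <= 1 / 4 -> 0 <= eps -> eps <= 1 / 4 ->
  (exists m1, forall m (H : kgraph k 'I_m), (m1 <= m)%N ->
    (c - k%:R * eta) * 'C(m, k - d)%:R <= (mindegree d H)%:R ->
    has_almost_tiling (Ygraph k (2 * l)) eps H) ->
  (k - d)%:R * (eta + 2 * eps) <= epsW * gap / 8 ->
  (k - d)%:R * l%:R <= (2 * g * (k - l) + l)%:R * (epsW * gap / 8) ->
  exists N0, forall (V : finType) e (W0 : seq V),
    edge_pred k e -> uniq W0 -> (N0 <= size W0)%N ->
    (forall D, uniq D -> size D = d -> {subset D <= W0} ->
      c + gap <= link_density R k e W0 D) ->
  exists Ts : seq (seq V), [/\ {in Ts, forall T, lpath k l e (2 * g) T}, uniq (flatten Ts),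
    {subset flatten Ts <= W0} &
    (size W0)%:R <= (size (flatten Ts))%:R + epsW * (size W0)%:R])%R.
Proof.
move=> g0 l2k dk gap0 eW0 c1 eta0 eta1 eps0 eps1 tiling cond1 cond2.
pose Ln := 2 * g * (k - l) + l; pose L : R := (Ln%:R)%R; pose s : R := ((k - d)%:R)%R.
have Ln0 : 0 < Ln by rewrite addn_gt0 !muln_gt0 g0 subn_gt0 (leq_ltn_trans _ l2k) // leq_pmull.
have L0 : (0 < L)%R by rewrite ltr0n.
have s0 : (0 < s)%R by rewrite ltr0n subn_gt0.
(* An upper bound for [n * q]: while the process runs, more than [epsW * n] vertices remain. *)
pose Q : R := (s * L / epsW)%R.
have Q0 : (0 < Q)%R by rewrite divr_gt0 ?mulr_gt0.
(* Small enough for both [beta * Q <= 1 / 4], as [potential_step] requires, and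
   [8 * (beta * Q ^+ 2) <= L * gap / 4], for the quadratic error. *)
pose beta : R := (1 / (4 * Q + 32 * Q ^+ 2 / (L * gap)))%R.
have LG0 : (0 < L * gap)%R by rewrite mulr_gt0.
have den0 : (0 < 4 * Q + 32 * Q ^+ 2 / (L * gap))%R.
  by rewrite addr_gt0 // !(mulr_gt0, invr_gt0, exprn_gt0) //.
have beta0 : (0 < beta)%R by rewrite divr_gt0.
have betaE : (beta * (4 * Q) + beta * (32 * Q ^+ 2 / (L * gap)) = 1)%R.
  by rewrite -mulrDr /beta mul1r mulVf // gt_eqF.
clearbody beta.
have beta1 : (beta * Q <= 1 / 4)%R.
  have : (0 <= beta * (32 * Q ^+ 2 / (L * gap)))%R.
    by apply: ltW; rewrite !(mulr_gt0, invr_gt0, exprn_gt0) //.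
  move: betaE; lra.
have beta2 : (8 * (beta * Q ^+ 2) <= L * gap / 4)%R.
  have h : (beta * (32 * Q ^+ 2 / (L * gap)) <= 1)%R.
    have : (0 <= beta * (4 * Q))%R by apply/ltW/(mulr_gt0 beta0)/mulr_gt0.
    move: betaE; lra.
  move: h; rewrite !mulrA ler_pdivrMr // mul1r; lra.
pose a : R := (beta * gap / 4)%R.
have a0 : (0 < a)%R by rewrite divr_gt0 ?mulr_gt0.
have [m0 m0P] := @exp_beats_poly R a 1%R d a0 ltr01.
have [N1 N1P] := long_light_path l2k (ltnW dk) c1 eta0 eta1 eps0 eps1 tiling g.
have [N2 N2P] := nat_above (N1.+1%:R / epsW)%R.
have [N3 N3P] := nat_above (Ln.+1%:R / epsW)%R.
have [N4 N4P] := nat_above (4 * Q ^+ 2 / (L * gap))%R.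
have [N5 N5P] := nat_above Q.
exists (m0 + N2 + N3 + N4 + N5 + d + 1)%N => V e W0 eP uW0 ltN deg.
set n := size W0 in ltN *.
have nE i : i <= m0 + N2 + N3 + N4 + N5 + d + 1 -> (i%:R <= n%:R :> R)%R.
  by move=> hi; rewrite ler_nat (leq_trans hi ltN).
have n0 : (0 < n%:R :> R)%R by rewrite ltr0n (leq_trans _ ltN) // addn1.
have dn : d <= n by apply: leq_trans ltN; rewrite addn1 leqW // leq_addl.
Local Open Scope ring_scope.
pose lam := beta * n%:R; have lam0 : 0 < lam by rewrite mulr_gt0.
(* Each of the three error terms of a step, bounded in [h1], [h2] and [h3], is at most a quarter of
   [beta * gap * L]. *)
pose b0 := beta * (3 / 4 * (gap * L)).
pose rest Ts := [seq x <- W0 | x \notin flatten Ts].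
pose good (Ts : seq (seq V)) := [/\ {in Ts, forall T, lpath k l e (2 * g) T},
  uniq (flatten Ts) & {subset flatten Ts <= W0}].
have sgood Ts : good Ts -> size (flatten Ts) = (Ln * size Ts)%N.
  case=> lp _ _; elim: Ts lp => [|T Ts IH] lp /=; first by rewrite muln0.
  rewrite size_cat IH => [|T' T'Ts]; last by apply: lp; rewrite inE T'Ts orbT.
  by rewrite (lpath_size l2k eP (lp T (mem_head _ _))) mulnS.
have srest Ts : good Ts -> (size (rest Ts) + size (flatten Ts))%N = n.
  by case=> _ uTs TsW; apply: size_rem_vertices.
suff [Ts [gTs le_rest]] : exists Ts, good Ts /\ (size (rest Ts))%:R <= epsW * n%:R.
  exists Ts; case: (gTs) => lp uTs TsW; split=> //.
  by rewrite -/n -{1}(srest Ts gTs) natrD addrC lerD2l.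
(* If the process never stopped, it would produce [n.+1] disjoint nonempty paths. *)
apply: contrapT => not_done.
have big Ts : good Ts -> epsW * n%:R < (size (rest Ts))%:R.
  by move=> gTs; rewrite ltNge; apply/negP => h; apply: not_done; exists Ts.
have iter i : exists Ts, [/\ size Ts = i, good Ts &
    potential k d e lam W0 (rest Ts) <=
      n%:R ^+ d * expR (- (lam * (c + gap))) * expR (i%:R * b0)].
  elim: i => [|i [Ts [sTs gTs pot]]].
    exists [::]; split=> //; rewrite mul0r expR0 mulr1 /rest /= (all_filterP _); last first.
      by apply/allP.
    rewrite [leRHS]mulrC -[leRHS]Sm_cst /potential; apply: le_Sm => D sD DW.
    case: (boolP (uniq D)) => uD; last by rewrite mul0r expR_ge0.
    by rewrite mul1r ler_expR lerN2 ler_pM2l // deg.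
  set W := rest Ts in pot.
  have uW : uniq W by rewrite filter_uniq.
  have WW0 : {subset W <= W0} by move=> x; rewrite mem_filter => /andP[].
  have lt_big := big Ts gTs; rewrite -/W in lt_big.
  have iL : i%:R * L <= n%:R.
    by rewrite -natrM ler_nat -(srest Ts gTs) sgood // sTs mulnC leq_addl.
  have degW D : uniq D -> size D = d -> {subset D <= W} -> c <= link_density R k e W D.
    move=> uD sD DW; rewrite -(ler_pM2l lam0) -lerN2 -ler_expR.
    have term := @Sm_ge_term R V W0 d (fun D => (uniq D)%:R * expR (- (lam * link_density R k e W D))) D.
    apply: le_trans _ (le_trans (le_trans (term _ sD _) pot) _); first by rewrite uD mul1r.
    - by move=> ?; rewrite mulr_ge0 ?expR_ge0.
    - by move=> x /DW /WW0.
    have h := m0P n (_ : (m0 <= n)%N).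
    rewrite -mulrA -expRD (_ : - (lam * (c + gap)) + i%:R * b0 =
        - (lam * c) + (- (a * n%:R) - beta * (3 / 4 * gap) * (n%:R - i%:R * L))); last first.
      by rewrite /a /b0 /lam; field.
    rewrite expRD mulrCA ler_piMr ?expR_ge0 //.
    apply: le_trans (h _); last by apply: leq_trans ltN; clear; lia.
    rewrite ler_wpM2l ?exprn_ge0 // ler_expR gerBl.
    by rewrite mulr_ge0 ?subr_ge0 // mulr_ge0 ?(ltW beta0) // mulr_ge0 ?(ltW gap0).
  have N1W : (N1 < size W)%N.
    rewrite -(ler_nat R); apply: ltW; apply: le_lt_trans lt_big.
    by rewrite mulrC -ler_pdivrMr //; apply: le_trans N2P _; apply: nE; clear; lia.
  have LW : (Ln < size W)%N.
    rewrite -(ler_nat R); apply: ltW; apply: le_lt_trans lt_big.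
    by rewrite mulrC -ler_pdivrMr //; apply: le_trans N3P _; apply: nE; clear; lia.
  have W0' : (0 < size W)%N by apply: leq_ltn_trans LW.
  have N0 : 0 < (size W)%:R :> R by rewrite ltr0n.
  have [|T [uT TW lpT le_T]] := N1P V e W (pull k d e lam W0 W) eP uW N1W degW.
    by move=> u _; apply: pull01.
  have sT : size T = Ln by rewrite (lpath_size l2k eP lpT).
  have gT : good (T :: Ts).
    case: gTs => lp uTs TsW; split=> /=.
    - by move=> T'; rewrite inE => /predU1P[->|/lp].
    - rewrite cat_uniq uT uTs andbT; apply/hasPn => x xTs /=.
      by apply/negP => /TW; rewrite mem_filter xTs.
    - by move=> x; rewrite mem_cat => /orP[/TW/WW0|/TsW].
  exists (T :: Ts); split=> //=; first by rewrite sTs.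
  have -> : rest (T :: Ts) = [seq x <- W | x \notin T].
    rewrite /W /rest -filter_predI; apply: eq_filter => x /=.
    by rewrite mem_cat negb_or.
  pose q := s * (size T)%:R / (size W)%:R.
  have q_le : q <= Q / n%:R.
    rewrite /q sT /Q -[leRHS]mulrA -invfM -/L ler_wpM2l ?mulr_ge0 ?(ltW s0) ?(ltW L0) //.
    by rewrite lef_pV2 ?posrE ?mulr_gt0 // ltW.
  have q0 : 0 <= q by rewrite divr_ge0 // mulr_ge0 // ltW.
  have lq : lam * q <= beta * Q.
    apply: le_trans (ler_wpM2l (ltW lam0) q_le) _.
    by rewrite /lam -mulrA (mulrC Q) mulVKf // gt_eqF.
  (* The last summand spreads the uncontrolled weight of the final [l] vertices over the whole
     path. *)
  pose delta := eta + 2 * eps + l%:R / L.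
  have del0 : 0 <= delta.
    apply: addr_ge0; last by apply: divr_ge0 => //; apply: ltW.
    by apply: addr_ge0; [apply: ltW | apply: mulr_ge0].
  have step := potential_step (lam := lam) (delta := delta) eP dk uW0 dn uW uT TW.
  apply: le_trans (step _ _ _ _ _) _.
  - by rewrite sT.
  - exact: ltW.
  - rewrite -/s -/q; apply: le_trans q_le _; rewrite ler_pdivrMr // mul1r.
    by apply: le_trans N5P _; apply: nE; clear; lia.
  - by rewrite -/s -/q; apply: le_trans lq beta1.
  - apply: le_trans le_T _; rewrite sT /delta -/L.
    have mu01 := wmean_ge0 (W := W) (w := pull k d e lam W0 W) (fun u _ => pull01 k e lam u W0' uW0 dn).
    rewrite (_ : L * (wmean W (pull k d e lam W0 W) + _) =
      L * (wmean W (pull k d e lam W0 W) + eta + 2 * eps) + l%:R); last by field; rewrite gt_eqF.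
    rewrite lerD2r ler_wpM2r //.
      apply: addr_ge0; last exact: mulr_ge0.
      by apply: addr_ge0; [case/andP: mu01 | apply: ltW].
    by rewrite ler_nat /Ln mulnA (mulnC g 2%N) leq_addr.
  rewrite -/s -/q -[i.+1%:R]natr1 [(_ + 1) * b0]mulrDl [1 * b0]mul1r expRD mulrA.
  apply: le_trans (ler_pM _ _ pot (_ : _ <= expR b0)) _ => //.
  - exact/ltW/potential_gt0.
  - apply: addr_ge0; last by apply: mulr_ge0 => //; apply: sqr_ge0.
    apply: addr_ge0 => //; apply: mulr_ge0; first exact: ltW.
    by apply: addr_ge0; [apply: mulr_ge0 | apply: sqr_ge0].
  apply: le_trans _ (expR_ge1Dx b0); rewrite -addrA lerD2l.
  have h1 : lam * q * delta <= beta * (L * gap / 4).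
    apply: le_trans (ler_wpM2r del0 lq) _; rewrite -[leLHS]mulrA (ler_pM2l beta0) /Q /delta.
    rewrite mulrAC ler_pdivrMr //.
    rewrite (_ : s * L * _ = L * (s * (eta + 2 * eps)) + s * l%:R); last by field; rewrite gt_eqF.
    have h4 := ler_wpM2l (ltW L0) cond1; rewrite -/s -/Ln -/L in h4 cond2 *.
    by move: h4 cond2; rewrite -/s -/Ln -/L; lra.
  have h2 : lam * q * q <= beta * (L * gap / 4).
    apply: (@le_trans _ _ (beta * Q * (Q / n%:R))).
      by rewrite ler_pM // mulr_ge0 // ltW.
    rewrite -mulrA ler_pM2l // mulrA -expr2 ler_pdivrMr //.
    have N4n : N4%:R <= n%:R :> R by apply: nE; clear; lia.
    have h5 := ler_wpM2r (ltW LG0) N4n.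
    by move: N4P; rewrite ler_pdivrMr // => h4; lra.
  have h3 : 8 * (lam * q) ^+ 2 <= beta * (L * gap / 4).
    apply: (@le_trans _ _ (8 * (beta * Q) ^+ 2)).
      rewrite ler_pM2l // lerXn2r ?nnegrE //; first exact: (mulr_ge0 (ltW lam0) q0).
      exact: ltW (mulr_gt0 beta0 Q0).
    rewrite (_ : 8 * (beta * Q) ^+ 2 = beta * (8 * (beta * Q ^+ 2))); last by ring.
    by rewrite ler_pM2l.
  rewrite /b0; lra.
have [Ts [sTs gTs _]] := iter n.+1.
have := srest Ts gTs; rewrite sgood // sTs mulnS => le_n.
have : (n.+1 <= Ln * n.+1)%N by rewrite leq_pmull.
by rewrite mulnS => /leq_trans/(_ (leq_addl (size (rest Ts)) _)); rewrite le_n ltnn.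
Qed.

End PathCover.

(** * Assembling a cycle *)

#[local] Arguments lpath : simpl never.

Section Assembly.
Variables (V : eqType) (k l : nat) (e : pred (seq V)).
Hypotheses (l2k : 2 * l < k) (eP : edge_pred k e).
Local Notation r := (k - l).
Local Notation spans := (spans k l e).
Implicit Types (es : seq (seq V * seq V)) (us v : seq V).

Lemma spans_flatten (I : eqType) (ts : seq I) (E : I -> seq (seq V * seq V)) (F : I -> seq V) :
  {in ts, forall t, spans (E t) (F t)} ->
  spans (flatten (map E ts)) (flatten (map F ts)).
Proof.
elim: ts => [|t ts IH] sp /=; first exact: spans_nil.
apply: spans_cat; first by apply: sp; rewrite mem_head.
by apply: IH => u uts; apply: sp; rewrite inE uts orbT.
Qed.

Lemma spans_ends es us p : spans es us -> uniq us -> p \in es ->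
  [/\ uniq p.1, size p.1 = l, uniq p.2 & size p.2 = l].
Proof.
move=> [vs [<- lp pvs]] uus /mapP[v vvs ->] /=.
have [q lpv] := lp v vvs; have sv := lpath_size l2k eP lpv.
have uv : uniq v.
  move: uus; rewrite -(perm_uniq pvs) => uvs.
  have /perm_flatten/perm_uniq := perm_to_rem vvs; rewrite uvs /=.
  by move/esym; rewrite cat_uniq => /andP[].
have lv : l <= size v by rewrite sv leq_addl.
by split; rewrite ?take_uniq ?drop_uniq ?size_takel ?size_drop ?subKn.
Qed.

Lemma spans_size es us : spans es us -> exists q, size us = q * r + l * size es.
Proof.
move=> [vs [<- lp /perm_size <-]]; elim: vs lp => [|v vs IH] lp.
  by exists 0; rewrite /= muln0.
have [|q qE] := IH; first by move=> u uvs; apply: lp; rewrite inE uvs orbT.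
have [q' /(lpath_size l2k eP) sv] := lp v (mem_head _ _).
by exists (q'.+1 + q); rewrite /= size_cat sv qE mulnDl mulnS; lia.
Qed.

Definition link_up (p q : seq V * seq V) := (p.2, q.1).

Definition connects (D : seq V * seq V) (z : seq V) : bool :=
  lpath k l e (2 * l).+2 (D.1 ++ z ++ D.2).

Lemma lpath_extend q v z h : lpath k l e q.+1 v -> size h = l ->
  connects ((ends l v).2, h) z ->
  exists q', lpath k l e q'.+1 (v ++ z ++ h).
Proof.
move=> lpv sh cz; have sv := lpath_size l2k eP lpv.
exists (q + (2 * l).+2); rewrite -addSn -{1}(cat_take_drop (size v - l) v) -catA.
rewrite lpath_join // ?cat_take_drop ?lpv //.
  by rewrite size_takel ?leq_subr // sv addnK.
by rewrite size_drop subKn // sv leq_addl.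
Qed.

Lemma lpath_chain vs v zs h : size h = l ->
  {in v :: vs, forall u, exists q, lpath k l e q.+1 u} ->
  all2 connects (pairmap link_up (ends l v) (rcons (map (ends l) vs) (h, h))) zs ->
  exists u Q, [/\ perm_eq u (v ++ flatten vs ++ flatten zs), lpath k l e Q.+1 (u ++ h)
    & take l (u ++ h) = take l v].
Proof.
move=> sh; elim: vs v zs => [|v1 vs IH] v [|z zs] //= lp.
  case/andP=> cz; case: zs => // _.
  have [q lpv] := lp v (mem_head _ _); have sv := lpath_size l2k eP lpv.
  have [Q lpQ] := lpath_extend lpv sh cz.
  exists (v ++ z), Q; rewrite cats0 -catA; split=> //.
  by rewrite takel_cat // sv leq_addl.
case/andP=> cz /IH[|u [Q [pu lpu tu]]].
  by move=> u uvs; apply: lp; rewrite inE uvs orbT.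
have [q lpv] := lp v (mem_head _ _); have sv := lpath_size l2k eP lpv.
have [q1 lpv1] : exists q1, lpath k l e q1.+1 v1 by apply: lp; rewrite !inE eqxx orbT.
have sv1 := lpath_size l2k eP lpv1.
have st : size (take l v1) = l by rewrite size_takel // sv1 leq_addl.
have [Q1 lpQ] := lpath_extend lpv st cz; have := lpath_size l2k eP lpQ.
rewrite !size_cat st addnA => /addIn svz.
exists (v ++ z ++ u), (Q1 + Q.+1); split.
- rewrite perm_catCA; apply: (@perm_trans _ (z ++ v ++ v1 ++ flatten vs ++ flatten zs)).
    by rewrite perm_cat2l perm_cat2l.
  by apply/permP => p; rewrite !count_cat; lia.
- rewrite -addSn -!catA (catA v z) -(cat_take_drop l (u ++ h)) tu lpath_join //.
    by rewrite -catA lpQ -tu cat_take_drop.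
  by rewrite size_cat.
by rewrite -!catA takel_cat // sv leq_addl.
Qed.

(** The chain is built towards the first [l] vertices of its own first path, which are not counted
    again in [u]; thus [u ++ take l u] is the cycle cut open. *)
Lemma assemble_cycle e0 es us zs :
  spans (e0 :: es) us -> all2 connects (pairmap link_up e0 (rcons es e0)) zs ->
  exists u Q, [/\ perm_eq u (us ++ flatten zs), size u = Q.+1 * r
    & lpath k l e Q.+1 (u ++ take l u)].
Proof.
move=> [[|v vs] [//= [E1 E2] lp pvs]] czs.
have [q lpv] := lp v (mem_head _ _); have sv := lpath_size l2k eP lpv.
have st : size (take l v) = l by rewrite size_takel // sv leq_addl.
have [|u [Q [pu lpu tu]]] := @lpath_chain vs v zs (take l v) st lp.
  rewrite E1 E2; move: czs; rewrite -!cats1 !pairmap_cat !all2E !size_cat !size_pairmap /=.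
  by rewrite -E1.
have su : size u = Q.+1 * r.
  by have := lpath_size l2k eP lpu; rewrite size_cat st => /addIn.
have tuE : take l u = take l v by rewrite -tu takel_cat // su; nia.
exists u, Q; split=> //; last by rewrite tuE.
apply: perm_trans pu _; rewrite catA perm_cat2r //.
Qed.

Lemma spans_absorb (sat : seq V -> pred (seq V)) (E : seq V -> seq (seq V * seq V))
    (ts ts' Ss : seq (seq V)) :
  uniq ts -> uniq ts' -> {subset ts' <= ts} -> all2 sat Ss ts' ->
  {in ts, forall t, spans (E t) t} ->
  {in Ss & ts, forall S t, sat S t -> spans (E t) (t ++ S)} ->
  spans (flatten (map E ts)) (flatten ts ++ flatten Ss).
Proof.
move=> uts uts' sub satS sp spS.
have [sE /allP sat_zip] : size Ss = size ts' /\ all (fun p => sat p.1 p.2) (zip Ss ts').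
  by move: satS; rewrite all2E => /andP[/eqP].
(* An absorber outside [ts'] has an index out of range and receives the default, the empty
   sequence. *)
pose A t := nth [::] Ss (index t ts').
have sA : {in ts, forall t, spans (E t) (t ++ A t)}.
  move=> t tts; case: (boolP (t \in ts')) => tts'; last first.
    rewrite /A nth_default ?cats0; first exact: sp.
    by rewrite sE leqNgt index_mem.
  have ltS : index t ts' < size Ss by rewrite sE index_mem.
  apply: spS => //; first by rewrite mem_nth.
  have /sat_zip : (A t, t) \in zip Ss ts'.
    apply/(nthP ([::], [::])); exists (index t ts'); first by rewrite size_zip -sE minnn.
    by rewrite nth_zip // nth_index.
  by [].
apply: spans_perm (spans_flatten sA).
have perm_ts := perm_filter_notin uts uts' sub.
have AS : map A ts' = Ss.
  apply: (@eq_from_nth _ [::]); rewrite ?size_map // => i lti.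
  by rewrite (nth_map [::]) // /A index_uniq.
have A0 : flatten (map A [seq t <- ts | t \notin ts']) = [::].
  elim: (ts) => //= t s IH; case: (boolP (t \in ts')) => //= tts'.
  by rewrite IH cats0 /A nth_default // sE leqNgt index_mem.
have /(perm_map A)/perm_flatten := perm_ts.
rewrite map_cat AS flatten_cat A0 cats0 => perm_A.
apply: (@perm_trans _ (flatten ts ++ flatten (map A ts))); last by rewrite perm_cat2l.
elim: (ts) => //= t s IH; apply/permP => p; move/permP: IH => /(_ p).
by rewrite !count_cat; lia.
Qed.

End Assembly.

Lemma uniq_blocks (T : eqType) a (ss : seq (seq T)) : 0 < a ->
  all (fun s => size s == a) ss -> uniq (flatten ss) -> uniq ss.
Proof.
move=> a0; elim: ss => //= s ss IH /andP[/eqP sa /IH {}IH].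
rewrite cat_uniq => /and3P[_ dis /IH ->]; rewrite andbT.
apply: contra dis => s_ss; case: s sa s_ss => [|x s] /= sa s_ss; first by lia.
apply/hasP; exists x; rewrite ?mem_head //.
by apply/flattenP; exists (x :: s); rewrite ?mem_head.
Qed.

Lemma uniq_sub_blocks (T : eqType) (ss ts : seq (seq T)) :
  uniq ss -> uniq (flatten ss) -> uniq ts -> {subset ts <= ss} ->
  uniq (flatten ts) /\ {subset flatten ts <= flatten ss}.
Proof.
move=> uss ufs uts sub; split; last first.
  by move=> x /flattenP[t /sub tss xt]; apply/flattenP; exists t.
have perm_ss := perm_filter_notin uss uts sub.
move: ufs; rewrite (perm_uniq (perm_flatten perm_ss)) flatten_cat cat_uniq.
by case/andP.
Qed.

Lemma mem_pairmap_link (V : eqType) (e0 : seq V * seq V) es D :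
  D \in pairmap (@link_up V) e0 es ->
  exists p q, [/\ p \in e0 :: es, q \in es & D = (p.2, q.1)].
Proof.
elim: es e0 => //= e1 es IH e0; rewrite inE => /predU1P[->|/IH[p [q [pin qin ->]]]].
  by exists e0, e1; rewrite !inE !eqxx.
by exists p, q; split=> //; rewrite inE ?pin ?qin orbT.
Qed.

Lemma size_filter_notin (V : finType) (X : seq V) : uniq X ->
  size [seq x <- enum V | x \notin X] + size X = size (enum V).
Proof.
have sX : {subset X <= enum V} by move=> x; rewrite mem_enum.
by move=> uX; rewrite (perm_size (perm_filter_notin (enum_uniq V) uX sX)) size_cat addnC.
Qed.

(** * The absorption argument with abstract parameters *)

Section Core.
Variables (R : realFieldType) (V : finType) (k l : nat) (e : pred (seq V)).
Hypotheses (l0 : 0 < l) (l2k : 2 * l < k) (eP : edge_pred k e) (V0 : 0 < size (enum V)).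
Local Notation n := (size (enum V)).
Local Notation r := (k - l).
Local Notation spans := (spans k l e).
Local Notation al := (abs_len k l).
Local Notation aq := (conn_len k l (2 * l).+1).

Definition conn_demand (D : seq V * seq V) : Prop :=
  [/\ uniq D.1, size D.1 = l, uniq D.2 & size D.2 = l].

Lemma size_abs_ends t : size (abs_ends k l t : seq (seq V * seq V)) = (abs_long k l).+1.
Proof. by rewrite /abs_ends /=; congr S; elim: (abs_long k l) (drop _ _) => //= m IH G; rewrite IH. Qed.

Lemma spans_demand e0 es us D : spans (e0 :: es) us -> uniq us ->
  D \in pairmap (@link_up V) e0 (rcons es e0) -> conn_demand D.
Proof.
move=> sp uus /mem_pairmap_link[p [q []]]; rewrite !inE !mem_rcons !inE => pin qin ->.
have {}pin : p \in e0 :: es by rewrite inE; move: pin; case: (p == e0).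
have [_ _ u1 s1] := spans_ends l2k eP sp uus pin.
by have [u2 s2 _ _] := spans_ends l2k eP sp uus qin.
Qed.

Variables (bad : pred V) (Na Ma Nr Mr NB X2 : nat).
Let nseg := Na * (abs_long k l).+1 + NB.+1.

Hypothesis absorbers : exists ts : seq (seq V),
  [/\ size ts <= Na, all (fun t => size t == al) ts, uniq (flatten ts),
    {in ts, forall t, exists2 S, size S = r & absorbs k l e S t} &
    forall S, size S = r -> uniq S -> {in S, forall x, ~~ bad x} ->
      Ma <= count (absorbs k l e S) ts].
Hypothesis edges_for : forall B F : seq V, uniq B -> ~~ has (mem F) B ->
  size B <= NB.+1 -> size F <= al * Na ->
  exists es us, [/\ spans es us, size es = size B, size us = k * size B,
    {subset B <= us} & uniq us /\ ~~ has (mem F) us].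
Hypothesis connectors_for : forall (Ds : seq (seq V * seq V)) (F : seq V),
  {in Ds, forall D, conn_demand D} -> size Ds <= nseg -> size F <= al * Na + k * NB.+1 ->
  exists zs : seq (seq V), [/\ size zs = size Ds, all2 (connects k l e) Ds zs, all (fun z => size z == aq) zs,
    uniq (flatten zs) & ~~ has (mem F) (flatten zs)].
Hypothesis reservoir_for : forall F : seq V, size F <= al * Na + k * NB.+1 + aq * nseg ->
  exists rs : seq (seq V), [/\ size rs <= Nr, all (fun z => size z == aq) rs,
    uniq (flatten rs) /\ ~~ has (mem F) (flatten rs) &
    forall D, conn_demand D -> Mr <= count (connects k l e D) rs].
Hypothesis paths_for : forall W : seq V, uniq W ->
  n <= size W + (al * Na + k * NB.+1 + aq * nseg + aq * Nr) ->
  exists Ts : seq (seq V), [/\ {in Ts, forall T, exists q, lpath k l e q.+1 T}, uniq (flatten Ts),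
    {subset flatten Ts <= W}, size W <= size (flatten Ts) + X2 & (size Ts).+1 <= Mr].
Hypotheses (few_bad : size [seq x <- enum V | bad x] <= NB)
  (capacity : X2 + aq * Nr <= r * Ma) (rn : r %| n).

Lemma hamilton_core : exists u Q, [/\ perm_eq u (enum V), size u = Q.+1 * r
  & lpath k l e Q.+1 (u ++ take l u)].
Proof.
have r0 : 0 < r by rewrite subn_gt0; move: l2k; clear; lia.
have aq0 : 0 < aq by rewrite /conn_len mulSn -addnA addn_gt0 r0.
have [ts [sts ats uts absts cnt_ts]] := absorbers.
have [x0 _] : exists x0 : V, x0 \in enum V by case: (enum V) V0 => // x s _; exists x; rewrite mem_head.
(* The extra vertex [x0] guarantees at least one path, hence a first pair of ends [e0]; it accounts
   for [NB.+1]. *)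
pose B := [seq x <- enum V | (bad x || (x == x0)) && (x \notin flatten ts)].
have uB : uniq B by rewrite filter_uniq ?enum_uniq.
have BF : ~~ has (mem (flatten ts)) B.
  by apply/hasPn => x; rewrite mem_filter => /andP[/andP[_ ->]].
have sB : size B <= NB.+1.
  apply: (@leq_trans (size (x0 :: [seq x <- enum V | bad x]))); last by rewrite ltnS.
  apply: uniq_leq_size => // x; rewrite mem_filter => /andP[/andP[bx _] _].
  by rewrite inE mem_filter mem_enum andbT orbC.
have sfts : size (flatten ts) <= al * Na.
  by rewrite (size_flatten_const ats) leq_mul2l sts orbT.
have [esB [usB [spB sesB susB BusB [uusB tsB]]]] := edges_for uB BF sB sfts.
pose esA1 := flatten (map (abs_ends k l) ts).
have spA1 : spans esA1 (flatten ts).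
  suff : spans esA1 (flatten (map id ts)) by rewrite map_id.
  apply: spans_flatten => t tts.
  have [S sS aS] := absts t tts.
  by have [] := absorbs_spans l0 l2k eP sS (eqP (allP ats t tts)) aS.
pose usA := flatten ts ++ usB; have uusA : uniq usA by rewrite cat_uniq uts uusB tsB.
have spA : spans (esA1 ++ esB) usA by apply: spans_cat.
have x0usA : x0 \in usA.
  rewrite mem_cat; case: (boolP (x0 \in flatten ts)) => //= x0ts.
  by apply: BusB; rewrite mem_filter eqxx orbT x0ts mem_enum.
have badA x : bad x -> x \in usA.
  move=> bx; rewrite mem_cat; case: (boolP (x \in flatten ts)) => //= xts.
  by apply: BusB; rewrite mem_filter bx xts mem_enum.
have [e0 [esA' esAE]] : exists e0 esA', esA1 ++ esB = e0 :: esA'.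
  case: (esA1 ++ esB) spA => [|e0 esA' _]; last by exists e0, esA'.
  by case=> -[|v vs] [] // _ _ /perm_mem/(_ x0); rewrite x0usA.
have sesA : (size esA').+1 <= nseg.
  rewrite -[_.+1]/(size (e0 :: esA')) -esAE size_cat sesB leq_add // /esA1.
  rewrite (@size_flatten_const _ (abs_long k l).+1) ?size_map; last first.
    by apply/allP => _ /mapP[t _ ->]; rewrite size_abs_ends.
  by rewrite mulnC leq_mul2r sts orbT.
have susA : size usA <= al * Na + k * NB.+1.
  by rewrite size_cat leq_add // susB leq_mul2l sB orbT.
rewrite esAE in spA.
have demA D : D \in pairmap (@link_up V) e0 esA' -> conn_demand D.
  move=> DA; apply: (spans_demand spA uusA).
  by rewrite -cats1 pairmap_cat mem_cat DA.
have sDA : size (pairmap (@link_up V) e0 esA') <= nseg by rewrite size_pairmap ltnW.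
have [zsA [szsA cA azsA uzsA FzsA]] := connectors_for demA sDA susA.
have sfzA : size (flatten zsA) <= aq * nseg.
  by rewrite (size_flatten_const azsA) szsA leq_mul2l sDA orbT.
have sF : size (usA ++ flatten zsA) <= al * Na + k * NB.+1 + aq * nseg.
  by rewrite size_cat leq_add.
have [rs [srs ars [urs Frs] cnt_rs]] := reservoir_for sF.
have uX : uniq (usA ++ flatten zsA) by rewrite cat_uniq uusA FzsA uzsA.
have uXr : uniq ((usA ++ flatten zsA) ++ flatten rs) by rewrite cat_uniq uX Frs urs.
pose W := [seq x <- enum V | x \notin (usA ++ flatten zsA) ++ flatten rs].
have uW : uniq W by rewrite filter_uniq ?enum_uniq.
have sW := size_filter_notin uXr; rewrite -/W in sW.
have sfrs : size (flatten rs) <= aq * Nr.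
  by rewrite (size_flatten_const ars) leq_mul2l srs orbT.
have nW : n <= size W + (al * Na + k * NB.+1 + aq * nseg + aq * Nr).
  by rewrite -sW leq_add2l size_cat leq_add.
have [Ts [lpT uTs TsW sTs cTs]] := paths_for uW nW.
have spT : spans (map (ends l) Ts) (flatten Ts) by exists Ts.
have dTs : ~~ has (mem ((usA ++ flatten zsA) ++ flatten rs)) (flatten Ts).
  by apply/hasPn => x /TsW; rewrite mem_filter => /andP[].
have [dTX dTr] : ~~ has (mem (flatten Ts)) (usA ++ flatten zsA) /\ ~~ has (mem (flatten Ts)) (flatten rs).
  by move: dTs; rewrite has_sym has_cat negb_or => /andP[].
have [dTA _] : ~~ has (mem (flatten Ts)) usA /\ ~~ has (mem (flatten Ts)) (flatten zsA).
  by move: dTX; rewrite has_cat negb_or => /andP[].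
have uAT : uniq (usA ++ flatten Ts) by rewrite cat_uniq uusA has_sym dTA uTs.
have spAT : spans (e0 :: esA' ++ map (ends l) Ts) (usA ++ flatten Ts).
  by rewrite -cat_cons; apply: spans_cat.
pose DB := pairmap (@link_up V) (last e0 esA') (rcons (map (ends l) Ts) e0).
have DBE : pairmap (@link_up V) e0 (rcons (esA' ++ map (ends l) Ts) e0) =
    pairmap (@link_up V) e0 esA' ++ DB by rewrite rcons_cat pairmap_cat.
have sDB : size DB = (size Ts).+1 by rewrite size_pairmap size_rcons size_map.
have demB : {in DB, forall D, size DB <= count (connects k l e D) rs}.
  move=> D DDB; rewrite sDB; apply: leq_trans cTs (cnt_rs D _).
  by apply: (spans_demand spAT uAT); rewrite DBE mem_cat DDB orbT.
have urs' := uniq_blocks aq0 ars urs.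
have [zsB [szsB uzsB' subB cB]] := distinct_choice urs' demB.
have [uzsB subfB] := uniq_sub_blocks urs' urs uzsB' subB.
have azsB : all (fun z => size z == aq) zsB by apply/allP => z /subB; apply: (allP ars).
pose X := (usA ++ flatten zsA) ++ flatten Ts ++ flatten zsB.
have uXX : uniq X.
  rewrite cat_uniq uX cat_uniq uTs uzsB andbT /= has_cat negb_or has_sym dTX /=.
  apply/andP; split.
    by apply: contra Frs => /hasP[x /subfB xr xX]; apply/hasP; exists x.
  by apply: contra dTr => /hasP[x /subfB xr xX]; apply/hasP; exists x.
pose U := [seq x <- enum V | x \notin X].
have uU : uniq U by rewrite filter_uniq ?enum_uniq.
have sU := size_filter_notin uXX; rewrite -/U in sU.
have sU_le : size U <= r * Ma.
  apply: leq_trans capacity; move: sU sW sTs sfrs; rewrite /X !size_cat.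
  move: (size (flatten Ts)) (size (flatten ts)) (size usB) (size (flatten zsA)) (size (flatten zsB)).
  move: (size (flatten rs)) (size U) (size W) (aq * Nr); clear; lia.
(* A path has [l] vertices modulo [r], a connector has [(2 * l).+2 * r - l], and a cycle has as many
   connectors as paths. So the number of used vertices is a multiple of [r], as is [n]. *)
have [p pE] : exists p, size U = p * r.
  have [q qE] := spans_size l2k eP spAT.
  have szz : size (flatten zsA) + size (flatten zsB) = aq * (size (e0 :: esA' ++ map (ends l) Ts)).
    rewrite (size_flatten_const azsA) (size_flatten_const azsB) szsA szsB sDB /= size_cat size_map.
    by rewrite size_pairmap -mulnDr addnS.
  have /dvdnP[N NE] := rn.
  exists (N - (q + (2 * l).+2 * size (e0 :: esA' ++ map (ends l) Ts))).
  have aqE : aq + l = (2 * l).+2 * r by move: l2k; rewrite /conn_len mulSn; clear; nia.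
  rewrite mulnBl mulnDl -NE mulnAC -aqE mulnDl -sU /X !size_cat.
  move: szz qE; rewrite size_cat [size usA]size_cat.
  move: (size (flatten Ts)) (size (flatten zsA)) (size (flatten zsB)) (size usB) (size (flatten ts)) (size U).
  move: (aq * _) (l * _) (q * r); clear; lia.
pose Ss := reshape (nseq p r) U.
have fSs : flatten Ss = U by rewrite reshapeKr // sumn_nseq pE mulnC.
have shSs : map size Ss = nseq p r by rewrite -[LHS]/(shape Ss) reshapeKl // sumn_nseq pE mulnC.
have sSs : size Ss = p by rewrite -(size_map size) shSs size_nseq.
have p_le : p <= Ma.
  by move: sU_le; rewrite pE mulnC leq_pmul2l.
have SsP S : S \in Ss -> [/\ size S = r, uniq S & {in S, forall x, ~~ bad x}].
  move=> SSs; split.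
  - have : size S \in map size Ss by apply: map_f.
    by rewrite shSs mem_nseq => /andP[_ /eqP].
  - have := perm_uniq (perm_flatten (perm_to_rem SSs)).
    by rewrite fSs uU /= cat_uniq => /esym/andP[].
  move=> x xS; have : x \in U by rewrite -fSs; apply/flattenP; exists S.
  by rewrite mem_filter => /andP[xX _]; apply: contra xX => /badA xA; rewrite /X mem_cat (mem_cat x usA) xA.
have al0 : 0 < al by rewrite /abs_len addn_gt0 l0.
have uts' := uniq_blocks al0 ats uts.
have demS : {in Ss, forall S, size Ss <= count (absorbs k l e S) ts}.
  move=> S /SsP[sS uS bS]; rewrite sSs; by apply: leq_trans p_le (cnt_ts S sS uS bS).
have [ts' [sts' uts'' sub' cS]] := distinct_choice uts' demS.
have spAbs : spans esA1 (flatten ts ++ flatten Ss).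
  apply: (spans_absorb l2k uts' uts'' sub' cS).
    move=> t tts; have [S sS aS] := absts t tts.
    by have [] := absorbs_spans l0 l2k eP sS (eqP (allP ats t tts)) aS.
  move=> S t /SsP[sS _ _] tts aS.
  by have [] := absorbs_spans l0 l2k eP sS (eqP (allP ats t tts)) aS.
rewrite fSs in spAbs.
have spTot : spans (e0 :: esA' ++ map (ends l) Ts) (((flatten ts ++ U) ++ usB) ++ flatten Ts).
  by rewrite -cat_cons -esAE; apply: spans_cat => //; apply: spans_cat.
have cTot : all2 (connects k l e) (pairmap (@link_up V) e0 (rcons (esA' ++ map (ends l) Ts) e0)) (zsA ++ zsB).
  rewrite DBE; elim: (pairmap _ _ _) (zsA) cA => [|D Ds IH] [|z zs] //= /andP[-> /IH]; exact.
have [u [Q [pu su lpu]]] := assemble_cycle l2k eP spTot cTot.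
exists u, Q; split=> //; apply: perm_trans pu _.
apply: (@perm_trans _ (X ++ U)).
  rewrite /X flatten_cat; apply/permP => a; rewrite !count_cat.
  move: (count a (flatten ts)) (count a U) (count a usB) (count a (flatten Ts)).
  by move: (count a (flatten zsA)) (count a (flatten zsB)); clear; lia.
apply: uniq_perm; rewrite ?enum_uniq //.
  by rewrite cat_uniq uXX uU andbT; apply/hasPn => x; rewrite mem_filter => /andP[].
by move=> x; rewrite mem_cat mem_filter mem_enum andbT orbN.
Qed.

End Core.

(** * Balanced families of linear size *)

Section PowerGrowth.
Variable R : realType.
Local Open Scope ring_scope.

Lemma pow_lt_exp K D : (0 < D)%N -> exists N, forall n, (N <= n)%N -> n%:R ^+ K < 2 ^+ (n %/ D) :> R.
Proof.
move=> D0; have D0R : 0 < D%:R :> R by rewrite ltr0n.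
have a0 : 0 < 1 / (2 * D%:R) :> R by rewrite divr_gt0 ?mulr_gt0.
have [N NP] := @exp_beats_poly R _ (1 / 4) K a0 (divr_gt0 ltr01 (ltr0n _ 4)).
exists N => n /NP; set x := 1 / (2 * D%:R) * n%:R => le4.
have e2 : expR (1 / 2) <= 2 :> R.
  have := expR_ge1Dx (- (1 / 2) : R); rewrite expRN => h.
  have e0 := expR_gt0 (1 / 2 : R).
  have : (1 / 2) * expR (1 / 2) <= 1 :> R.
    rewrite -[leRHS](mulVf (lt0r_neq0 e0)) ler_pM2r //; lra.
  lra.
have x_le : x - 1 / 2 <= (n %/ D)%:R * (1 / 2).
  have := ltn_ceil n D0; rewrite -(ltr_nat R) natrM -natr1 => h.
  have {}h : n%:R / D%:R <= (n %/ D)%:R + 1 :> R by rewrite ler_pdivrMr // ltW.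
  rewrite (_ : x = n%:R / D%:R / 2); first by lra.
  by rewrite /x; field; rewrite gt_eqF.
have ex : expR x <= 2 * 2 ^+ (n %/ D).
  rewrite -[x](subrK (1 / 2)) expRD mulrC ler_pM ?expR_ge0 //.
  apply: le_trans (_ : expR ((n %/ D)%:R * (1 / 2)) <= _); first by rewrite ler_expR.
  by rewrite expRM_natl lerXn2r ?nnegrE ?expR_ge0.
have e0 := expR_gt0 x.
have : n%:R ^+ K <= 1 / 4 * expR x.
  by rewrite -ler_pdivrMr // -expRN.
have : 0 < 2 ^+ (n %/ D) :> R by rewrite exprn_gt0.
lra.
Qed.

Lemma pow_le_quarter (x : R) : 0 < x -> x <= 1 -> exists p, (1 - x) ^+ p <= 1 / 4.
Proof.
move=> x0 x1; have [p pP] := nat_above (3 / x); exists p.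
have px : 3 <= p%:R * x by rewrite -ler_pdivrMr.
have h := expR_ge1Dx (p%:R * x).
apply: (@le_trans _ _ (expR (- (p%:R * x)))).
  rewrite -mulrN expRM_natl lerXn2r ?nnegrE ?expR_ge0 //; first by lra.
  exact: expR_ge1Dx.
rewrite expRN -div1r ler_pdivrMr ?expR_gt0 //; lra.
Qed.

(** With [(1 - kappa / 4) ^+ p <= 1 / 4], the total weight falls below [n ^ K * 4 ^- M], hence below
    [2 ^- M] for [M = n %/ D] and large [n]. The ratio [p] between the number of tuples and their
    multiplicity depends on [kappa] alone, so [D] may be chosen afterwards. *)
Lemma balanced_family (kappa : R) : 0 < kappa -> kappa <= 1 ->
  exists p, forall K D, (0 < D)%N -> exists N,
  forall (V : finType) (T : eqType) (sat : T -> pred (seq V)) a (Ds : seq T) (F : seq V),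
    let n := size (enum V) in
    (N <= n)%N -> (0 < n)%N -> (size Ds <= n ^ K)%N ->
    {in Ds, forall D, kappa <= Em (enum V) a (fun t => (sat D t)%:R)} ->
    2 * (a * (a + size F + a * (p * (n %/ D))))%:R <= kappa * n%:R ->
  exists ts, [/\ (size ts <= p * (n %/ D))%N, all (fun t => size t == a) ts,
    uniq (flatten ts) /\ ~~ has (mem F) (flatten ts),
    {in ts, forall t, exists2 D, D \in Ds & sat D t} &
    {in Ds, forall D', (n %/ D <= count (sat D') ts)%N}].
Proof.
move=> k0 k1; have [||p pP] := @pow_le_quarter (kappa / 4); [lra|lra|].
exists p => K D D0; have [N NP] := pow_lt_exp K D0.
exists N => V T sat a Ds F n le_N n0 sDs satD le_n.
have h := NP n le_N; set M := (n %/ D)%N in h le_n *.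
have M0 : 0 < 2 ^+ M :> R by rewrite exprn_gt0.
apply: (balanced_choice n0 k0 satD le_n); rewrite exprM.
apply: (@le_lt_trans _ _ (n%:R ^+ K * (1 / 4) ^+ M)).
  rewrite ler_pM ?exprn_ge0 //; first by lra.
    by rewrite -natrX ler_nat.
  by rewrite lerXn2r ?nnegrE ?exprn_ge0 //; lra.
rewrite (_ : (1 / 4) ^+ M = 2 ^- M / 2 ^+ M :> R); last first.
  by rewrite -invfM -exprMn -exprVn; congr (_ ^+ M); field.
by rewrite mulrCA -[ltRHS]mulr1 ltr_pM2l ?invr_gt0 // ltr_pdivrMr // mul1r.
Qed.

End PowerGrowth.

Section Stages.
Variables (R : realType) (V : finType) (k l : nat) (e : pred (seq V)).
Hypotheses (l2k : (2 * l < k)%N) (eP : edge_pred k e) (V0 : (0 < size (enum V))%N).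
Local Open Scope ring_scope.
Local Notation n := (size (enum V)).
Local Notation E := (Em (R := R) (enum V)).
Local Notation spans := (spans k l e).

Lemma cover_by_edges (cc : R) (B F : seq V) : 0 < cc ->
  (forall x, cc <= link_density R k e (enum V) [:: x]) ->
  uniq B -> ~~ has (mem F) B ->
  (k.-1 * (k.-1 + (size F + size B) + k.-1 * size B))%:R < cc * n%:R ->
  exists es us, [/\ spans es us, size es = size B, size us = (k * size B)%N,
    {subset B <= us} & uniq us /\ ~~ has (mem F) us].
Proof.
move=> cc0 deg uB BF lt_n.
have [||ts [sts sat_ts ats uts tsF]] := @greedy_choice R V V (fun x t => e (x :: t)) k.-1 cc V0 cc0 B (F ++ B).
- move=> x _; have := deg x; rewrite /link_density /= subn1; exact.
- by rewrite size_cat.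
have [tF tB] : ~~ has (mem (flatten ts)) F /\ ~~ has (mem (flatten ts)) B.
  by move: tsF; rewrite has_sym has_cat negb_or => /andP[].
pose vs := [seq p.1 :: p.2 | p <- zip B ts].
have pvs : perm_eq (flatten vs) (B ++ flatten ts).
  rewrite /vs; elim: (B) (ts) sts => [|x B' IH] [|t ts'] //= [sz].
  rewrite perm_cons; apply: perm_trans (_ : perm_eq _ (t ++ B' ++ flatten ts')) _.
    by rewrite perm_cat2l IH.
  by rewrite perm_catCA.
have st : size (flatten ts) = (k.-1 * size B)%N by rewrite (size_flatten_const ats) sts.
exists (map (ends l) vs), (B ++ flatten ts); split.
- exists vs; split=> // _ /mapP[[x t] xt ->]; exists 0%N.
  have : e (x :: t) && (size t == k.-1).
    elim: (B) (ts) sat_ts ats xt => [|y B' IH] [|u ts'] //= /andP[eyu s1] /andP[su a1].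
    by rewrite inE => /predU1P[[-> ->]|/IH]; [rewrite eyu | apply].
  case/andP=> ext /eqP sxt; rewrite (lpath1_edge e l2k) //= sxt prednK //.
  by apply: leq_ltn_trans l2k.
- by rewrite !size_map size_zip sts minnn.
- rewrite size_cat st -mulSn prednK //; exact: leq_ltn_trans l2k.
- by move=> x xB; rewrite mem_cat xB.
- by rewrite cat_uniq uB uts has_sym tB has_cat negb_or BF has_sym tF.
Qed.

End Stages.

Section Lists.
Variables (V : finType).

Definition all_lists m : seq (seq V) := [seq val t | t <- enum {: m.-tuple V}].

Lemma mem_all_lists m s : (s \in all_lists m) = (size s == m).
Proof.
apply/mapP/eqP => [[t _ ->]|sm]; first by rewrite size_tuple.
have st : size s == m by rewrite sm.
by exists (Tuple st); rewrite ?mem_enum.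
Qed.

Lemma size_all_lists m : size (all_lists m) = size (enum V) ^ m.
Proof. by rewrite size_map -cardE card_tuple cardE. Qed.

End Lists.

(** * Choice of the parameters *)

Section SubsetAverages.
Variables (R : realFieldType) (V : eqType).
Local Open Scope ring_scope.

Lemma Sm_filter (W : seq V) (p : pred V) m (f : seq V -> R) :
  Sm [seq x <- W | p x] m f = Sm W m (fun s => (all p s)%:R * f s).
Proof.
elim: m f => [|m IH] f /=; first by rewrite mul1r.
rewrite big_filter big_mkcond; apply: eq_bigr => x _.
case: (p x) => /=; first exact: IH.
by rewrite -(Sm0 R W m); apply: eq_Sm => s _ _; rewrite mul0r.
Qed.

Lemma Sm_perm_eq (W W' : seq V) m (f : seq V -> R) :
  perm_eq W W' -> Sm W m f = Sm W' m f.
Proof.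
move=> pW; elim: m f => //= m IH f; rewrite (perm_big _ pW) /=.
by apply: eq_bigr => x _; apply: IH.
Qed.

End SubsetAverages.

Section PathStage.
Variables (R : realType) (V : finType) (k l : nat) (e : pred (seq V)).
Hypotheses (l0 : (0 < l)%N) (l2k : (2 * l < k)%N) (eP : edge_pred k e) (V0 : (0 < size (enum V))%N).
Local Open Scope ring_scope.
Local Notation n := (size (enum V)).
Local Notation r := (k - l)%N.
Local Notation E := (Em (R := R) (enum V)).
Local Notation A := (link_density R k e).
Local Notation aq := (conn_len k l (2 * l).+1).

Lemma link_density_sub (W v : seq V) : uniq W -> (0 < size W)%N ->
  A (enum V) v <= A W v + ((k - size v) * (n - size W))%:R / n%:R.
Proof.
move=> uW W0; rewrite /link_density; set m := (k - size v)%N.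
pose F := [seq x <- enum V | x \notin W].
have sF : size F = (n - size W)%N by have := size_filter_notin uW; rewrite -/F => <-; rewrite addnK.
have W_n : (size W <= n)%N by rewrite -(size_filter_notin uW) leq_addl.
rewrite -sF; apply: le_trans _ (lerD (lexx _) (Em_mem_le R m F (enum_uniq V) V0)).
have pW : perm_eq W [seq x <- enum V | x \in W].
  apply: uniq_perm => //; first exact/filter_uniq/enum_uniq.
  by move=> x; rewrite mem_filter mem_enum andbT.
apply: (@le_trans _ _ (E m (fun s => (all (mem W) s)%:R * (e (v ++ s))%:R)
   + E m (fun s => (has (mem F) s)%:R))).
  rewrite -EmD; apply: le_Em => s _ _.
  case: (boolP (all _ s)) => [_|/allPn[x xs xW]] /=; first by rewrite mul1r lerDl.
  have -> : has (mem F) s.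
    by apply/hasP; exists x => //=; rewrite mem_filter mem_enum andbT.
  by rewrite mul0r add0r lern1 leq_b1.
rewrite lerD2r /Em -Sm_filter (Sm_perm_eq _ _ pW) ler_wpM2l //.
  by apply: Sm_ge0 => *; apply: ler0n.
rewrite lef_pV2 ?posrE ?exprn_gt0 ?ltr0n //.
by rewrite lerXn2r ?nnegrE ?ler0n // ler_nat.
Qed.

Lemma conn_demandP (kap : R) (D : seq V * seq V) :
  (forall X Y, uniq X -> size X = l -> uniq Y -> size Y = l ->
     kap <= conn R k l e (2 * l).+1 X Y) ->
  conn_demand l D -> kap <= E aq (fun z => (connects k l e D z)%:R).
Proof. by move=> h [u1 s1 u2 s2]; apply: h. Qed.

Lemma cover_rest (g d N0 U X2 Mr : nat) (c gap epsW : R) :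
  (forall W0 : seq V, uniq W0 -> (N0 <= size W0)%N ->
     (forall D, uniq D -> size D = d -> {subset D <= W0} -> c + gap <= A W0 D) ->
     exists Ts : seq (seq V), [/\ {in Ts, forall T, lpath k l e (2 * g) T}, uniq (flatten Ts),
       {subset flatten Ts <= W0}
       & (size W0)%:R <= (size (flatten Ts))%:R + epsW * (size W0)%:R]) ->
  (forall D, uniq D -> size D = d -> c + gap + gap <= A (enum V) D) ->
  (0 < g)%N -> 0 <= epsW -> (U + N0 < n)%N -> ((k - d) * U)%:R <= gap * n%:R ->
  epsW * n%:R <= X2%:R -> (n %/ (2 * g) < Mr)%N ->
  forall W : seq V, uniq W -> (n <= size W + U)%N ->
  exists Ts : seq (seq V), [/\ {in Ts, forall T, exists q, lpath k l e q.+1 T}, uniq (flatten Ts),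
    {subset flatten Ts <= W}, (size W <= size (flatten Ts) + X2)%N & ((size Ts).+1 <= Mr)%N].
Proof.
move=> cover degD g0 eps0 U_n Ugap epsX nMr W uW n_W.
have W0 : (0 < size W)%N by move: U_n n_W; clear; lia.
have W_n : (size W <= n)%N by rewrite -(size_filter_notin uW) leq_addl.
have nR : 0 < n%:R :> R by rewrite ltr0n.
have [||Ts [lpT uT TW sT]] := cover W uW.
- by move: U_n n_W; clear; lia.
- move=> D uD sD _; have := le_trans (degD D uD sD) (link_density_sub D uW W0).
  rewrite sD; have : ((k - d) * (n - size W))%:R / n%:R <= gap.
    rewrite ler_pdivrMr //; apply: le_trans Ugap; rewrite ler_nat leq_mul2l.
    by apply/orP; right; move: n_W; clear; lia.
  lra.
exists Ts; split=> //.
- by move=> T /lpT h; exists (2 * g).-1; rewrite prednK // muln_gt0.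
- rewrite -(ler_nat R) natrD; apply: le_trans sT _; rewrite lerD2l.
  by apply: le_trans epsX; rewrite ler_wpM2l // ler_nat.
- apply: leq_ltn_trans nMr; rewrite leq_divRL ?muln_gt0 //.
  apply: (@leq_trans (size (flatten Ts))); last first.
    apply: leq_trans W_n; exact: uniq_leq_size.
  elim: (Ts) lpT => [|T Ts' IH] lpT //=; rewrite size_cat mulSn leq_add //.
    rewrite (lpath_size l2k eP (lpT T (mem_head _ _))).
    apply: leq_trans (leq_addr _ _); rewrite leq_pmulr // subn_gt0.
    by move: l2k; clear; lia.
  by apply: IH => T' T'in; apply: lpT; rewrite inE T'in orbT.
Qed.

End PathStage.

Section Stage.
Variables (R : realType) (V : finType) (k l d : nat) (e : pred (seq V)).
Hypotheses (l0 : (0 < l)%N) (l2k : (2 * l < k)%N) (eP : edge_pred k e) (V0 : (0 < size (enum V))%N).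
Local Open Scope ring_scope.
Local Notation n := (size (enum V)).
Local Notation r := (k - l)%N.
Local Notation E := (Em (R := R) (enum V)).
Local Notation A := (link_density R k e).
Local Notation al := (abs_len k l).
Local Notation aq := (conn_len k l (2 * l).+1).

Definition families (kap : R) (N M K : nat) : Prop :=
  forall (T : eqType) (sat : T -> pred (seq V)) a (Ds : seq T) (F : seq V),
    (size Ds <= n ^ K)%N ->
    {in Ds, forall D, kap <= E a (fun t => (sat D t)%:R)} ->
    2 * (a * (a + size F + a * N))%:R <= kap * n%:R ->
  exists ts, [/\ (size ts <= N)%N, all (fun t => size t == a) ts,
    uniq (flatten ts) /\ ~~ has (mem F) (flatten ts),
    {in ts, forall t, exists2 D, D \in Ds & sat D t} &
    {in Ds, forall D', (M <= count (sat D') ts)%N}].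

Variables (c cc gap kap th rho ka epsW : R) (Na Ma Nr Mr NB X2 N0 g : nat).
Let U := (al * Na + k * NB.+1 + aq * (Na * (abs_long k l).+1 + NB.+1) + aq * Nr)%N.
Let K1 := (k + 2 * aq)%N.
Hypotheses (cc0 : 0 < cc)
  (deg : forall v, uniq v -> (size v <= l.+1)%N -> cc <= A (enum V) v)
  (degD : forall D, uniq D -> size D = d -> c + gap + gap <= A (enum V) D).
Hypotheses (kap0 : 0 < kap) (kap_le : kap <= conn_density l cc)
  (conn_n : (8 * l * (l.+1 * l.+1))%:R <= cc ^+ 2 * n%:R).
Hypotheses (th0 : 0 < th) (th_n : 4 * cc <= th * n%:R)
  (th3_n : 2 * (l.+1 * l.+1)%:R <= th ^+ 3 * n%:R) (rho0 : 0 < rho)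
  (th_rho : (abs_short k l)%:R * (4 * th / cc) + r%:R * rho <= kap ^+ 2 * cc / 8)
  (cc_n : (4 * l * l)%:R <= n%:R * cc) (l_n : (8 * l * l <= n)%N)
  (ka_le : ka <= abs_density k l cc th kap)
  (NB_ge : 4 * th / (cc * rho) * n%:R <= NB%:R).
Hypotheses (famA : families ka Na Ma r) (famR : families kap Nr Mr (2 * l))
  (ka_n : 2 * (al * (al + al * Na))%:R <= ka * n%:R)
  (U_cc : (K1 * (K1 + U))%:R < cc * n%:R) (U_kap : (K1 * (K1 + U))%:R < kap * n%:R)
  (U_gap : ((k - d) * U)%:R <= gap * n%:R) (U_n : (U + N0 < n)%N).
Hypotheses (g0 : (0 < g)%N) (eps0 : 0 <= epsW) (eps_X : epsW * n%:R <= X2%:R)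
  (g_Mr : (n %/ (2 * g) < Mr)%N) (capacity : (X2 + aq * Nr <= r * Ma)%N) (rn : (r %| n)%N).
Hypothesis cover : forall W0 : seq V, uniq W0 -> (N0 <= size W0)%N ->
  (forall D, uniq D -> size D = d -> {subset D <= W0} -> c + gap <= A W0 D) ->
  exists Ts : seq (seq V), [/\ {in Ts, forall T, lpath k l e (2 * g) T}, uniq (flatten Ts),
    {subset flatten Ts <= W0}
    & (size W0)%:R <= (size (flatten Ts))%:R + epsW * (size W0)%:R].

Lemma hamilton_stage : exists u Q, [/\ perm_eq u (enum V), size u = (Q.+1 * r)%N
  & lpath k l e Q.+1 (u ++ take l u)].
Proof.
have connP X Y : uniq X -> size X = l -> uniq Y -> size Y = l ->
    kap <= conn R k l e (2 * l).+1 X Y.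
  move=> *; apply: le_trans kap_le _; exact: (conn_ge l2k eP V0 cc0 deg).
have aqK : (aq <= K1)%N by apply: leq_trans (leq_pmull _ _) (leq_addl k _).
pose bad := unswappable (R := R) k l e cc th rho.
apply: (@hamilton_core V k l e l0 l2k eP V0 bad Na Ma Nr Mr NB X2) => //.
- pose good := [seq S <- all_lists V r | ~~ has bad S].
  have [|S||ts [sts ats [uts _] hts cts]] := famA (sat := absorbs k l e) (a := al) (Ds := good) (F := [::]).
  + by rewrite -size_all_lists size_filter count_size.
  + rewrite mem_filter mem_all_lists => /andP[/hasPn nb /eqP sS].
    apply: le_trans ka_le _.
    exact: (absorbs_density l0 l2k eP V0 cc0 deg th0 th_n th3_n sS nb kap0 connP th_rho cc_n l_n).
  + by rewrite addn0.
  exists ts; split=> //.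
    move=> t /hts[S]; rewrite mem_filter mem_all_lists => /andP[_ /eqP sS] aS.
    by exists S.
  move=> S sS _ nb; apply: cts; rewrite mem_filter mem_all_lists sS eqxx andbT.
  exact/hasPn.
- move=> B F uB BF sB sF.
  apply: (cover_by_edges l2k V0 cc0 _ uB BF); first by move=> x; apply: deg.
  apply: le_lt_trans U_cc; rewrite ler_nat; apply: leq_mul.
    by apply: leq_trans (leq_pred k) (leq_addr _ _).
  rewrite -addnA leq_add //; first by apply: leq_trans (leq_pred k) (leq_addr _ _).
  rewrite -addnA -mulSn prednK; last by move: l2k; clear; lia.
  rewrite /U -!addnA leq_add // (leq_trans _ (leq_addr _ _)) //.
  by rewrite leq_mul2l sB orbT.
- move=> Ds F dDs sDs sF.
  have [||zs [? ? ? ? ?]] := @greedy_choice R V _ (connects k l e) aq kap V0 kap0 Ds F; last by exists zs.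
    by move=> D /dDs; apply: conn_demandP.
  apply: le_lt_trans U_kap; rewrite ler_nat; apply: leq_mul.
    exact: aqK.
  rewrite -addnA leq_add //.
  apply: leq_trans (leq_addr _ _); rewrite leq_add // leq_mul2l.
  by rewrite sDs orbT.
- move=> F sF.
  pose Ds := [seq p <- [seq (X, Y) | X <- all_lists V l, Y <- all_lists V l] |
    uniq p.1 && uniq p.2].
  have DsP D : reflect (conn_demand l D) (D \in Ds).
    rewrite mem_filter; apply: (iffP andP) => [[uD /allpairsP[[X Y] /= [XV YV ED]]]|[u1 s1 u2 s2]].
      move: uD; rewrite ED /= => /andP[uX uY].
      by move: XV YV; rewrite !mem_all_lists => /eqP sX /eqP sY; split.
    rewrite u1 u2; split=> //; apply/allpairsP; exists D; rewrite !mem_all_lists s1 s2.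
    by case: (D).
  have [|D||rs [srs ars urs _ crs]] := famR (sat := connects k l e) (a := aq) (Ds := Ds) (F := F).
  + rewrite size_filter (leq_trans (count_size _ _)) // size_allpairs !size_all_lists.
    by rewrite -expnD mul2n addnn.
  + by move=> /DsP; apply: conn_demandP.
  + apply: le_trans (ltW U_kap); rewrite -natrM ler_nat mulnA; apply: leq_mul.
      exact: leq_addl.
    rewrite -addnA leq_add //.
    by rewrite leq_add.
  by exists rs; split=> // D dD; apply: crs; apply/DsP.
- exact: (cover_rest l2k eP V0 cover degD g0 eps0 U_n U_gap eps_X g_Mr).
- rewrite -(ler_nat R); apply: le_trans NB_ge.
  exact: (unswappable_le l0 l2k eP V0 cc0 deg th0 th_n th3_n rho0).
Qed.

End Stage.

(** * Arithmetic of the constants *)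

Section Budget.

Lemma mul_div_le a b n : a <= b -> a * (n %/ b) <= n.
Proof. by move=> ab; apply: leq_trans (leq_divM n b); rewrite mulnC leq_mul2l ab orbT. Qed.

Lemma le_mul_div b n : 0 < b -> b <= n -> n <= 2 * b * (n %/ b).
Proof.
move=> b0 bn; have q0 : 0 < n %/ b by rewrite divn_gt0.
by apply: ltnW; apply: leq_trans (ltn_ceil n b0) _; rewrite (mulnAC 2) leq_mul2r; move: q0; clear; lia.
Qed.

(** Each divisor is so large that its class of reserved vertices, scaled by [m], takes at most a
    quarter of [n]; the additive term comes from the successor in [(n %/ D2).+1]. *)
Lemma budget n m a1 a2 a3 p1 p3 D1 D2 D3 :
  4 * (m * (a1 * p1)) <= D1 -> 4 * (m * a2) <= D2 -> 4 * (m * (a3 * p3)) <= D3 ->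
  4 * (m * (a1 * (p1 * (n %/ D1)) + a2 * (n %/ D2).+1 + a3 * (p3 * (n %/ D3))))
    <= 3 * n + 4 * (m * a2).
Proof.
move=> /(mul_div_le n) h1 /(mul_div_le n) h2 /(mul_div_le n) h3.
rewrite mulnS (mulnA a1) (mulnA a3) !mulnDr !mulnA in h1 h2 h3 *; lia.
Qed.

Lemma half_capacity n a r Da Dr : 0 < Da -> 0 < r -> 2 * Da * a <= Dr ->
  n %/ (2 * Da) + a * (n %/ Dr) <= r * (n %/ Da).
Proof.
move=> Da0 r0 /(mul_div_le n) h.
apply: (@leq_trans (n %/ Da)); last by rewrite leq_pmull.
have h1 : 2 * (n %/ (2 * Da)) <= n %/ Da.
  by rewrite leq_divRL // mulnAC mulnC leq_divM.
have h2 : 2 * (a * (n %/ Dr)) <= n %/ Da.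
  by rewrite leq_divRL // mulnAC (mulnA _ a).
by move: h1 h2; clear; lia.
Qed.

Lemma div_lt_div n g Dr : 0 < Dr -> Dr <= g -> Dr <= n -> n %/ (2 * g) < n %/ Dr.
Proof.
move=> Dr0 Dg Dn; have q0 : 0 < n %/ Dr by rewrite divn_gt0.
have g0 : 0 < 2 * g by rewrite muln_gt0 (leq_trans Dr0 Dg).
case: (posnP (n %/ (2 * g))) => [-> //|h].
rewrite leq_divRL //; apply: leq_trans (leq_divM n (2 * g)).
by rewrite mulnA; apply: leq_mul => //; rewrite muln2 -addnn; move: h; clear; lia.
Qed.

Lemma budget_rest m c K u N n : 0 < m -> 4 * (m * u) <= 3 * n + 4 * (m * c) ->
  4 * (m * (c + K)) + 4 * N < n -> m * (K + u) < n /\ u + N < n.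
Proof.
move=> m0; have : u <= m * u by rewrite leq_pmull.
by rewrite !mulnDr; lia.
Qed.

Lemma sumn_cons_le x s n : sumn (x :: s) <= n -> x <= n /\ sumn s <= n.
Proof. by move=> /= h; split; apply: leq_trans h; [apply: leq_addr | apply: leq_addl]. Qed.

Lemma half_sum n a m p q : 4 * (a * a * m * p) * q <= n -> 4 * (a * a * m) <= n ->
  2 * (a * (a + a * (p * q))) * m <= n.
Proof.
have -> : 2 * (a * (a + a * (p * q))) * m = 2 * (a * a * m) + 2 * (a * a * m * p * q) by ring.
rewrite -mulnA; lia.
Qed.

Variable R : realType.
Local Open Scope ring_scope.

Lemma scale_le (a : R) M x n : 0 <= a -> 1 <= a * M%:R -> (x * M <= n)%N -> x%:R <= a * n%:R.
Proof.
move=> a0 aM xMn; apply: (@le_trans _ _ (a * (x * M)%:R)).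
  by rewrite natrM mulrCA ler_peMr ?ler0n.
by rewrite ler_wpM2l // ler_nat.
Qed.

Lemma scale_lt (a : R) M x n : 0 < a -> 1 <= a * M%:R -> (x * M < n)%N -> x%:R < a * n%:R.
Proof.
move=> a0 aM xMn; apply: (@le_lt_trans _ _ (a * (x * M)%:R)).
  by rewrite natrM mulrCA ler_peMr ?ler0n.
by rewrite ltr_pM2l // ltr_nat.
Qed.

Lemma above_inv (a : R) : 0 < a -> exists M, 1 <= a * M%:R.
Proof.
by move=> a0; have [M MP] := nat_above (1 / a); exists M; rewrite mulrC -ler_pdivrMr.
Qed.

Lemma small_positive (a b y : R) : 0 <= a -> 0 <= b -> 0 < y ->
  exists th, [/\ 0 < th, a * th <= y & b * th <= 1].
Proof.
move=> a0 b0 y0; pose s := (a + 1) * (b + 1) * (1 + y).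
have s0 : 0 < s by rewrite !mulr_gt0 //; lra.
exists (y / s); split; first by rewrite divr_gt0.
  rewrite mulrA ler_pdivrMr // mulrC ler_pM2l // /s.
  have h : 0 <= a * b + b + a * b * y + b * y + a * y + y by rewrite !addr_ge0 ?mulr_ge0 // ltW.
  have -> : (a + 1) * (b + 1) * (1 + y) = a + 1 + (a * b + b + a * b * y + b * y + a * y + y) by ring.
  lra.
rewrite mulrA ler_pdivrMr // mul1r /s.
have h : 0 <= a * b + b + a * b * y + a + a * y + y by rewrite !addr_ge0 ?mulr_ge0 // ltW.
have -> : (a + 1) * (b + 1) * (1 + y) = b * y + 1 + (a * b + b + a * b * y + a + a * y + y) by ring.
lra.
Qed.

End Budget.

Section Main.
Variables (R : realType) (k l d : nat) (c gap cc : R).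
Local Open Scope ring_scope.
Hypotheses (l0 : (0 < l)%N) (l2k : (2 * l < k)%N) (dk : (d < k)%N).
Hypotheses (c1 : c <= 1) (gap0 : 0 < gap) (cc0 : 0 < cc).
Hypothesis tiling : forall delta : R, 0 < delta -> exists eta eps : R,
  [/\ 0 < eta, eta <= delta, 0 <= eps, eps <= delta &
    exists m1, forall m (H : kgraph k 'I_m), (m1 <= m)%N ->
      (c - k%:R * eta) * 'C(m, k - d)%:R <= (mindegree d H)%:R ->
      has_almost_tiling (Ygraph k (2 * l)) eps H].
Local Notation r := (k - l)%N.
Local Notation al := (abs_len k l).
Local Notation aq := (conn_len k l (2 * l).+1).

Lemma long_paths_cover g epsW : (0 < g)%N -> 0 < epsW ->
  (k - d)%:R * l%:R <= (2 * g * r + l)%:R * (epsW * gap / 8) ->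
  exists N0, forall (V : finType) e (W0 : seq V), edge_pred k e -> uniq W0 -> (N0 <= size W0)%N ->
    (forall D, uniq D -> size D = d -> {subset D <= W0} -> c + gap <= link_density R k e W0 D) ->
    exists Ts : seq (seq V), [/\ {in Ts, forall T, lpath k l e (2 * g) T}, uniq (flatten Ts),
       {subset flatten Ts <= W0}
       & (size W0)%:R <= (size (flatten Ts))%:R + epsW * (size W0)%:R].
Proof.
move=> g0 eps0 g_ge; set y : R := epsW * gap / 8 in g_ge *.
have y0 : 0 < y by rewrite divr_gt0 // mulr_gt0.
have kd0 : 0 <= 3 * (k - d)%:R :> R by apply: mulr_ge0.
have [delta [dl0 dl1 dl2]] := small_positive kd0 (ler0n R 4) y0.
have [eta [eps [eta0 eta_le eps_ge eps_le til]]] := tiling dl0.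
apply: (@path_cover R k l d g c gap epsW eta eps) => //; try by lra.
apply: le_trans dl1; rewrite -mulrA mulrCA ler_wpM2l //; lra.
Qed.

Lemma hamilton_sequence : exists n0, forall (V : finType) (e : pred (seq V)),
  edge_pred k e -> (n0 <= size (enum V))%N -> (r %| size (enum V))%N ->
  (forall D, uniq D -> size D = d -> c + gap + gap <= link_density R k e (enum V) D) ->
  (forall v, uniq v -> (size v <= l.+1)%N -> cc <= link_density R k e (enum V) v) ->
  exists u Q, [/\ perm_eq u (enum V), size u = (Q.+1 * r)%N & lpath k l e Q.+1 (u ++ take l u)].
Proof.
have r0 : (0 < r)%N by rewrite subn_gt0; move: l2k; clear; lia.
pose kap : R := Num.min 1 (conn_density l cc).
have kap0 : 0 < kap.
  rewrite lt_min ltr01 /conn_density /conn_th.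
  have c20 : 0 < cc / 2 by rewrite divr_gt0.
  have t0 : 0 < cc ^+ 3 / (l%:R *+ 16) by rewrite divr_gt0 ?exprn_gt0 // pmulrn_lgt0 // ltr0n.
  by apply: (mulr_gt0 (mulr_gt0 c20 _) c20); rewrite !exprn_gt0.
have kap1 : kap <= 1 by rewrite ge_min lexx.
have kap_le : kap <= conn_density l cc by rewrite ge_min lexx orbT.
clearbody kap.
(* Through [scale_le] and [scale_lt], the factor [M0] turns inequalities with real constants into
   inequalities between natural numbers. *)
have [M0 [M0cc M0kap M0gap]] : exists M0, [/\ 1 <= cc * M0%:R, 1 <= kap * M0%:R & 1 <= gap * M0%:R].
  have [M1 h1] := above_inv cc0; have [M2 h2] := above_inv kap0; have [M3 h3] := above_inv gap0.
  exists (M1 + M2 + M3)%N; split.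
  - by apply: le_trans h1 _; rewrite ler_pM2l // ler_nat -addnA leq_addr.
  - by apply: le_trans h2 _; rewrite ler_pM2l // ler_nat addnAC leq_addl.
  - by apply: le_trans h3 _; rewrite ler_pM2l // ler_nat leq_addl.
have M00 : (0 < M0)%N.
  by case: (posnP M0) => // M00; move: M0cc; rewrite M00 mulr0 ler10.
pose K1 := (k + 2 * aq)%N; pose c2 := (k + aq)%N; pose a1 := (al + aq * (abs_long k l).+1)%N.
have K10 : (0 < K1)%N by rewrite addn_gt0; move: l2k; clear; lia.
pose Db := (4 * (K1 * M0 * c2)).+1.
(* This makes [r * rho] half of the failure probability [kap ^+ 2 * cc / 8] that absorbers tolerate;
   [th] is chosen for the other half. *)
pose rho := kap ^+ 2 * cc / (16 * r%:R).
have rR : 0 < r%:R :> R by rewrite ltr0n.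
have k2c0 : 0 < kap ^+ 2 * cc by rewrite mulr_gt0 ?exprn_gt0.
have rho0 : 0 < rho by rewrite divr_gt0 // mulr_gt0.
have ccrho0 : 0 < cc * rho by rewrite mulr_gt0.
have [||| th [th0 th1 th2]] := small_positive (a := (abs_short k l)%:R * (4 / cc))
  (b := 4 / (cc * rho) * (2 * Db%:R)) (y := kap ^+ 2 * cc / 16).
- by rewrite mulr_ge0 // divr_ge0 // ltW.
- by rewrite mulr_ge0 // divr_ge0 // ltW.
- by rewrite divr_gt0.
have th_rho : (abs_short k l)%:R * (4 * th / cc) + r%:R * rho <= kap ^+ 2 * cc / 8.
  have -> : r%:R * rho = kap ^+ 2 * cc / 16 by rewrite /rho; field; rewrite gt_eqF.
  have -> : (abs_short k l)%:R * (4 * th / cc) = (abs_short k l)%:R * (4 / cc) * th.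
    by rewrite -!mulrA; congr (_ * (_ * _)); rewrite mulrC.
  lra.
pose ka : R := Num.min 1 (abs_density k l cc th kap).
have ka0 : 0 < ka.
  rewrite lt_min ltr01 /abs_density.
  by rewrite !(mulr_gt0, exprn_gt0, divr_gt0).
have ka1 : ka <= 1 by rewrite ge_min lexx.
have ka_le : ka <= abs_density k l cc th kap by rewrite ge_min lexx orbT.
clearbody ka.
have [Mka Mka1] := above_inv ka0.
have [pa famA] := balanced_family ka0 ka1.
have [pr famR] := balanced_family kap0 kap1.
pose Da := (4 * (K1 * M0 * (a1 * pa)) + 4 * (al * al * Mka * pa)).+1.
pose Dr := (4 * (K1 * M0 * (aq * pr)) + 2 * Da * (aq * pr)).+1.
have [NA famA'] := famA r Da isT.
have [NR famR'] := famR (2 * l)%N Dr isT.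
pose epsW : R := 1 / (4 * Da%:R).
have DaR : 0 < Da%:R :> R by rewrite ltr0n.
have eps0 : 0 < epsW by rewrite divr_gt0 // mulr_gt0.
have [M1 M11] : exists M1, 1 <= (epsW * gap / 8) * M1%:R.
  by apply: above_inv; rewrite divr_gt0 // mulr_gt0.
(* The summand [Dr] keeps the number of paths below the multiplicity of the reservoir; the other one
   makes the final [l] vertices of a path negligible. *)
pose g := (Dr + k * l * M1)%N.
have [||| N0 cover] := @long_paths_cover g epsW => //.
  rewrite -natrM mulrC; apply: (scale_le (M := M1)) => //.
    by rewrite divr_ge0 // mulr_ge0 // ltW.
  apply: leq_trans (leq_addr _ _).
  apply: (@leq_trans (k * l * M1)); first by rewrite !leq_mul2r leq_subr !orbT.
  apply: leq_trans (_ : g <= _)%N; first exact: leq_addl.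
  by rewrite -mulnA mulnCA leq_pmulr // muln_gt0.
have [T1 T1P] := nat_above ((8 * l * (l.+1 * l.+1))%:R / cc ^+ 2).
have [T2 T2P] := nat_above (4 * cc / th).
have [T3 T3P] := nat_above (2 * (l.+1 * l.+1)%:R / th ^+ 3).
have [T4 T4P] := nat_above ((4 * l * l)%:R / cc).
exists (sumn [:: 1; NA; NR; T1; T2; T3; T4; 8 * l * l; Db; 2 * Da; Dr;
  (4 * (K1 * M0 * (c2 + K1)) + 4 * N0).+1; 4 * (al * al * Mka)])%N.
move=> V e eP le_n rn degD deg; set n := size (enum V) in le_n rn *.
move: le_n => /sumn_cons_le[V0] /sumn_cons_le[nNA] /sumn_cons_le[nNR] /sumn_cons_le[nT1]
  /sumn_cons_le[nT2] /sumn_cons_le[nT3] /sumn_cons_le[nT4] /sumn_cons_le[nll]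
  /sumn_cons_le[nDb] /sumn_cons_le[nDa] /sumn_cons_le[nDr] /sumn_cons_le[nK]
  /sumn_cons_le[nal _].
have bud := @budget n (K1 * M0) a1 c2 aq pa pr Da Db Dr.
have {}bud : (4 * (K1 * M0 * (a1 * (pa * (n %/ Da)) + c2 * (n %/ Db).+1 + aq * (pr * (n %/ Dr)))) <=
   3 * n + 4 * (K1 * M0 * c2))%N.
  by apply: bud; rewrite /Da /Db /Dr // leqW // leq_addr.
pose NB := (n %/ Db)%N; pose Na := (pa * (n %/ Da))%N; pose Nr := (pr * (n %/ Dr))%N.
pose U := (al * Na + k * NB.+1 + aq * (Na * (abs_long k l).+1 + NB.+1) + aq * Nr)%N.
have UE : U = (a1 * (pa * (n %/ Da)) + c2 * (n %/ Db).+1 + aq * (pr * (n %/ Dr)))%N.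
  by rewrite /U /a1 /c2 -/Na -/NB -/Nr mulnDl [in RHS]mulnDl mulnDr (mulnC Na) mulnA; clear; lia.
rewrite -UE in bud.
have [Umu UN0] : (K1 * M0 * (K1 + U) < n)%N /\ (U + N0 < n)%N.
  by apply: budget_rest bud nK; rewrite muln_gt0 K10.
rewrite mulnAC in Umu.
have nR : forall T x y, 0 < y -> x / y <= T%:R -> (T <= n)%N -> x <= y * n%:R :> R.
  move=> T x y y0; rewrite ler_pdivrMr // => xT Tn; apply: le_trans xT _.
  by rewrite mulrC ler_pM2l // ler_nat.
apply: (@hamilton_stage R V k l d e l0 l2k eP V0 c cc gap kap th rho ka epsW
  Na (n %/ Da) Nr (n %/ Dr) NB (n %/ (2 * Da)) N0 g) => //.
- by apply: nR T1P nT1; rewrite exprn_gt0.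
- exact: nR T2P nT2.
- by apply: nR T3P nT3; rewrite exprn_gt0.
- by rewrite mulrC; apply: nR T4P nT4.
- have := le_mul_div (isT : (0 < Db)%N) nDb; rewrite -(ler_nat R) !natrM -/NB => h.
  have b0 : 0 <= 4 * th / (cc * rho) by rewrite divr_ge0 ?mulr_ge0 // ltW.
  apply: le_trans (ler_wpM2l b0 h) _; rewrite mulrA -[leRHS]mul1r ler_wpM2r //.
  by move: th2; rewrite mulrAC -(mulrAC 4 th).
- move=> T sat a Ds F sDs satD hn; exact: famA'.
- move=> T sat a Ds F sDs satD hn; exact: famR'.
- rewrite -natrM; apply: scale_le Mka1 _; first exact: ltW.
  have /(mul_div_le n) h : (4 * (al * al * Mka * pa) <= Da)%N by rewrite leqW // leq_addl.
  exact: half_sum h nal.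
- exact: scale_lt cc0 M0cc Umu.
- exact: scale_lt kap0 M0kap Umu.
- apply: scale_le (ltW gap0) M0gap _; apply: leq_trans (ltnW Umu).
  rewrite leq_mul2r; apply/orP; right; apply: leq_mul; last exact: leq_addl.
  by apply: leq_trans (leq_subr _ _) (leq_addr _ _).
- exact: ltW.
- have h := @le_mul_div (2 * Da) n isT nDa; move: h; rewrite -(ler_nat R) natrM => h.
  apply: le_trans (ler_wpM2l (ltW eps0) h) _; rewrite mulrA.
  rewrite (_ : epsW * _ = 1) ?mul1r // /epsW !natrM; field; rewrite gt_eqF //.
- by apply: div_lt_div => //; apply: leq_addr.
- rewrite /Nr mulnA; apply: half_capacity => //.
  by rewrite leqW // leq_addl.
- by move=> W0 uW0 sW0 dW0; apply: cover.
Qed.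

End Main.

(** * Hamilton cycles *)

Section Cycle.
Variables (k l : nat) (V : finType) (H : kgraph k V).
Hypotheses (l0 : 0 < l) (l2k : 2 * l < k).
Local Notation r := (k - l).

(** The two windows together occupy [r + k] consecutive positions. As [u] is at least [2 * k] long,
    they do not also meet around the cycle. *)
Lemma consecutive_rot (u : seq V) i j : uniq u -> 2 * k <= size u ->
  rot j u = rot r (rot i u) -> consecutive k l u i j.
Proof.
move=> uu su rij; rewrite /consecutive /window rij.
have : uniq (rot i u) by rewrite rot_uniq.
have : 2 * k <= size (rot i u) by rewrite size_rot.
move: (rot i u) => v sv; rewrite -(cat_take_drop r v).
set a := take r v; have sa : size a = r by rewrite size_takel //; move: sv; clear; lia.
have : k <= size (drop r v) by rewrite size_drop; move: sv; clear; lia.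
move: (drop r v) => w sw; rewrite -(cat_take_drop k w).
set b := take k w; have sb : size b = k by rewrite size_takel.
rewrite -sa rot_size_cat sa -!catA (take_size_cat _ sb).
have -> : take k (a ++ b ++ drop k w) = a ++ take l b.
  rewrite take_cat sa ltnNge leq_subr /= (_ : k - r = l); last by move: l2k; clear; lia.
  by rewrite takel_cat // sb; move: l2k; clear; lia.
rewrite (drop_size_cat _ sa) eqxx /= => uab.
have -> : [set x in a ++ take l b] :&: [set x in b] = [set x in take l b].
  apply/setP => x; rewrite !inE mem_cat; case: (boolP (x \in take l b)) => [xb|_].
    by rewrite orbT (mem_take xb).
  rewrite orbF; apply/andP => -[xa xb]; move: uab; rewrite cat_uniq => /and3P[_ /hasPn/(_ x)].
  by rewrite mem_cat xb /= xa => /(_ isT).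
have ub : uniq (take l b).
  by apply: take_uniq; move: uab; rewrite catA cat_uniq cat_uniq => /and3P[/and3P[]].
rewrite cardsE (card_uniqP ub) size_takel ?eqxx // sb; move: l2k; clear; lia.
Qed.

(** Only the last window wraps around, by exactly [l] vertices, and [take l u] supplies these. *)
Lemma window_lpath (u : seq V) Q i : 2 * k <= size u -> size u = Q.+1 * r -> i <= Q ->
  window k u (i * r) = take k (drop (i * r) (u ++ take l u)).
Proof.
move=> su sQ iQ; have iu : i * r <= size u by rewrite sQ leq_mul2r leqW ?orbT.
rewrite /window /rot drop_cat ltn_neqAle iu andbT; case: eqP => [E|_].
  move: iQ; have : i == Q.+1.
    rewrite -(eqn_pmul2r (_ : 0 < r)) ?E ?sQ //; move: l2k; clear; lia.
  by move=> /eqP ->; rewrite ltnn.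
rewrite !take_cat size_drop; case: ltnP => // h.
congr (_ ++ _); case: (ltnP i Q) => iQ'.
  exfalso; move: h; rewrite leqNgt => /negP; apply.
  apply: (@leq_trans (2 * r)); first by move: l2k; clear; lia.
  by rewrite sQ -mulnBl leq_mul2r; apply/orP; right; move: iQ'; clear; lia.
have -> : i = Q by apply/eqP; rewrite eqn_leq iQ.
have -> : k - (size u - Q * r) = l by rewrite sQ mulSn addnK; move: l2k; clear; lia.
rewrite !take_takel //.
by move: su; rewrite sQ mulSn; move: l2k; clear; lia.
Qed.

Lemma lcycle_of_lpath (u : seq V) Q : perm_eq u (enum V) -> 2 * k <= #|V| -> size u = Q.+1 * r ->
  lpath k l (edge_of H) Q.+1 (u ++ take l u) -> has_hamilton_lcycle l H.
Proof.
move=> pu kV sQ lp; have su : 2 * k <= size u by rewrite (perm_size pu) -cardE.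
have uu : uniq u by rewrite (perm_uniq pu) enum_uniq.
pose s := [seq i * r | i <- iota 0 Q.+1].
pose C := [set:: [seq [set x in window k u i] | i <- s]].
have CH : C \subset edges H.
  apply/fintype.subsetP => A; rewrite inE => /mapP[_ /mapP[i iQ ->] ->].
  rewrite mem_iota ltnS /= in iQ; rewrite (window_lpath su sQ iQ).
  by have /andP[] := lpath_window lp (iQ : i < Q.+1).
have Ck : {in C, forall A : {set V}, #|A| = k}.
  by move=> A /(fintype.subsetP CH); apply: edges_card.
exists (KGraph Ck); split=> //; exists u, s; split=> //.
- by split=> // x; rewrite (perm_mem pu) mem_enum.
- split.
    apply: (homo_sorted (e := ltn) _ _ (iota_ltn_sorted 0 Q.+1)) => i j ij.
    by rewrite /= ltn_pmul2r // subn_gt0; move: l2k; clear; lia.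
  move=> _ /mapP[i iQ ->]; rewrite mem_iota in iQ.
  by rewrite sQ ltn_pmul2r // subn_gt0; move: l2k; clear; lia.
have path_s m a : a + m = Q -> path (consecutive k l u) (a * r) (rcons [seq i * r | i <- iota a.+1 m] 0).
  elim: m a => [|m IH] a /= aQ.
    rewrite andbT; apply: consecutive_rot => //; rewrite rot0 -rotD -?mulSn.
      by rewrite (_ : a.+1 = Q.+1) -?sQ ?rot_size //; move: aQ; clear; lia.
    by rewrite sQ leq_mul2r; apply/orP; right; move: aQ; clear; lia.
  rewrite IH; last by move: aQ; clear; lia.
  rewrite andbT; apply: consecutive_rot => //; rewrite -rotD -?mulSn //.
  by rewrite sQ leq_mul2r; apply/orP; right; move: aQ; clear; lia.
exact: (path_s Q 0).
Qed.

End Cycle.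

Section Degrees.
Variables (R : realType) (k d : nat) (V : finType) (H : kgraph k V).
Local Open Scope ring_scope.
Local Notation n := (size (enum V)).

Lemma mindegree_le_degree (S : {set V}) : #|S| = d -> (mindegree d H <= degree H S)%N.
Proof.
move=> /eqP sS; rewrite /mindegree; elim: (index_enum _) (mem_index_enum S) => //= A s IH.
rewrite inE big_cons => /predU1P[<-|/IH le_S]; first by rewrite sS geq_minl.
by case: ifP => // _; rewrite geq_min le_S orbT.
Qed.

(** The quotient of falling factorial and power is the probability that a random [s]-tuple is
    injective. *)
Lemma ffact_ge_expn s : (0 < n)%N -> n%:R ^+ s * (1 - (s * s)%:R / n%:R) <= (n ^_ s)%:R :> R.
Proof.
move=> n0; have nR : 0 < n%:R ^+ s :> R by rewrite exprn_gt0 ?ltr0n.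
have : Em (R := R) (enum V) s (fun t => (uniq t)%:R) = (n ^_ s)%:R / n%:R ^+ s.
  rewrite /Em Sm_enum -natr_sum; congr (_%:R / _); rewrite -cardE -card_uniq_tuples -sum1_card.
  rewrite [RHS]big_mkcond; apply: eq_bigr => t _; rewrite inE.
  by have -> : all predT t by apply/allP.
move=> E; rewrite mulrC -ler_pdivlMr // -E lerBlDr.
apply: le_trans _ (lerD (lexx _) (Em_nuniq_le R s (enum_uniq V) n0)).
rewrite -[leLHS](Em_cst s _ n0) -EmD; apply: le_Em => t _ _.
by case: uniq => /=; lra.
Qed.

Lemma link_density_mindegree (t : R) (D : seq V) : (0 < n)%N -> 0 <= t -> uniq D -> size D = d ->
  t * 'C(n, k - d)%:R <= (mindegree d H)%:R ->
  t * (1 - ((k - d) * (k - d))%:R / n%:R) <= link_density R k (edge_of H) (enum V) D.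
Proof.
move=> n0 t0 uD sD tC; have T0 : (0 < #|V|)%N by rewrite cardE.
have := link_density_degree H R T0 uD; rewrite sD -cardE => E.
have nR : 0 < #|V|%:R ^+ (k - d) :> R by rewrite exprn_gt0 ?ltr0n.
rewrite -(ler_pM2r nR) E -mulrA (mulrC (1 - _)).
apply: (@le_trans _ _ (t * (n ^_ (k - d))%:R)).
  by rewrite ler_wpM2l // cardE; apply: ffact_ge_expn.
rewrite -bin_ffact natrM mulrA natrM mulrC ler_wpM2l ?ler0n //.
apply: le_trans tC _; rewrite ler_nat mindegree_le_degree //.
by rewrite cardsE (card_uniqP uD).
Qed.

(** An average over the extensions of [v] to [d] entries; at most a proportion [d * d / n] of them
    has a repetition or meets [v]. *)
Lemma link_density_shorter (c : R) (e : pred (seq V)) (v : seq V) : (0 < n)%N -> 0 <= c -> (d <= k)%N ->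
  (forall D, uniq D -> size D = d -> c <= link_density R k e (enum V) D) ->
  uniq v -> (size v <= d)%N ->
  c * (1 - (d * d)%:R / n%:R) <= link_density R k e (enum V) v.
Proof.
move=> n0 c0 dk degD uv vd; set m := (d - size v)%N.
have nR : 0 < n%:R :> R by rewrite ltr0n.
rewrite /link_density (_ : (k - size v)%N = (m + (k - d))%N); last by move: vd dk; rewrite /m; clear; lia.
rewrite Em_cat; apply: (@le_trans _ _ (Em (R := R) (enum V) m (fun y =>
    c * (1 - (~~ uniq y)%:R - (has (mem v) y)%:R)))).
  rewrite EmZ !EmB Em_cst // ler_wpM2l // -addrA lerD2l -opprD lerN2.
  apply: le_trans (lerD (Em_nuniq_le R m (enum_uniq V) n0) (Em_mem_le R m v (enum_uniq V) n0)) _.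
  rewrite -mulrDl ler_pM2r ?invr_gt0 // -natrD ler_nat -mulnDr subnK // leq_mul2r leq_subr orbT //.
apply: le_Em => y sy _.
have E0 : 0 <= Em (R := R) (enum V) (k - d) (fun z => (e (v ++ y ++ z))%:R).
  by apply: Em_ge0 => *; apply: ler0n.
case: (boolP (uniq y)) => uy /=; last first.
  by apply: le_trans _ E0; rewrite mulr_ge0_le0 //; case: has => /=; lra.
case: (boolP (has _ y)) => vy /=.
  by apply: le_trans _ E0; rewrite mulr_ge0_le0 //; lra.
rewrite !subr0 mulr1; have := degD (v ++ y).
rewrite cat_uniq uv uy vy size_cat sy subnKC // => /(_ isT erefl) /le_trans; apply.
rewrite /link_density size_cat sy subnKC //.
by apply: le_Em => z _ _; rewrite catA.
Qed.

End Degrees.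

Section HamiltonCycles.
Variables (R : realType) (k l d : nat).
Local Open Scope ring_scope.
Hypotheses (l0 : (0 < l)%N) (l2k : (2 * l < k)%N) (ld : (l < d)%N) (dk : (d < k)%N).
Local Notation r := (k - l)%N.

(** The surplus [eta] is spent in quarters: on passing from sets to tuples, on the reserved
    absorbers and connectors, and on the decay allowed by the potential. Half of the last quarter is
    lost to sampling, which leaves [t + eta / 8] for the tiling. *)
Lemma hamilton_of_tiling (t eta : R) : 0 <= t -> 0 < eta -> t + eta <= 1 ->
  (forall delta : R, 0 < delta -> exists eps, [/\ 0 <= eps, eps <= delta &
    exists m1, forall m (H : kgraph k 'I_m), (m1 <= m)%N ->
      (t + eta / 8) * 'C(m, k - d)%:R <= (mindegree d H)%:R ->
      has_almost_tiling (Ygraph k (2 * l)) eps H]) ->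
  exists n0, forall (V : finType) (H : kgraph k V), (n0 <= #|V|)%N -> (r %| #|V|)%N ->
    (t + eta) * 'C(#|V|, k - d)%:R <= (mindegree d H)%:R -> has_hamilton_lcycle l H.
Proof.
move=> t0 eta0 t1 til.
have c1 : t + eta / 4 <= 1 by lra.
have gap0 : 0 < eta / 4 by rewrite divr_gt0.
have [|n0 n0P] := hamilton_sequence l0 l2k dk c1 gap0 gap0.
  move=> delta dl0.
  have [th [th0 th1 th2]] := small_positive (a := 1) (b := k%:R * (8 / eta)) ler01
    (mulr_ge0 (ler0n _ _) (divr_ge0 (ler0n _ _) (ltW eta0))) dl0.
  have [eps [eps0 eps1 [m1 m1P]]] := til delta dl0.
  exists th, eps; split=> //; first by rewrite -[th]mul1r.
  exists m1 => m H le_m le_H; apply: m1P => //; apply: le_trans le_H.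
  rewrite ler_wpM2r //.
  have : k%:R * th <= eta / 8.
    have -> : k%:R * th = k%:R * (8 / eta) * th * (eta / 8) by field; rewrite gt_eqF.
    by rewrite -[leRHS]mul1r ler_wpM2r // divr_ge0 // ltW.
  lra.
have [T1 T1P] := nat_above (((k - d) * (k - d))%:R * (4 / eta)).
exists (sumn [:: n0; T1; (2 * k)%N; (2 * (d * d))%N]) => V H le_n rn degH.
move: le_n => /sumn_cons_le[nn0] /sumn_cons_le[nT1] /sumn_cons_le[nk] /sumn_cons_le[nd _].
have V0 : (0 < size (enum V))%N by rewrite -cardE (leq_trans _ nk) // muln_gt0 (leq_ltn_trans _ dk).
have nR : 0 < #|V|%:R :> R by rewrite ltr0n cardE.
have degD D : uniq D -> size D = d ->
    t + eta / 4 + eta / 4 + eta / 4 <= link_density R k (edge_of H) (enum V) D.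
  move=> uD sD; apply: le_trans (link_density_mindegree V0 _ uD sD (_ : (t + eta) * _ <= _)); last first.
  - by rewrite -cardE.
  - by rewrite addr_ge0 // ltW.
  have : ((k - d) * (k - d))%:R / #|V|%:R <= eta / 4.
    rewrite ler_pdivrMr // mulrC -ler_pdivrMr; last by rewrite divr_gt0.
    by rewrite invf_div; apply: le_trans T1P _; rewrite ler_nat.
  rewrite -cardE; set x := _ / _ => hx.
  have x0 : 0 <= x by rewrite divr_ge0.
  have : (t + eta) * x <= x by rewrite ler_piMl.
  rewrite mulrBr mulr1; lra.
have [||D uD sD|v uv sv|u [Q [pu su lp]]] := n0P V (edge_of H) (edge_ofP H).
- by rewrite -cardE.
- by rewrite -cardE.
- by have := degD D uD sD; lra.
(* Here [c' >= eta / 2], and repetitions cost at most a factor of two; this yields [eta / 4], the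
   value used for [cc]. *)
- pose c' := t + eta / 4 + eta / 4 + eta / 4.
  have c'0 : eta / 2 <= c' by rewrite /c'; lra.
  have c'1 : 0 <= c' by apply: le_trans c'0; rewrite divr_ge0 // ltW.
  apply: le_trans (link_density_shorter V0 c'1 (ltnW dk) degD uv (leq_trans sv ld)).
  have : (d * d)%:R / (size (enum V))%:R <= 1 / 2 :> R.
    rewrite -cardE ler_pdivrMr // mul1r mulrC ler_pdivlMr // -natrM ler_nat mulnC //.
  set x := _ / _ => hx.
  have : c' * (1 / 2) <= c' * (1 - x) by rewrite ler_wpM2l //; lra.
  lra.
exact: lcycle_of_lpath su lp.
Qed.

(** A strict bound on the outer upper limit holds throughout a right neighbourhood of zero, which
    contains some [eps <= delta]. For this [eps], the bound on the inner limit gives a threshold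
    below [tau * 'C(m, k - d)] for all large [m]. *)
Lemma tiling_of_density (tau delta : R) : (tiling_density R k d l < tau%:E)%E -> 0 < delta ->
  exists eps, [/\ 0 <= eps, eps <= delta &
    exists m1, forall m (H : kgraph k 'I_m), (m1 <= m)%N ->
      tau * 'C(m, k - d)%:R <= (mindegree d H)%:R -> has_almost_tiling (Ygraph k (2 * l)) eps H].
Proof.
rewrite /tiling_density limf_esupE => /ereal_inf_lt[_ [A nA <-] supA] dl0.
have [eps [[eps_A eps0] eps1]] : exists eps, (A eps /\ 0 < eps) /\ eps <= delta.
  have : \forall x \near (0 : R)^'+%classic, (A x /\ 0 < x) /\ x <= delta.
    near=> x; split; first split; near: x => //.
    - exact: nbhs_right_gt.
    - exact: nbhs_right_le.
  by move/filter_ex.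
exists eps; split=> //; first exact: ltW.
have : (limf_esup (fun n : nat => ((tiling_threshold k d l n eps)%:R / ('C(n, k - d))%:R : R)%:E) \oo
    < tau%:E)%E.
  by apply: le_lt_trans supA; apply: ereal_sup_ubound; exists eps.
rewrite limf_esupE => /ereal_inf_lt[_ [B [N _ NB] <-] supB].
exists (N + k)%N => m H le_m le_H.
have C0 : (0 < 'C(m, k - d))%N.
  by rewrite bin_gt0; move: le_m; clear; lia.
have : (((tiling_threshold k d l m eps)%:R / ('C(m, k - d))%:R : R)%:E < tau%:E)%E.
  apply: le_lt_trans supB; apply: ereal_sup_ubound; exists m => //.
  by apply: NB => /=; move: le_m; clear; lia.
rewrite lte_fin ltr_pdivrMr ?ltr0n // => lt_tau.
rewrite /tiling_threshold /mindegree_threshold in lt_tau.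
case: ex_minnP lt_tau => T /asboolP TP _ lt_tau; apply: TP.
by rewrite -(ler_nat R) ltW // (lt_le_trans lt_tau).
Unshelve. all: by end_near.
Qed.

Lemma bin_ge s m : (0 < s)%N -> (m <= 'C(s + m, s))%N.
Proof.
case: s => // s _; elim: m => // m IH.
rewrite addnS binS; have : (0 < 'C(s.+1 + m, s))%N by rewrite bin_gt0; clear; lia.
by move: IH; clear; lia.
Qed.

End HamiltonCycles.

(** * Densities *)

Section Density.
Variables (R : realType) (k l d : nat).
Local Open Scope ring_scope.
Hypotheses (l0 : (0 < l)%N) (l2k : (2 * l < k)%N) (ld : (l < d)%N) (dk : (d < k)%N).
Local Notation r := (k - l)%N.
Local Notation bound := (maxe (tiling_density R k d l) (1 / 3)%:E).

Lemma hamilton_of_mindegree (eta : R) : 0 < eta -> exists n0, forall (V : finType) (H : kgraph k V),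
  (n0 <= #|V|)%N -> (r %| #|V|)%N ->
  ((bound + eta%:E) * ('C(#|V|, k - d)%:R)%:E <= (mindegree d H)%:R%:E)%E -> has_hamilton_lcycle l H.
Proof.
move=> eta0; have bin0 (V : finType) : (k <= #|V|)%N -> 0 < 'C(#|V|, k - d)%:R :> R.
  by move=> kV; rewrite ltr0n bin_gt0 (leq_trans (leq_subr _ _) kV).
have : ((1 / 3)%:E <= bound)%E by rewrite le_max lexx orbT.
have : (tiling_density R k d l <= bound)%E by rewrite le_max lexx.
case: bound => [t|_ _|_]; first last.
- by rewrite leeNy_eq.
(* An infinite bound makes the degree condition unsatisfiable, because the binomial coefficient is
   positive. *)
- exists k => V H kV _; rewrite addye // mulyr gtr0_sg ?bin0 // mul1e leye_eq //.
rewrite lee_fin => td t3.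
have t0 : 0 <= t by apply: le_trans t3; rewrite divr_ge0.
have [t1|t1] := leP (t + eta) 1; last first.
  (* No minimum degree exceeds the binomial coefficient, so the condition is again unsatisfiable. *)
  exists k => V H kV _; rewrite -EFinD -EFinM lee_fin => le_H; exfalso.
  have : (mindegree d H)%:R <= 'C(#|V|, k - d)%:R :> R by rewrite ler_nat mindegree_le.
  rewrite leNgt => /negP; apply; apply: lt_le_trans le_H.
  by rewrite ltr_pMl // bin0.
have [|n0 n0P] := hamilton_of_tiling l0 l2k ld dk t0 eta0 t1.
  move=> delta; apply: tiling_of_density => //.
  by apply: le_lt_trans td _; rewrite lte_fin ltrDl divr_gt0.
exists n0 => V H nV rV; rewrite -EFinD -EFinM lee_fin; exact: n0P.
Qed.

(** By minimality, one less than the threshold is below [(t + eta / 2) * C]. The missing unit is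
    covered by [eta / 2 * C], which is at least one for large [n] because [k - d] is positive. *)
Lemma hamilton_density_le : (hamilton_density R k d l <= bound)%E.
Proof.
apply/lee_addgt0Pr => eta eta0.
have eta20 : 0 < eta / 2 by rewrite divr_gt0.
have [n0 n0P] := hamilton_of_mindegree eta20.
have : ((1 / 3)%:E <= bound)%E by rewrite le_max lexx orbT.
move: n0P; case: bound => [t|_ _|]; first last.
- by rewrite leeNy_eq.
- by rewrite addye // leey.
move=> n0P; rewrite lee_fin => t3.
have t0 : 0 <= t by apply: le_trans t3; rewrite divr_ge0.
have [M MP] := nat_above (2 / eta).
rewrite /hamilton_density limf_esupE.
pose A := [set n | (r %| n)%N /\ (n0 + M + k <= n)%N]%classic.
apply: (@le_trans _ _ (ereal_sup
    [set ((hamilton_threshold k d l n)%:R / ('C(n, k - d))%:R : R)%:E | n in A]%classic)).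
  apply: ereal_inf_lbound; exists A => //.
  by exists (n0 + M + k)%N => // n /= le_n rn; split.
apply: ub_ereal_sup => _ [n [rn le_n] <-]; rewrite -EFinD lee_fin.
have CM : M%:R <= 'C(n, k - d)%:R :> R.
  have := @bin_ge (k - d) (n - (k - d)); rewrite subn_gt0 => /(_ dk).
  rewrite subnKC; last by move: le_n; clear; lia.
  by move=> h; rewrite ler_nat; apply: leq_trans h; move: le_n; clear; lia.
have C0 : 0 < 'C(n, k - d)%:R :> R.
  by rewrite ltr0n bin_gt0; move: le_n; clear; lia.
rewrite ler_pdivrMr //; set C : R := 'C(n, k - d)%:R in CM C0 *.
rewrite /hamilton_threshold /mindegree_threshold; case: ex_minnP => T _ T_min.
case: T T_min => [|T] T_min; first by rewrite mulr_ge0 ?addr_ge0 // ltW.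
have lt_T : T%:R < (t + eta / 2) * C.
  rewrite ltNge; apply/negP => le_T.
  suff : (T.+1 <= T)%N by rewrite ltnn.
  apply: T_min; apply/asboolP => H le_H; apply: n0P; rewrite ?card_ord //.
    by move: le_n; clear; lia.
  by rewrite -EFinD -EFinM lee_fin (le_trans le_T) // ler_nat.
have : 1 <= eta / 2 * C.
  rewrite -[leLHS](_ : eta / 2 * (2 / eta) = 1); last by field; rewrite gt_eqF.
  by rewrite ler_pM2l // (le_trans MP).
rewrite -[T.+1%:R]natr1; lra.
Qed.

End Density.

Theorem theorem1p4 (R : realType) (k l d : nat)
    (hl : (1 <= l)%N) (hlk : (2 * l < k)%N)
    (hld : (l < d)%N) (hdk : (d <= k - 1)%N) :
  (forall eta : R, (0 < eta)%R ->
     exists n0 : nat, forall (V : finType) (H : kgraph k V),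
       (n0 <= #|V|)%N -> (k - l %| #|V|)%N ->
       ((maxe (tiling_density R k d l) (1 / 3)%:E + eta%:E)
          * ('C(#|V|, k - d)%:R)%:E <= (mindegree d H)%:R%:E)%E ->
       has_hamilton_lcycle l H) /\
  (hamilton_density R k d l <= maxe (tiling_density R k d l) (1 / 3)%:E)%E.
Proof.
have dk : (d < k)%N by lia.
by split; [apply: hamilton_of_mindegree | apply: hamilton_density_le].
Qed.
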